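(* Let $G$ be a finite $m\times n$ grid. Every initial configuration of $k\ge 3$ robots on distinct nodes of $G$ that is non-partitive and is not a 2S2 configuration is gatherable despite at most one crash fault.
   Context: Model. The $m\times n$ grid is the anonymous grid graph (no node or edge labels). A configuration is a map $f:V(G)\to\{0,1,2\}$ with $f(v)=0$ if $v$ is empty, $1$ if $v$ holds exactly one robot (a singleton), $2$ if $v$ holds at least two robots (a multiplicity). Initially the $k\ge3$ robots occupy distinct nodes. Robots are anonymous, identical, oblivious (no memory of past cycles), cannot communicate, share no coordinate system, orientation or chirality, and all run the same deterministic algorithm. Each robot repeatedly performs Look–Compute–Move cycles: it takes a snapshot of the whole current configuration (global visibility with weak multiplicity detection: it learns $f$ up to the symmetries of the grid), decides deterministically from the snapshot to stay or to move to an adjacent node, and moves instantaneously. The system is fully asynchronous: every non-crashed robot is activated infinitely often, but durations of phases and inactivity are finite, unbounded and adversarial, so a robot may move on the basis of an outdated snapshot. At most one robot may crash, at an adversarially chosen time: it stops forever, remains visible on its node and is indistinguishable from the others. An initial configuration is gatherable despite at most one crash fault if there is such an algorithm such that, in every execution from it (every asynchronous schedule, every choice of at most one crashing robot and crash time), after finite time all non-crashed robots are on a single node and remain there. Partitive: an automorphism of a configuration $(G,f)$ is a graph automorphism $\varphi$ of $G$ with $f(\varphi(v))=f(v)$ for all $v$. A configuration is partitive if it has an automorphism $\varphi$ of order $p>1$ such that every orbit of $V(G)$ under the cyclic group $\langle\varphi\rangle$ has exactly $p$ elements (on grids: a reflection symmetry whose axis contains no node, or a rotational symmetry whose center is not a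 node). MES: for an $n\times n$ grid with $n$ even, the minimum enclosing square (MES) of a configuration is the smallest square subgrid with the same geometric center as the grid containing all occupied nodes; its corners are its four corner nodes. 2S2: a configuration on an $n\times n$ grid with $n$ even is 2S2 if exactly two corners of its MES are occupied, they are diagonally opposite, and the configuration is invariant under the reflection in the diagonal of the MES passing through the two unoccupied corners. *)

(* Defs.v *)
From mathcomp Require Import all_boot all_fingroup.
Set Implicit Arguments. Unset Strict Implicit. Unset Printing Implicit Defensive.

Section Grid.
Variables m n : nat.

Definition node : finType := ('I_m * 'I_n)%type.

Definition adj (u v : node) : bool :=
  ((u.1 == v.1 :> nat) && ((u.2.+1 == v.2 :> nat) || (v.2.+1 == u.2 :> nat)))
  || ((u.2 == v.2 :> nat) && ((u.1.+1 == v.1 :> nat) || (v.1.+1 == u.1 :> nat))).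

Definition is_aut (s : {perm node}) : Prop := forall u v, adj (s u) (s v) = adj u v.

Definition conf k (pos : 'I_k -> node) (v : node) : nat :=
  minn 2 #|[set r | pos r == v]|.

Definition partitive (f : node -> nat) : Prop :=
  exists s : {perm node},
    [/\ is_aut s, (forall v, f (s v) = f v), 1 < #[s]%g
      & forall v, #|porbit s v| = #[s]%g].

(* minimum enclosing square, for square grids (used when m = n):
   the centred square subgrid [a, n-1-a] x [a, n-1-a]. *)
Definition mes_ok (f : node -> nat) (a : nat) : Prop :=
  forall v : node, f v != 0 ->
    [/\ a <= v.1, v.1 <= m.-1 - a, a <= v.2 & v.2 <= n.-1 - a].

Definition is_MES (f : node -> nat) (a : nat) : Prop :=
  mes_ok f a /\ forall b, mes_ok f b -> b <= a.

Definition occupied (f : node -> nat) (i j : nat) : Prop :=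
  exists v : node, [/\ val v.1 = i, val v.2 = j & f v != 0].

Definition inv_transpose (f : node -> nat) : Prop :=
  forall v w : node, val w.1 = val v.2 -> val w.2 = val v.1 -> f w = f v.

Definition inv_antitranspose (f : node -> nat) : Prop :=
  forall v w : node, val w.1 = n.-1 - val v.2 -> val w.2 = n.-1 - val v.1 -> f w = f v.

Definition is_2S2 (f : node -> nat) : Prop :=
  [/\ m = n, ~~ odd n &
    exists a, is_MES f a /\
      let c := n.-1 - a in
      ((occupied f a a /\ occupied f c c /\ ~ occupied f a c /\ ~ occupied f c a
          /\ inv_antitranspose f)
       \/ (occupied f a c /\ occupied f c a /\ ~ occupied f a a /\ ~ occupied f c c
          /\ inv_transpose f))].

(* An algorithm maps a snapshot (configuration, expressed in the robot's local
   frame) and the robot's own node (in that frame) to a destination. *)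
Definition algo := {ffun node -> nat} -> node -> node.

Definition valid_algo (A : algo) : Prop :=
  forall f v, A f v = v \/ adj v (A f v).

Section Exec.
Variable k : nat.

(* state: positions and pending destination (Some d after Look-Compute,
   None when the robot is between cycles) *)
Definition state := (('I_k -> node) * ('I_k -> option node))%type.

Definition crashed_at (crash : option ('I_k * nat)) (r : 'I_k) (t : nat) : bool :=
  if crash is Some (c, tc) then (c == r) && (tc <= t) else false.

Definition never_crashes (crash : option ('I_k * nat)) (r : 'I_k) : bool :=
  if crash is Some (c, _) then c != r else true.

(* snapshot in the local frame phi (a grid automorphism chosen by the adversary) *)
Definition view (pos : 'I_k -> node) (phi : {perm node}) : {ffun node -> nat} :=
  [ffun v => conf pos ((phi^-1)%g v)].

(* one activation of robot r: Look-Compute if idle, Move if a destination is pending *)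
Definition step (A : algo) (s : state) (r : 'I_k) (phi : {perm node}) (crashed : bool)
  : state :=
  let: (pos, pend) := s in
  if crashed then s else
  match pend r with
  | None => (pos, fun r' => if r' == r
                   then Some ((phi^-1)%g (A (view pos phi) (phi (pos r))))
                   else pend r')
  | Some d => (fun r' => if r' == r then d else pos r',
               fun r' => if r' == r then None else pend r')
  end.

Fixpoint run (A : algo) (p0 : 'I_k -> node) (sched : nat -> 'I_k)
  (frame : nat -> {perm node}) (crash : option ('I_k * nat)) (t : nat) : state :=
  match t with
  | 0 => (p0, fun _ => None)
  | t'.+1 => step A (run A p0 sched frame crash t') (sched t') (frame t')
                  (crashed_at crash (sched t') t')
  end.

Definition fair (sched : nat -> 'I_k) (crash : option ('I_k * nat)) : Prop :=
  forall r, never_crashes crash r -> forall t, exists t', t <= t' /\ sched t' = r.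

Definition gathers (A : algo) (p0 : 'I_k -> node) (sched : nat -> 'I_k)
  (frame : nat -> {perm node}) (crash : option ('I_k * nat)) : Prop :=
  exists (T : nat) (g : node), forall t, T <= t ->
    forall r, never_crashes crash r -> (run A p0 sched frame crash t).1 r = g.

Definition gatherable (p0 : 'I_k -> node) : Prop :=
  exists A : algo, valid_algo A /\
    forall sched frame crash,
      (forall t, is_aut (frame t)) -> fair sched crash -> gathers A p0 sched frame crash.

End Exec.
End Grid.

(* Main.v *)
(* All robots compute from the snapshot the same gathering node [T], chosen in a set [X] of
   at most four nodes: the corners of the grid (with the median line in place of the two
   extremal lines of an odd dimension) or, when an even square grid carries a configuration
   with a diagonal symmetry, the corners of its MES. Once [T] is the only multiplicity of
   [X], or the only occupied node of [X], it remains so for ever if robots step towards [T]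
   without entering [X] elsewhere, and then all of them reach [T] whether or not one
   crashes. Before that, at least two robots are allowed to move, so that one crash does
   not block progress, and they are selected so that [T] stays distinguishable within [X]:
   typically an invariant score of the nodes of [X], maximal at [T] initially, becomes
   strictly maximal there at the first move, so that an outdated snapshot still designates
   [T]. The rule depends on how many nodes of [X] are occupied. The 2S2 configurations are those
   where the diagonal symmetry exchanges the only two occupied corners of the MES. *)
Require Import Defs.
From mathcomp Require Import all_boot all_fingroup cyclic.
From mathcomp Require Import zify.
From Stdlib Require Import FunctionalExtensionality ClassicalEpsilon.
Set Implicit Arguments. Unset Strict Implicit. Unset Printing Implicit Defensive.

(** * Asynchronous executions *)

(** The algorithm may depend on the initial configuration, so only states reachable from it matter,
    and a robot may assume any such state that explains its snapshot. This is sound because an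
    automorphism carrying the configuration of one reachable state to that of another will always
    fix [T]. The obstacle is thus not only a symmetry of one configuration but an accidental
    isomorphism between configurations of two different moments. A robot far from [T] may approach
    [T] and another node of X at the same time; steps are therefore constrained by [retreats] until
    they reach the quarter of the box where [T] is nearest. Termination needs no analysis of
    schedules: every proper move brings its robot nearer to [T], so positions freeze, and it remains
    to exclude a frozen state where nobody correct wants to move. Diagonal symmetries of even
    squares need plans of their own, because the node of best score may lie off the axis, where the
    symmetry does not fix it. *)

Section Core.
Variables (m n k : nat).
Implicit Types (pos : 'I_k -> node m n) (pend : 'I_k -> option (node m n)).

Definition upd (A : Type) (f : 'I_k -> A) (r : 'I_k) (a : A) : 'I_k -> A :=
  fun r' => if r' == r then a else f r'.

Lemma upd_id (A : Type) (f : 'I_k -> A) r : upd f r (f r) = f.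
Proof.
by apply: functional_extensionality => r'; rewrite /upd; case: eqP => [->|].
Qed.

Lemma nonincr_stabilizes (M : nat -> nat) :
  (forall t, M t.+1 <= M t) -> exists t0, forall t, t0 <= t -> M t = M t0.
Proof.
move=> dec.
have mono t t' : t <= t' -> M t' <= M t.
  elim: t' => [|t' IH]; first by rewrite leqn0 => /eqP->.
  by rewrite leq_eqVlt ltnS => /orP[/eqP->//|/IH]; apply: leq_trans.
suff gen N t0 : M t0 <= N -> exists t1, forall t, t1 <= t -> M t = M t1.
  exact: (gen (M 0) 0).
elim: N t0 => [|N IH] t0 leN.
  exists t0 => t /mono; lia.
case: (excluded_middle_informative (exists t, t0 <= t /\ M t < M t0)).
  by move=> [t [le_t lt]]; apply: (IH t); lia.
move=> no; exists t0 => t le_t; apply/eqP; rewrite eqn_leq mono //= leqNgt.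
by apply/negP => lt; apply: no; exists t.
Qed.

Section Algorithm.
Variables (T : node m n)
  (J : ('I_k -> node m n) -> ('I_k -> option (node m n)) -> Prop)
  (Al : (node m n -> nat) -> node m n -> node m n -> Prop).

Definition answer (f : {ffun node m n -> nat}) (v w : node m n) : Prop :=
  exists (phi : {perm node m n}) pos pend r u,
    [/\ is_aut phi, J pos pend, forall x, f x = conf pos ((phi^-1)%g x),
        v = phi (pos r) /\ w = phi u & Al (conf pos) (pos r) u].

(* The robot guesses a state satisfying the invariant [J] and a frame which explain
   its snapshot, and follows the rule [Al] there; [Al] commutes with automorphisms, so
   the result does not depend on the guess. *)
Definition plan_algo : algo m n := fun f v =>
  match excluded_middle_informative (exists w, answer f v w) with
  | left ex => proj1_sig (constructive_indefinite_description _ ex)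
  | right _ => v
  end.

End Algorithm.

(* Every proper move decreases [D], so positions are eventually constant; from then on
   each correct robot is told to stay where it is. *)
Lemma gatherable_core (p0 : 'I_k -> node m n) (T : node m n)
    (J : ('I_k -> node m n) -> ('I_k -> option (node m n)) -> Prop)
    (Al : (node m n -> nat) -> node m n -> node m n -> Prop)
    (D : node m n -> nat) :
  J p0 (fun _ => None) ->
  (forall pos pend r d, J pos pend -> Al (conf pos) (pos r) d ->
     d = pos r \/ adj (pos r) d) ->
  (forall pos pend pos' pend' s u u', J pos pend -> J pos' pend' ->
     is_aut s -> (forall v, conf pos' (s v) = conf pos v) ->
     Al (conf pos) u u' -> Al (conf pos') (s u) (s u')) ->
  (forall pos pend r, J pos pend -> exists d, Al (conf pos) (pos r) d) ->
  (forall pos pend r d, J pos pend -> pend r = None ->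
     Al (conf pos) (pos r) d -> J pos (upd pend r (Some d))) ->
  (forall pos pend r d, J pos pend -> pend r = Some d ->
     J (upd pos r d) (upd pend r None)) ->
  (forall pos pend r d, J pos pend -> pend r = Some d ->
     d = pos r \/ D d < D (pos r)) ->
  (forall pos pend (c : option 'I_k), J pos pend ->
     (forall r, Some r != c -> Al (conf pos) (pos r) (pos r)) ->
     forall r, Some r != c -> pos r = T) ->
  gatherable p0.
Proof.
move=> J0 Jadj Jequiv Jtot Jlook Jmove Jdec Jlive.
pose A := plan_algo J Al.
exists A; split.
  move=> f v; rewrite /A /plan_algo.
  case: excluded_middle_informative => [ex|]; last by left.
  case: constructive_indefinite_description => w /= [phi [pos [pend [r [u]]]]].
  move=> [autphi Jp _ [-> ->] Alu].
  by case: (Jadj _ _ _ _ Jp Alu) => [->|ad]; [left | right; rewrite autphi].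
move=> sched frame crash aut_fr fair_s.
pose st t := run A p0 sched frame crash t.
have Alook pos pend r phi : J pos pend -> is_aut phi ->
    Al (conf pos) (pos r) ((phi^-1)%g (A (view pos phi) (phi (pos r)))).
  move=> Jp autphi; rewrite /A /plan_algo.
  case: excluded_middle_informative => [ex|[]]; last first.
    have [u Alu] := Jtot _ _ r Jp.
    exists (phi u), phi, pos, pend, r, u; split=> // x.
    by rewrite /view ffunE.
  case: constructive_indefinite_description => w /= [psi [pos1 [pend1 [r1 [u]]]]].
  move=> [autpsi J1 fE [vE ->] Alu].
  (* [s] carries the guessed state to the actual one: through the guessed frame [psi], then back
     through the real frame [phi]. *)
  pose s := (psi * phi^-1)%g.
  have auts : is_aut s.
    move=> x y; rewrite !permM.
    by rewrite -(autphi ((phi^-1)%g (psi x))) !permKV autpsi.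
  have := Jequiv _ _ _ _ s _ _ J1 Jp auts _ Alu.
  rewrite !permM -vE permK; apply=> v.
  by have := fE (psi v); rewrite /view ffunE permM permK.
have Jst t : J (st t).1 (st t).2.
  elim: t => [|t]; first exact: J0.
  rewrite /st /=; case: (run _ _ _ _ _ t) => [pos pend] /= Jp.
  case: crashed_at => //; case E: (pend _) => [d|] /=; first exact: (Jmove _ _ _ _ Jp E).
  by apply: Jlook => //; apply: Alook Jp _.
(* The sum of the potentials never increases, so it is constant from some time on; each proper move
   would lower it, so positions are then frozen. *)
pose M t := \sum_r D ((st t).1 r).
have pos_step t r : (st t.+1).1 r = (st t).1 r \/ D ((st t.+1).1 r) < D ((st t).1 r).
  move: (Jst t); rewrite /st /=; case: (run _ _ _ _ _ t) => [pos pend] /= Jp.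
  case: crashed_at; first by left.
  case E: (pend _) => [d|] /=; last by left.
  by case: eqP => [->|]; [exact: Jdec Jp E | left].
have pos_le t r : D ((st t.+1).1 r) <= D ((st t).1 r).
  by case: (pos_step t r) => [->|/ltnW].
have [t0 Mconst] : exists t0, forall t, t0 <= t -> M t = M t0.
  by apply: nonincr_stabilizes => t; apply: leq_sum => r _; apply: pos_le.
have posE t : t0 <= t -> (st t).1 = (st t0).1.
  elim: t => [|t IH]; first by rewrite leqn0 => /eqP->.
  rewrite leq_eqVlt => /orP[/eqP->//|]; rewrite ltnS => le_t; rewrite -(IH le_t).
  apply: functional_extensionality => r.
  case: (pos_step t r) => // lt_r; exfalso.
  have: M t.+1 < M t.
    rewrite /M (bigD1 r) //= [X in _ < X](bigD1 r) //= -addSn.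
    by apply: leq_add => //; apply: leq_sum => r' _; apply: pos_le.
  by rewrite !Mconst ?ltnn // ltnW.
have stuck r : never_crashes crash r ->
    Al (conf (st t0).1) ((st t0).1 r) ((st t0).1 r).
  move=> nc.
  have ncr t : sched t = r -> crashed_at crash (sched t) t = false.
    move=> ->; move: nc; rewrite /never_crashes /crashed_at.
    by case: (crash) => [[c tc]|] // /negPf->.
  (* The first activation of [r] from time [t] on: only activations of [r] alter its pending
     destination, which is thus still the one held at [t]. *)
  have next t : exists t', [/\ t <= t', sched t' = r & (st t').2 r = (st t).2 r].
    have /ex_minnP[t' /andP[le_t /eqP sr] minr] : exists t', (t <= t') && (sched t' == r).
      by have [t' [le_t sr]] := fair_s r nc t; exists t'; rewrite le_t sr eqxx.
    exists t'; split=> //.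
    have stay j : j <= t' - t -> (st (t + j)).2 r = (st t).2 r.
      elim: j => [|j IH] le_j; first by rewrite addn0.
      rewrite addnS -IH; last by apply: ltnW.
      have /eqP nr : r != sched (t + j).
        apply/eqP => E; have := minr (t + j); rewrite -E eqxx leq_addr => /(_ isT).
        lia.
      rewrite /st /=; case: (run _ _ _ _ _ (t + j)) => [pos pend] /=.
      case: crashed_at => //; case: (pend _) => [d|] /=;
      by case: eqP => // E; case: nr.
    by have := stay _ (leqnn _); rewrite subnKC.
  have [t1 [le1 sr1 none1]] : exists t1, [/\ t0 <= t1, sched t1 = r & (st t1).2 r = None].
    have [t1 [le1 sr1 _]] := next t0.
    case E: ((st t1).2 r) => [d|]; last by exists t1.
    have none : (st t1.+1).2 r = None.
      move: E; rewrite /st /=; case: (run _ _ _ _ _ t1) => [pos pend] /= E.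
      by rewrite ncr // sr1 E /= eqxx.
    have [t2 [le2 sr2 E2]] := next t1.+1.
    exists t2; rewrite E2; split=> //; lia.
  have [d [some Ald]] : exists d, (st t1.+1).2 r = Some d /\ Al (conf (st t1).1) ((st t1).1 r) d.
    move: none1 (Jst t1); rewrite /st /=; case: (run _ _ _ _ _ t1) => [pos pend] /= E Jp.
    rewrite ncr // sr1 E /= eqxx; eexists; split; first reflexivity.
    exact: Alook Jp _.
  (* The destination computed at [t1] is executed at [t2] without changing any position, so it was
     the current node. *)
  have [t2 [le2 sr2 E2]] := next t1.+1.
  have := posE t2.+1; have := posE t2; rewrite posE // in Ald.
  move: E2; rewrite some /st /=; case: (run _ _ _ _ _ t2) => [pos pend] /= E2.
  rewrite ncr // sr2 E2 /= => p2 p3.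
  move: (p3 ltac:(lia)) => /(congr1 (@^~ r)); rewrite /= eqxx => dE.
  by rewrite dE in Ald.
pose c := if crash is Some (c, _) then Some c else None.
have ncE r : never_crashes crash r = (Some r != c).
  by rewrite /never_crashes /c; case: (crash) => [[c' tc]|] //=; rewrite eq_sym.
exists t0, T => t le_t r; rewrite -/(st t) posE // ncE.
by apply: (Jlive _ _ _ (Jst t0)) => r'; rewrite -ncE; apply: stuck.
Qed.

End Core.

(** * Geometry of the grid *)

Ltac bound u := have ? := ltn_ord u.1; have ? := ltn_ord u.2.

Section Geometry.
Variables (m n : nat).
Local Notation V := (node m n).
Implicit Types (u v w x y T : V) (s : {perm V}).

Definition dist u v : nat :=
  (u.1 - v.1) + (v.1 - u.1) + ((u.2 - v.2) + (v.2 - u.2)).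

Lemma node_eq u v : u.1 = v.1 :> nat -> u.2 = v.2 :> nat -> u = v.
Proof. by case: u v => [a b] [c d] /= /val_inj-> /val_inj->. Qed.

Lemma node_ex i j : i < m -> j < n -> exists v : V, v.1 = i :> nat /\ v.2 = j :> nat.
Proof. by move=> lti ltj; exists (Ordinal lti, Ordinal ltj). Qed.

Lemma node_neq u v : (u != v) = ((u.1 != v.1 :> nat) || (u.2 != v.2 :> nat)).
Proof. by case: u v => [a b] [c d]; rewrite xpair_eqE negb_and. Qed.

Lemma distC u v : dist u v = dist v u.
Proof. rewrite /dist; lia. Qed.

Lemma dist_eq0 u v : dist u v = 0 -> u = v.
Proof. rewrite /dist => h; apply: node_eq; lia. Qed.

Lemma distvv u : dist u u = 0.
Proof. rewrite /dist; lia. Qed.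

Lemma dist_tri u v w : dist u w <= dist u v + dist v w.
Proof. rewrite /dist; lia. Qed.

Lemma dist_lt u v : dist u v < m + n.
Proof. by bound u; bound v; rewrite /dist; lia. Qed.

Lemma adj_dist u v : adj u v = (dist u v == 1).
Proof. rewrite /adj /dist; lia. Qed.

Lemma dist_step u v : 0 < dist u v -> exists w, adj u w /\ dist u v = (dist w v).+1.
Proof.
bound u; bound v; move=> gt0; rewrite /dist in gt0.
case: (ltngtP u.1 v.1) => c1.
- have [||w [w1 w2]] := @node_ex u.1.+1 u.2; try lia.
  exists w; rewrite adj_dist /dist; lia.
- have [||w [w1 w2]] := @node_ex u.1.-1 u.2; try lia.
  exists w; rewrite adj_dist /dist; lia.
case: (ltngtP u.2 v.2) => c2; last lia.
- have [||w [w1 w2]] := @node_ex u.1 u.2.+1; try lia.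
  exists w; rewrite adj_dist /dist; lia.
have [||w [w1 w2]] := @node_ex u.1 u.2.-1; try lia.
exists w; rewrite adj_dist /dist; lia.
Qed.

Lemma is_autV s : is_aut s -> is_aut (s^-1)%g.
Proof. by move=> auts u v; rewrite -auts !permKV. Qed.

(** A shortest path is mapped to a path, so distances do not increase; the same holds for the
    inverse. *)
Lemma aut_dist s u v : is_aut s -> dist (s u) (s v) = dist u v.
Proof.
have le s' u' v' : is_aut s' -> dist (s' u') (s' v') <= dist u' v'.
  move=> auts; have [d] := ubnP (dist u' v'); elim: d u' => // d IH u' ltd.
  case: (posnP (dist u' v')) => [/dist_eq0->|gt0]; first by rewrite distvv.
  have [w [aw dw]] := dist_step gt0.
  have := dist_tri (s' u') (s' w) (s' v').
  have : dist (s' u') (s' w) = 1 by apply/eqP; rewrite -adj_dist auts.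
  have := IH w; lia.
move=> auts; apply/eqP; rewrite eqn_leq le //=.
by have := le _ (s u) (s v) (is_autV auts); rewrite !permK.
Qed.

Definition refl (N : nat) (a : bool) (i : nat) := if a then N.-1 - i else i.

Let absd i j := (i - j) + (j - i).

Let end_refl N a i j : 0 < N -> a = 0 \/ a = N.-1 -> i < N -> j < N ->
  absd i a = j -> i = refl N (a != 0) j.
Proof.
move=> N0 ha ltN ltj E; move: E; rewrite /absd /refl.
by case: (eqVneq a 0) => [-> E|neq E] /=; [|case: ha => ?]; lia.
Qed.

Let end_absd N a b i : i < N -> a = 0 \/ a = N.-1 -> absd a b = N.-1 -> b < N ->
  absd i b = N.-1 - absd i a.
Proof. by rewrite /absd => ? [] -> ? ?; lia. Qed.

(** Opposite corners realise the largest distance, so corners go to corners. A node is then located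
    by its distances to the images of two adjacent corners, which share either a row or, in a square
    grid, a column. *)
Lemma aut_classify s : is_aut s ->
  (exists a b, forall v, (s v).1 = refl m a v.1 :> nat /\ (s v).2 = refl n b v.2 :> nat)
  \/ (m = n /\ exists a b, forall v,
        (s v).1 = refl n a v.2 :> nat /\ (s v).2 = refl m b v.1 :> nat).
Proof.
move=> auts.
case: (posnP m) => [m0|m_gt0].
  by left; exists false, false => v; have := ltn_ord v.1; lia.
case: (posnP n) => [n0|n_gt0].
  by left; exists false, false => v; have := ltn_ord v.2; lia.
have [||A [A1 A2]] := @node_ex 0 0; try lia.
have [||B [B1 B2]] := @node_ex 0 n.-1; try lia.
have [||C [C1 C2]] := @node_ex m.-1 0; try lia.
have [||E [E1 E2]] := @node_ex m.-1 n.-1; try lia.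
have dAE := aut_dist A E auts; have dBC := aut_dist B C auts.
have dAB := aut_dist A B auts; have dAC := aut_dist A C auts.
have cA : ((s A).1 = 0 :> nat \/ (s A).1 = m.-1 :> nat) /\
          ((s A).2 = 0 :> nat \/ (s A).2 = n.-1 :> nat).
  by bound (s A); bound (s E); move: dAE; rewrite /dist; lia.
have cB : ((s B).1 = 0 :> nat \/ (s B).1 = m.-1 :> nat) /\
          ((s B).2 = 0 :> nat \/ (s B).2 = n.-1 :> nat).
  by bound (s B); bound (s C); move: dBC; rewrite /dist; lia.
clear dAE dBC dAC C C1 C2 E E1 E2.
have dA v : absd (s v).1 (s A).1 + absd (s v).2 (s A).2 = v.1 + v.2.
  have := aut_dist v A auts; rewrite /dist A1 A2 /absd => ->; clear; lia.
have dB v : absd (s v).1 (s B).1 + absd (s v).2 (s B).2 = v.1 + (n.-1 - v.2).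
  have := aut_dist v B auts; have ltn := ltn_ord v.2; rewrite /dist B1 B2 /absd => ->.
  clear -n_gt0 ltn; lia.
have {}dAB : absd (s A).1 (s B).1 + absd (s A).2 (s B).2 = n.-1.
  by move: dAB; rewrite /dist A1 A2 B1 B2 /absd; clear; lia.
clear A1 A2 B1 B2; case: cA => a1 a2; case: cB => b1 b2.
have ltv w : (w.1 < m) * (w.2 < n) by split; apply: ltn_ord.
have sum (X Y r c N : nat) : c < N -> Y <= N.-1 -> X + Y = r + c ->
    X + (N.-1 - Y) = r + (N.-1 - c) -> X = r /\ Y = c by clear; lia.
have absd_le N i j : i < N -> j < N -> absd i j <= N.-1 by rewrite /absd; clear; lia.
case: (eqVneq ((s A).1 : nat) ((s B).1 : nat)) => row.
  left; exists ((s A).1 != 0 :> nat), ((s A).2 != 0 :> nat) => v.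
  have {}dAB : absd (s A).2 (s B).2 = n.-1.
    by move: dAB; rewrite row /absd; clear; lia.
  move: (dA v) (dB v).
  rewrite -row (@end_absd n (s A).2 (s B).2 (s v).2) ?ltv // => eA eB.
  have lec : absd (s v).2 (s A).2 <= n.-1 by rewrite absd_le ?ltv.
  have [? ?] := sum _ _ _ _ n (ltn_ord _) lec eA eB.
  by split; apply: end_refl; rewrite ?ltv.
right; have mn : m = n.
  by move: dAB; rewrite /absd; clear -a1 a2 b1 b2 row; lia.
split=> //; exists ((s A).1 != 0 :> nat), ((s A).2 != 0 :> nat) => v.
have col : (s A).2 = (s B).2 :> nat.
  by move: dAB; rewrite /absd; clear -a1 a2 b1 b2 row mn n_gt0; lia.
have {}dAB : absd (s A).1 (s B).1 = m.-1.
  by move: dAB; rewrite col /absd; clear -mn; lia.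
move: (dA v) (dB v).
rewrite -col (@end_absd m (s A).1 (s B).1 (s v).1) ?ltv // => eA eB.
have lec : absd (s v).1 (s A).1 <= m.-1 by rewrite absd_le ?ltv.
have [? ?] : absd (s v).2 (s A).2 = v.1 /\ absd (s v).1 (s A).1 = v.2.
  have ltn := ltn_ord v.2; move: lec eA eB.
  clear -ltn mn; lia.
have rE a i : refl m a i = refl n a i by case: a; rewrite /refl; lia.
have lt1 : v.2 < m by have := ltn_ord v.2; clear -mn; lia.
have lt2 : v.1 < n by have := ltn_ord v.1; clear -mn; lia.
by split; [rewrite -rE | rewrite rE]; apply: end_refl; rewrite ?ltv.
Qed.

End Geometry.

Definition gap (i j : nat) : nat := (i - j) + (j - i).

(** * One coordinate relative to a target line and its mirror image *)

Section Line.
Variables (N t : nat).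
Hypotheses (t_lt : t < N) (t_mid : odd N -> t + t + 1 = N).

Definition ends i := (i == t) || (i + t + 1 == N).
(** When [t] is the median line the first disjunct accepts every coordinate: an odd dimension is
    never restricted by the box. *)
Definition between i :=
  [|| t + t + 1 == N, (t <= i) && (i + t + 1 <= N) | (i <= t) && (N <= i + t + 1)].
Definition near i := (t + t + 1 == N) || (gap i t < gap i (N.-1 - t)).
Definition toward i := if i < t then i.+1 else i.-1.

Lemma toward_gap i : i != t -> gap i t = (gap (toward i) t).+1.
Proof. rewrite /toward /gap; case: ifP; lia. Qed.

Lemma toward_lt i : i < N -> toward i < N.
Proof. rewrite /toward; case: ifP; lia. Qed.

Lemma toward_near i : i < N -> i != t -> near i -> near (toward i).
Proof.
move=> ltN neq; rewrite /near; case: eqP => //= neqm; rewrite /toward /gap.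
case: ifP; lia.
Qed.

Lemma near_ends i : near i -> ends i -> i = t.
Proof. rewrite /near /ends /gap; case: eqP => /=; lia. Qed.

Lemma near_le i x : near i -> ends x -> gap i t <= gap i x ?= iff (x == t).
Proof.
rewrite /near /ends => h ex; apply/leqifP; case: (eqVneq x t) => [->|neq]; first by rewrite eqxx.
by move: h ex; rewrite /gap; lia.
Qed.

Lemma toward_ends i : i < N -> between i -> i != t -> ends (toward i) -> toward i = t.
Proof. move=> ltN; rewrite /between /ends /toward; case: ifP; lia. Qed.

Lemma far_toward_ends i : 2 < gap t (N.-1 - t) -> between i -> ~~ near i -> ~~ ends (toward i).
Proof. rewrite /between /near /ends /toward /gap; case: ifP; lia. Qed.

Lemma far_neq i : ~~ near i -> i != t.
Proof. rewrite /near /gap; lia. Qed.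

(** For even [N] there are no ties, so a far coordinate is at least one unit nearer to the mirror
    line than to [t]. A step towards [t] can at best exchange the two distances, which happens when
    it crosses the median. *)
Lemma far_toward_le i x : between i -> ~~ near i -> ends x ->
  gap i (N.-1 - t) <= gap (toward i) x.
Proof.
have odd_or : odd N \/ exists h, N = h + h.
  by case: (boolP (odd N)) => [|e]; [left | right; exists N./2; lia].
case: odd_or => [/t_mid|[h hE]]; rewrite /between /near /ends /toward /gap; first lia.
case: ifP; lia.
Qed.

Lemma far_toward_lt i x : between i -> ~~ near i -> ~~ near (toward i) -> ends x ->
  gap i (N.-1 - t) < gap (toward i) x.
Proof.
rewrite /near !negb_or -!leqNgt => /or3P b /andP[/eqP neq b1] /andP[_ b2] ex.
have {ex} : x = t \/ x = N.-1 - t by case/orP: ex => /eqP; lia.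
move: b1 b2; rewrite /toward /gap.
have [e eE] : exists e, e + t + 1 = N by exists (N.-1 - t); lia.
have -> : N.-1 - t = e by lia.
rewrite -eE in b neq *; clear eE t_lt t_mid N => b1 b2.
by case: b => [/eqP ?|/andP[? ?]|/andP[? ?]]; case: ltnP b1 b2 => ? ? ? [->|->]; lia.
Qed.

(** Between the two lines, approaching [t] means leaving its mirror image, so the comparison of the
    two distances shifts by two in favour of [t]. *)
Lemma gap_diff i j x : between i -> ends x -> (gap i t = (gap j t).+1) ->
  (gap i j = 1) -> (x = t) \/ (gap j x + gap i t = gap i x + gap j t + 2).
Proof.
move=> b /orP[/eqP->|/eqP ex] e1 e2; first by left.
have [e eE] : exists e, e + t + 1 = N by exists (N.-1 - t); lia.
have -> : x = e by lia.
case: (eqVneq e t) => [->|et]; [by left|right].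
move: b; rewrite /between -eE.
have [jE|jE] : j = i.+1 \/ i = j.+1 by move: e2; rewrite /gap; clear; lia.
  have {}e1 : i < t by move: e1; rewrite jE /gap; clear; lia.
  rewrite jE /gap; clear -e1 et; lia.
have {}e1 : t < i by move: e1; rewrite jE /gap; clear; lia.
rewrite jE /gap; clear -e1 jE et; lia.
Qed.

(** For even [N] the two lines are an odd distance apart, so no coordinate between them is
    equidistant from both; for odd [N] they coincide. *)
Lemma ends_neq i x : ends x -> gap i x = gap i t -> between i -> x = t.
Proof.
have odd_or : odd N \/ exists h, N = h + h.
  by case: (boolP (odd N)) => [|e]; [left | right; exists N./2; lia].
case: odd_or => [/t_mid|[h hE]]; rewrite /between /ends /gap; lia.
Qed.

Lemma between_step i j : between i -> gap i t = (gap j t).+1 -> gap i j = 1 -> between j.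
Proof. rewrite /between /gap; lia. Qed.

(** Distinct lines are an odd distance apart, so a distance of at most two is one, and the far half
    is reduced to the mirror line. *)
Lemma far_small i : gap t (N.-1 - t) <= 2 -> between i -> ~~ near i ->
  i + t + 1 = N /\ gap t (N.-1 - t) = 1.
Proof.
have odd_or : odd N \/ exists h, N = h + h.
  by case: (boolP (odd N)) => [|e]; [left | right; exists N./2; lia].
rewrite /near negb_or -leqNgt => le2 b /andP[/eqP neq]; move: b le2.
have [e eE] : exists e, e + t + 1 = N by exists (N.-1 - t); lia.
have -> : N.-1 - t = e by lia.
case/or3P => [/eqP ?|/andP[? ?]|/andP[? ?]]; case: odd_or => [/t_mid|[h hE]];
  rewrite /gap; lia.
Qed.

End Line.

(** * Corner sets, boxes and safe steps *)

Section Target.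
Variables (m n : nat).
Local Notation V := (node m n).
Implicit Types (u v w x y T : V) (s : {perm V}).

Definition inX T v := ends m T.1 v.1 && ends n T.2 v.2.
Definition inbox T v := between m T.1 v.1 && between n T.2 v.2.
Definition flip1 T : V := (rev_ord T.1, T.2).
Definition flip2 T : V := (T.1, rev_ord T.2).
Definition opp T : V := (rev_ord T.1, rev_ord T.2).
(** These conditions make the set [inX T] and its box invariant under all automorphisms; the last
    one takes care of those that transpose a square grid. *)
Definition centered T :=
  [/\ odd m -> T.1 + T.1 + 1 = m, odd n -> T.2 + T.2 + 1 = n
    & m = n -> T.1 = T.2 :> nat \/ T.1 + T.2 + 1 = n].

Let endsR N (i : 'I_N) : ends N i (rev_ord i).
Proof. by have lt := ltn_ord i; rewrite /ends /= -addnA addn1 subnK ?eqxx ?orbT. Qed.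

Let endsI N i : ends N i i.
Proof. by rewrite /ends eqxx. Qed.

Lemma inX_T T : inX T T.
Proof. by rewrite /inX !endsI. Qed.

Lemma inX_flip1 T : inX T (flip1 T).
Proof. by rewrite /inX endsI endsR. Qed.

Lemma inX_flip2 T : inX T (flip2 T).
Proof. by rewrite /inX endsI endsR. Qed.

Lemma inX_opp T : inX T (opp T).
Proof. by rewrite /inX !endsR. Qed.

Lemma inXP T v : reflect ([\/ v = T, v = flip1 T, v = flip2 T | v = opp T]) (inX T v).
Proof.
have e N (i j : 'I_N) : ends N i j -> j = i \/ j = rev_ord i.
  case/orP => /eqP E; [left|right]; apply: val_inj => //=.
  have lt := ltn_ord i; clear -E lt; move: E lt; lia.
apply: (iffP andP) => [[/e e1 /e e2]|]; last first.
  by case=> ->; apply/andP; [exact: inX_T | exact: inX_flip1 | exact: inX_flip2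
    | exact: inX_opp].
rewrite (surjective_pairing v).
by case: e1 => ->; case: e2 => ->;
  [apply: Or41|apply: Or43|apply: Or42|apply: Or44] => //; case: (T).
Qed.

Lemma refl_ends N t t' a i : t < N -> t' < N -> i < N -> t = t' \/ t + t' + 1 = N ->
  ends N t' i -> ends N t (refl N a i).
Proof. by rewrite /ends /refl; case: a; clear; lia. Qed.

Lemma refl_between N t t' a i : t < N -> t' < N -> i < N -> t = t' \/ t + t' + 1 = N ->
  between N t' i -> between N t (refl N a i).
Proof. by rewrite /between /refl; case: a; clear; lia. Qed.

Lemma aut_inX T s v : centered T -> is_aut s -> inX T v -> inX T (s v).
Proof.
move=> [_ _ cT] /aut_classify[[a [b sE]]|[mn [a [b sE]]]] /andP[x1 x2]; bound T; bound v.
  have [e1 e2] := sE v; rewrite /inX e1 e2.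
  by apply/andP; split; [apply: refl_ends x1 | apply: refl_ends x2]; auto.
have [e1 e2] := sE v; rewrite /inX e1 e2; have {}cT := cT mn.
have {}x1 : ends n T.1 v.1 by move: x1; rewrite /ends; clear -mn; lia.
have {}x2 : ends m T.2 v.2 by move: x2; rewrite /ends; clear -mn; lia.
have re a' i : refl m a' i = refl n a' i by rewrite /refl mn.
rewrite -(re a) (re b); apply/andP; split.
  by apply: refl_ends x2; clear -mn cT; try bound v; bound T; lia.
by apply: refl_ends x1; clear -mn cT; try bound v; bound T; lia.
Qed.

Lemma aut_inbox T s v : centered T -> is_aut s -> inbox T v -> inbox T (s v).
Proof.
move=> [_ _ cT] /aut_classify[[a [b sE]]|[mn [a [b sE]]]] /andP[x1 x2]; bound T; bound v.
  have [e1 e2] := sE v; rewrite /inbox e1 e2.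
  by apply/andP; split; [apply: refl_between x1 | apply: refl_between x2]; auto.
have [e1 e2] := sE v; rewrite /inbox e1 e2; have {}cT := cT mn.
have {}x1 : between n T.1 v.1 by move: x1; rewrite /between; clear -mn; lia.
have {}x2 : between m T.2 v.2 by move: x2; rewrite /between; clear -mn; lia.
have re a' i : refl m a' i = refl n a' i by rewrite /refl mn.
rewrite -(re a) (re b); apply/andP; split.
  by apply: refl_between x2; clear -mn cT; try bound v; bound T; lia.
by apply: refl_between x1; clear -mn cT; try bound v; bound T; lia.
Qed.

Definition dominated T u := forall x, inX T x -> x != T -> dist u T < dist u x.
(** The facing corner [opp T] has this property when no dimension is degenerate; the metric form is
    transported by automorphisms fixing [T]. *)
Definition antipodal T y := forall v, inbox T v -> dist y v + dist v T = dist y T.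

(* While outside the quarter dominated by [T], a robot must not get closer to the
   nearest element of [inX T]; stagnation is allowed only when leaving the quarter
   of the antipode, where the move that crosses the median line is neutral. *)
Definition retreats T u u' := forall x, inX T x -> exists y,
  [/\ inX T y, dist y u <= dist x u' & dist y u = dist x u' -> antipodal T y].

(** The third condition leaves [T] as the only node of [inX T] that can be entered. The fourth
    allows distances reached after any number of steps to be compared with the initial ones. *)
Definition step T u u' :=
  [/\ adj u u', dist u' T < dist u T, inX T u' -> u' = T
    & dominated T u' \/ retreats T u u'].

(* In a 2 x 2 box every step from the corner opposite to [T] enters another corner. *)
Definition inW T u := inbox T u &&
  ~~ [&& gap T.1 (m.-1 - T.1) == 1, gap T.2 (n.-1 - T.2) == 1 & u == opp T].

Lemma distE u v : dist u v = gap u.1 v.1 + gap u.2 v.2.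
Proof. by []. Qed.

Lemma gapC i j : gap i j = gap j i.
Proof. by rewrite /gap addnC. Qed.

Lemma near_dominated T u : centered T -> near m T.1 u.1 -> near n T.2 u.2 -> dominated T u.
Proof.
move=> [odm odn _] h1 h2 x /andP[x1 x2]; rewrite node_neq !distE.
have [le1 e1] := near_le (ltn_ord T.1) odm h1 x1; have [le2 e2] := near_le (ltn_ord T.2) odn h2 x2.
by rewrite -e1 -e2; clear -le1 le2; lia.
Qed.

Lemma revE (N t : nat) : N - t.+1 = N.-1 - t.
Proof. lia. Qed.

Lemma opposite_gap (N t i : nat) : t < N -> between N t i -> t + t + 1 != N ->
  gap (N - t.+1) i + gap i t = gap (N - t.+1) t.
Proof. rewrite /between /gap; lia. Qed.

(** Near [T] in both coordinates, any approach stays in the quarter dominated by [T]. Far in exactly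
    one, that coordinate moves. Far in both, the move follows a side longer than two, so that no
    other corner is entered; if both sides are short, [u] is the corner of a 2 x 2 box which [inW]
    excludes. *)
Lemma step_exists T u : centered T -> inW T u -> u != T -> exists u', step T u u'.
Proof.
move=> cent; have [odm odn _] := cent; move=> /andP[/andP[b1 b2] Wu] uT.
bound u; bound T.
pose row := toward T.1 u.1; pose col := toward T.2 u.2.
have rowlt : row < m by apply: toward_lt.
have collt : col < n by apply: toward_lt.
have [R [R1 R2]] := node_ex rowlt (ltn_ord u.2).
have [C [C1 C2]] := node_ex (ltn_ord u.1) collt.
have adjR : u.1 != T.1 :> nat -> adj u R /\ dist R T < dist u T.
  move=> neq; have := toward_gap (ltn_ord T.1) odm neq; rewrite -/row.
  rewrite adj_dist !distE R1 R2 => e.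
  have e1 : gap u.1 row = 1.
    by rewrite /row /toward; clear -neq; rewrite /gap; case: ifP; lia.
  by rewrite e1 e /gap; clear; lia.
have adjC : u.2 != T.2 :> nat -> adj u C /\ dist C T < dist u T.
  move=> neq; have := toward_gap (ltn_ord T.2) odn neq; rewrite -/col.
  rewrite adj_dist !distE C1 C2 => e.
  have e1 : gap u.2 col = 1.
    by rewrite /col /toward; clear -neq; rewrite /gap; case: ifP; lia.
  by rewrite e1 e /gap; clear; lia.
case: (boolP (near m T.1 u.1)) => n1; case: (boolP (near n T.2 u.2)) => n2.
- case: (eqVneq (u.1 : nat) T.1) => neq.
    have neq2 : u.2 != T.2 :> nat by move: uT; rewrite node_neq neq eqxx.
    have [? ?] := adjC neq2; exists C.
    have dC : dominated T C.
      by apply: near_dominated; rewrite ?C1 ?C2 //; apply: toward_near.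
    split=> //; last by left.
    move=> /andP[x1 x2]; apply: node_eq; first by rewrite C1.
    rewrite C2 in x2 *; apply: toward_ends x2 => //.
  have [? ?] := adjR neq; exists R.
  have dR : dominated T R.
    by apply: near_dominated; rewrite ?R1 ?R2 //; apply: toward_near.
  split=> //; last by left.
  move=> /andP[x1 x2]; apply: node_eq.
    rewrite R1 in x1 *; apply: toward_ends x1 => //.
  by rewrite R2 in x2 *; apply: near_ends x2.
- have neq := far_neq (ltn_ord T.2) odn n2; have [? ?] := adjC neq; exists C; split=> //.
    move=> /andP[x1 x2]; apply: node_eq.
      by rewrite C1 in x1 *; apply: near_ends x1.
    rewrite C2 in x2 *; apply: toward_ends x2 => //.
  case: (boolP (near n T.2 col)) => nc.
    by left; apply: near_dominated; rewrite ?C1 ?C2.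
  right=> x /andP[x1 x2]; exists (flip2 T).
  have lt : dist (flip2 T) u < dist x C.
    rewrite !distE C1 C2 /= ![gap _ u.1]gapC ![gap _ u.2]gapC [gap x.2 _]gapC.
    have [le1 _] := near_le (ltn_ord T.1) odm n1 x1; have := far_toward_lt (ltn_ord T.2) odn b2 n2 nc x2.
    by rewrite revE -addnS => lt2; apply: leq_add.
  split; [|exact: ltnW|by move=> E; rewrite E ltnn in lt].
  exact: inX_flip2.
- have neq := far_neq (ltn_ord T.1) odm n1; have [? ?] := adjR neq; exists R; split=> //.
    move=> /andP[x1 x2]; apply: node_eq; last by rewrite R2 in x2 *; apply: near_ends x2.
    rewrite R1 in x1 *; apply: toward_ends x1 => //.
  case: (boolP (near m T.1 row)) => nc.
    by left; apply: near_dominated; rewrite ?R1 ?R2.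
  right=> x /andP[x1 x2]; exists (flip1 T).
  have lt : dist (flip1 T) u < dist x R.
    rewrite !distE R1 R2 /= ![gap _ u.1]gapC ![gap _ u.2]gapC [gap x.1 _]gapC.
    have [le1 _] := near_le (ltn_ord T.2) odn n2 x2; have := far_toward_lt (ltn_ord T.1) odm b1 n1 nc x1.
    by rewrite revE -addSn => lt2; apply: leq_add.
  split; [|exact: ltnW|by move=> E; rewrite E ltnn in lt].
  exact: inX_flip1.
(* Far in both coordinates: [opp T] is the corner nearest to [u], and the step away from it gives
   the weak form of [retreats]. *)
have aopp : antipodal T (opp T).
  move=> v /andP[v1 v2]; bound v; rewrite !distE /=.
  have m1 : T.1 + T.1 + 1 != m by move: n1; rewrite /near negb_or => /andP[].
  have m2 : T.2 + T.2 + 1 != n by move: n2; rewrite /near negb_or => /andP[].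
  by rewrite -(opposite_gap (ltn_ord _) v1) // -(opposite_gap (ltn_ord _) v2) // addnACA.
have rt w : adj u w -> (w = C \/ w = R) -> retreats T u w.
  move=> _ wCR x Xx; exists (opp T); split=> //; first exact: inX_opp.
  case/andP: Xx => x1 x2; rewrite ![dist _ u]distC ![dist x w]distC !distE /=.
  rewrite !revE.
  have far N t i z : t < N -> ends N t z -> between N t i -> ~~ near N t i ->
      gap i (N.-1 - t) <= gap i z.
    rewrite /ends /between /near; clear => lt ez b; rewrite negb_or -leqNgt.
    have [->|->] : z = t \/ z = N.-1 - t by lia.
      by case/andP.
    by [].
  case: wCR => ->; [rewrite C1 C2|rewrite R1 R2]; apply: leq_add;
    by [apply: far | apply: far_toward_le].
case: (ltnP 2 (gap T.2 (n.-1 - T.2))) => [big|small2].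
  have [aC ?] := adjC (far_neq (ltn_ord T.2) odn n2); exists C; split=> //; last by right; apply: rt; [|left].
  by case/andP=> _; rewrite C2 (negPf (far_toward_ends (ltn_ord T.2) odn big b2 n2)).
case: (ltnP 2 (gap T.1 (m.-1 - T.1))) => [big|small1].
  have [aR ?] := adjR (far_neq (ltn_ord T.1) odm n1); exists R; split=> //; last by right; apply: rt; [|right].
  by case/andP; rewrite R1 (negPf (far_toward_ends (ltn_ord T.1) odm big b1 n1)).
have [e1 g1] := far_small (ltn_ord T.1) odm small1 b1 n1.
have [e2 g2] := far_small (ltn_ord T.2) odn small2 b2 n2.
case/negP: Wu; rewrite g1 g2 !eqxx /=; apply/eqP/node_eq; [clear -e1; move: e1 | clear -e2; move: e2]; rewrite /=; lia.
Qed.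

Lemma step_coord T u u' : adj u u' -> dist u' T < dist u T ->
  [/\ u'.2 = u.2 :> nat, gap u.1 T.1 = (gap u'.1 T.1).+1 & gap u.1 u'.1 = 1] \/
  [/\ u'.1 = u.1 :> nat, gap u.2 T.2 = (gap u'.2 T.2).+1 & gap u.2 u'.2 = 1].
Proof.
rewrite adj_dist !distE => /eqP adj1 lt.
have [[e1 e2]|[e1 e2]] : (gap u.1 u'.1 = 0 /\ gap u.2 u'.2 = 1) \/
    (gap u.1 u'.1 = 1 /\ gap u.2 u'.2 = 0) by clear -adj1; lia.
  have e : u'.1 = u.1 :> nat by move: e1; rewrite /gap; clear; lia.
  by right; split=> //; move: lt e2; rewrite e /gap; clear; lia.
have e : u'.2 = u.2 :> nat by move: e2; rewrite /gap; clear; lia.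
by left; split=> //; move: lt e1; rewrite e /gap; clear; lia.
Qed.

Lemma step_inW T u u' : centered T -> inW T u -> step T u u' -> inW T u'.
Proof.
move=> [odm odn _] /andP[/andP[b1 b2] Wu] [au lt noX _].
apply/andP; split; last first.
  apply/negP => /and3P[g1 g2 /eqP E].
  have := noX; rewrite E => /(_ (inX_opp T)) ET.
  have /(congr1 (fun v : V => v.1 : nat)) := ET; rewrite /= => E1.
  by rewrite -revE E1 /gap subnn in g1.
have [[e1 e2 e3]|[e1 e2 e3]] := step_coord au lt.
  by rewrite /inbox e1 b2 (between_step (ltn_ord _) odm b1 e2 e3).
by rewrite /inbox e1 b1 (between_step (ltn_ord _) odn b2 e2 e3).
Qed.

(** If [x] and [T] differ in the coordinate that moves, the comparison shifts by two. Otherwise they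
    differ in the other coordinate only, where equidistance is impossible, so the weak inequality
    was already strict. *)
Lemma step_closer T u u' x : centered T -> inW T u -> step T u u' -> inX T x -> x != T ->
  dist u T <= dist u x -> dist u' T < dist u' x.
Proof.
move=> [odm odn _] /andP[/andP[b1 b2] _] [au lt _ _] /andP[x1 x2].
rewrite node_neq !distE => neq le.
have [[e1 e2 e3]|[e1 e2 e3]] := step_coord au lt; rewrite e1.
  case: (gap_diff (ltn_ord _) odm b1 x1 e2 e3) => [E|]; last by move: le; clear; lia.
  rewrite E eqxx /= in neq; rewrite E in le *.
  have neg := ends_neq (ltn_ord _) odn x2.
  have : gap u.2 x.2 <> gap u.2 T.2 by move=> /neg/(_ b2)/eqP; apply/negP.
  by move: le; clear; lia.
case: (gap_diff (ltn_ord _) odn b2 x2 e2 e3) => [E|]; last by move: le; clear; lia.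
rewrite E eqxx orbF /= in neq; rewrite E in le *.
have neg := ends_neq (ltn_ord _) odm x1.
have : gap u.1 x.1 <> gap u.1 T.1 by move=> /neg/(_ b1)/eqP; apply/negP.
by move: le; clear; lia.
Qed.

Lemma step_dominated T u u' : centered T -> inW T u -> step T u u' ->
  dominated T u -> dominated T u'.
Proof. by move=> cT Wu st dom x Xx xT; apply: (step_closer cT Wu st) => //; apply/ltnW/dom. Qed.

Inductive walk T u : V -> Prop :=
| walk0 : walk T u u
| walkS v w : walk T u v -> step T v w -> walk T u w.

Lemma walk_inW T u v : centered T -> inW T u -> walk T u v -> inW T v.
Proof. by move=> cT Wu; elim=> // w w' _ Ww; apply: step_inW. Qed.

Lemma walk_lt T u v : walk T u v -> v = u \/ dist v T < dist u T.
Proof.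
elim=> [|v' w _ IH [_ lt _ _]]; first by left.
by right; case: IH => [<-|]; last apply: ltn_trans.
Qed.

(** Only [T] can be entered, so a robot found on another node of [inX T] has never moved. *)
Lemma walk_inX T u v : walk T u v -> inX T v -> v = T \/ v = u.
Proof.
by case=> [_|v' w _ [_ _ noX _] /noX ->]; [right | left].
Qed.

Lemma walk_closer T u v x : centered T -> inW T u -> walk T u v -> v != u ->
  inX T x -> x != T -> dist u T <= dist u x -> dist v T < dist v x.
Proof.
move=> cT Wu wk; elim: wk => [|v' w wk IH st _ Xx xT le]; first by rewrite eqxx.
have Wv := walk_inW cT Wu wk.
apply: (step_closer cT Wv st) => //.
by case: (eqVneq v' u) => [->//|neq]; apply/ltnW/IH.
Qed.

(** Retreats compose by chaining their witnesses backwards; equality over the whole walk implies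
    equality over its initial part, whose witness is then antipodal. Domination, once reached,
    persists. *)
Lemma walk_retreats T u v : centered T -> inW T u -> walk T u v -> v != u ->
  dominated T v \/ retreats T u v.
Proof.
move=> cT Wu wk; elim: wk => [|v' w wk IH st _]; first by rewrite eqxx.
have Wv := walk_inW cT Wu wk.
case: (eqVneq v' u) => [E|neq]; first by case: st => _ _ _; rewrite E.
case: (IH neq) => [dom|ret]; first by left; apply: step_dominated st dom.
case: st => _ _ _ [|ret']; [by left | right] => x Xx.
have [y [Xy le eq]] := ret' x Xx; have [z [Xz le' eq']] := ret y Xy.
exists z; split=> //; first exact: leq_trans le.
move=> E; apply: eq'; apply/eqP; rewrite eqn_leq le' E; exact: le.
Qed.

Lemma aut_neq s x y : (s x == s y) = (x == y).
Proof. by rewrite (inj_eq perm_inj). Qed.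

Lemma aut_inXE T s v : centered T -> is_aut s -> inX T (s v) = inX T v.
Proof.
move=> cT auts; apply/idP/idP; last exact: aut_inX.
by move=> /(aut_inX cT (is_autV auts)); rewrite permK.
Qed.

Lemma aut_dominated T s u : centered T -> is_aut s -> s T = T ->
  dominated T u -> dominated T (s u).
Proof.
move=> cT auts sT dom x Xx xT; have autV := is_autV auts.
have sVT : (s^-1)%g T = T by rewrite -{1}sT permK.
have := dom ((s^-1)%g x); rewrite -(aut_dist u T auts) -(aut_dist u _ auts) permKV sT.
by apply; [rewrite aut_inXE | rewrite -sVT aut_neq].
Qed.

Lemma aut_antipodal T s y : centered T -> is_aut s -> s T = T ->
  antipodal T y -> antipodal T (s y).
Proof.
move=> cT auts sT anti v bv; have autV := is_autV auts.
have := anti _ (aut_inbox cT autV bv).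
by rewrite -(aut_dist y _ auts) -(aut_dist _ T auts) -(aut_dist y T auts) !permKV sT.
Qed.

Lemma aut_step T s u u' : centered T -> is_aut s -> s T = T ->
  step T u u' -> step T (s u) (s u').
Proof.
move=> cT auts sT [au lt noX Q]; split.
- by rewrite auts.
- by rewrite -{1 2}sT !aut_dist.
- by rewrite aut_inXE // => /noX ->.
case: Q => [dom|ret]; [left | right]; first exact: aut_dominated.
move=> x Xx; have [|y [Xy le eq]] := ret ((s^-1)%g x).
  by rewrite aut_inXE //; apply: is_autV.
exists (s y); rewrite aut_inXE // aut_dist // -{1 2}(permKV s x) aut_dist //.
by split=> // /eq; apply: aut_antipodal.
Qed.

End Target.

(** * Recognising the gathering node *)

Section Config.
Variables (m n k : nat).
Local Notation V := (node m n).
Implicit Types (pos : 'I_k -> V) (g : V -> nat) (u v x T : V) (s : {perm V}).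

Lemma conf_gt0 pos v : reflect (exists r, pos r = v) (conf pos v != 0).
Proof.
rewrite /conf; apply: (iffP idP) => [|[r rv]].
  rewrite -lt0n leq_min /= => /card_gt0P[r]; rewrite inE => /eqP rv; by exists r.
by rewrite -lt0n leq_min /=; apply/card_gt0P; exists r; rewrite inE rv.
Qed.

Lemma conf_gt1 pos v :
  reflect (exists r r', [/\ r != r', pos r = v & pos r' = v]) (1 < conf pos v).
Proof.
rewrite /conf leq_min /=; apply: (iffP card_gt1P).
  by move=> [r [r' [h h' neq]]]; exists r, r'; rewrite !inE in h h'; split=> //; apply/eqP.
by move=> [r [r' [neq h h']]]; exists r, r'; rewrite !inE h h'.
Qed.

Lemma conf_le2 pos v : conf pos v <= 2.
Proof. exact: geq_minl. Qed.

Lemma conf_at pos r : conf pos (pos r) != 0.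
Proof. by apply/conf_gt0; exists r. Qed.

Lemma conf_le1 pos v : (forall r r', pos r = v -> pos r' = v -> r = r') -> conf pos v <= 1.
Proof.
move=> uniq; rewrite leqNgt; apply/negP => /conf_gt1[r [r' [neq h h']]].
by rewrite (uniq r r') ?eqxx in neq.
Qed.

Lemma upd_eq (A : Type) (f : 'I_k -> A) r a : upd f r a r = a.
Proof. by rewrite /upd eqxx. Qed.

Lemma upd_neq (A : Type) (f : 'I_k -> A) r r' a : r' != r -> upd f r a r' = f r'.
Proof. by rewrite /upd => /negPf->. Qed.

Definition unambiguous T g x : Prop :=
  (g x = 2 /\ forall y, inX T y -> y != x -> g y <= 1) \/
  (g x != 0 /\ forall y, inX T y -> y != x -> g y = 0).

Definition config_map s g g' := forall v, g' (s v) = g v.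

Lemma config_mapV s g g' : config_map s g g' -> config_map (s^-1)%g g' g.
Proof. by move=> h v; rewrite -h permKV. Qed.

Lemma unambiguous_map T s g g' x : centered T -> is_aut s -> config_map s g g' ->
  unambiguous T g x -> unambiguous T g' (s x).
Proof.
move=> cT auts sg [[h1 h2]|[h1 h2]]; [left | right]; rewrite sg; split=> // y Xy yx.
  rewrite -(permKV s y) sg; apply: h2.
    by rewrite aut_inXE //; apply: is_autV.
  by rewrite -(aut_neq s) permKV.
rewrite -(permKV s y) sg; apply: h2.
  by rewrite aut_inXE //; apply: is_autV.
by rewrite -(aut_neq s) permKV.
Qed.

Lemma unambiguous_uniq T g x y : inX T x -> inX T y ->
  unambiguous T g x -> unambiguous T g y -> x = y.
Proof.
move=> Xx Xy ux uy; apply/eqP/negPn/negP => xy.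
have yx : y != x by rewrite eq_sym.
by case: ux => -[h1 h2]; case: uy => -[h3 h4];
  move: (h2 y Xy yx) (h4 x Xx xy) h1 h3; clear; lia.
Qed.

Section Plan.
Variables (p0 : 'I_k -> V) (T : V).
Hypotheses (cT : centered T) (p0_inj : injective p0) (p0W : forall r, inW T (p0 r)).

Definition reached pos := forall r, walk T (p0 r) (pos r).

Lemma reachedX pos r : reached pos -> inX T (pos r) -> pos r = T \/ pos r = p0 r.
Proof. by move=> /(_ r)/walk_inX. Qed.

Lemma reached_inW pos r : reached pos -> inW T (pos r).
Proof. by move=> /(_ r); apply: walk_inW. Qed.

Lemma reached_upd pos r d : reached pos -> step T (pos r) d -> reached (upd pos r d).
Proof.
move=> re st r'; rewrite /upd; case: eqP => [->|//]; exact: walkS st.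
Qed.

(** The robots on [x] have never moved, and initial nodes are distinct. *)
Lemma reached_conf_le1 pos x : reached pos -> inX T x -> x != T -> conf pos x <= 1.
Proof.
move=> re Xx xT; apply: conf_le1 => r r' h h'; apply: p0_inj.
have a q : pos q = x -> p0 q = x.
  by move=> E; case: (reachedX (r := q) re); rewrite E // => E'; rewrite E' eqxx in xT.
by rewrite !a.
Qed.

Lemma step_source pos r d : step T (pos r) d -> pos r <> T.
Proof. by move=> [_ lt _ _] E; rewrite E distvv in lt. Qed.

(** Robots on [T] do not step away and no other node of [inX T] is entered, so a multiplicity on [T]
    persists, and so does the emptiness of the other nodes. *)
Lemma unambiguous_upd pos r d : reached pos -> step T (pos r) d ->
  unambiguous T (conf pos) T -> unambiguous T (conf (upd pos r d)) T.
Proof.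
move=> re st; have re' := reached_upd re st; have src := step_source st.
have keep q : pos q = T -> upd pos r d q = T.
  by move=> E; rewrite upd_neq //; apply/eqP => qr; rewrite qr in E.
case=> [[h1 _]|[/conf_gt0[q qT] h2]]; [left|right]; split.
- have /conf_gt1[q [q' [neq h h']]] : 1 < conf pos T by rewrite h1.
  apply/eqP; rewrite eqn_leq conf_le2 /=; apply/conf_gt1.
  by exists q, q'; rewrite !keep.
- by move=> y Xy yT; apply: reached_conf_le1.
- by apply/conf_gt0; exists q; apply: keep.
move=> y Xy yT; apply/eqP/negPn/negP => /conf_gt0[q' q'y].
have := h2 y Xy yT; apply/eqP/conf_gt0.
move: q'y; rewrite /upd; case: eqP => [_|_]; last by exists q'.
move=> dy; case: st => _ _ noX _; rewrite dy in noX.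
by rewrite noX ?eqxx in yT.
Qed.

(* [En] is what a robot reads off the snapshot; [EnH] persists while other robots move,
   so that a move decided on an outdated snapshot is as good as a fresh one. Two enabled
   robots are required since one of them may have crashed. *)
Lemma gather_plan (P1 : ('I_k -> V) -> Prop) (EnH : ('I_k -> V) -> 'I_k -> Prop)
    (En : (V -> nat) -> V -> Prop) :
  let ok pos := [/\ P1 pos, reached pos & ~ unambiguous T (conf pos) T] in
  P1 p0 \/ unambiguous T (conf p0) T ->
  (forall pos pos' s, ok pos -> ok pos' -> is_aut s ->
     config_map s (conf pos) (conf pos') -> s T = T) ->
  (forall pos x, ok pos -> inX T x -> x != T -> ~ unambiguous T (conf pos) x) ->
  (forall pos pos' s u, ok pos -> ok pos' -> is_aut s -> s T = T ->
     config_map s (conf pos) (conf pos') -> En (conf pos) u -> En (conf pos') (s u)) ->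
  (forall pos, ok pos -> exists r r',
     [/\ r != r', En (conf pos) (pos r) & En (conf pos) (pos r')]) ->
  (forall pos r, ok pos -> En (conf pos) (pos r) -> pos r != T /\ EnH pos r) ->
  (forall pos r d, ok pos -> EnH pos r -> step T (pos r) d ->
     P1 (upd pos r d) \/ unambiguous T (conf (upd pos r d)) T) ->
  (forall pos r r' d, ok pos -> EnH pos r -> EnH pos r' -> r' != r ->
     step T (pos r) d -> EnH (upd pos r d) r') ->
  gatherable p0.
Proof.
move=> ok init ident noalt equiv two source move_ok persist.
pose far pos := ~ unambiguous T (conf pos) T.
(* Only destinations other than the current node require an enabled robot: a pending decision to
   stay is harmless. *)
pose J pos pend :=
  [/\ reached pos, forall r d, pend r = Some d -> d = pos r \/ step T (pos r) d
    & unambiguous T (conf pos) T \/ (P1 pos /\ far pos /\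
        forall r d, pend r = Some d -> d <> pos r -> EnH pos r)].
pose Al g u u' :=
  (unambiguous T g T /\ ((u = T /\ u' = T) \/ (u <> T /\ step T u u'))) \/
  (~ unambiguous T g T /\ ((En g u /\ step T u u') \/ (~ En g u /\ u' = u))).
have okJ pos pend : J pos pend -> far pos -> ok pos.
  by move=> [re _ [//|[? [? _]]]] ?; split.
(* The image of a recognisable target is recognisable, so it is [T] by uniqueness or is excluded by
   [noalt]; two states where [T] is not yet recognisable are left to [ident]. *)
have sT pos pend pos' pend' s : J pos pend -> J pos' pend' -> is_aut s ->
    config_map s (conf pos) (conf pos') ->
    s T = T /\ (unambiguous T (conf pos) T <-> unambiguous T (conf pos') T).
  move=> Jp Jp' auts sE.
  have XsT : inX T (s T) by rewrite aut_inXE ?inX_T.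
  have XsVT : inX T ((s^-1)%g T) by rewrite aut_inXE ?inX_T //; apply: is_autV.
  have imp : s T = T -> s T = T /\ (unambiguous T (conf pos) T <-> unambiguous T (conf pos') T).
    move=> sTT; split=> //; split=> [/(unambiguous_map cT auts sE)|]; first by rewrite sTT.
    move=> /(unambiguous_map cT (is_autV auts) (config_mapV sE)).
    by rewrite -{2}sTT permK.
  apply: imp.
  case: (excluded_middle_informative (unambiguous T (conf pos) T)) => u1;
    case: (excluded_middle_informative (unambiguous T (conf pos') T)) => u2.
  - by have := unambiguous_uniq XsT (inX_T T) (unambiguous_map cT auts sE u1) u2.
  - have u3 := unambiguous_map cT auts sE u1.
    apply/eqP/negPn/negP => neq.
    exact: (noalt _ _ (okJ _ _ Jp' u2) XsT neq).
  - have u3 := unambiguous_map cT (is_autV auts) (config_mapV sE) u2.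
    apply/eqP/negPn/negP => neq; apply: (noalt _ _ (okJ _ _ Jp u1) XsVT _ u3).
    by rewrite -(aut_neq s) permKV eq_sym.
  by apply: (ident pos pos'); [apply: okJ Jp _ | apply: okJ Jp' _ | | ].
apply: (@gatherable_core m n k p0 T J Al (fun v => dist v T)).
- split=> //; first by move=> r; apply: walk0.
  case: (excluded_middle_informative (unambiguous T (conf p0) T)) => u0; first by left.
  by right; case: init.
- move=> pos pend r d _; case=> [[_ [[-> ->]|[_ [au _ _ _]]]]|[_ [[_ [au _ _ _]]|[_ ->]]]];
    by [left | right].
- move=> pos pend pos' pend' s u u' Jp Jp' auts sE.
  have [sTT eqU] := sT _ _ _ _ _ Jp Jp' auts sE.
  case=> [[/eqU U Q]|[U Q]]; [left | right]; split=> //.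
  + case: Q => [[-> ->]|[neq st]]; [by left | right; split; last exact: aut_step].
    by move=> E; apply: neq; apply: (@perm_inj _ s); rewrite E sTT.
  + by move=> /eqU.
  have U' : ~ unambiguous T (conf pos') T by move=> /eqU.
  have ok1 := okJ _ _ Jp U; have ok2 := okJ _ _ Jp' U'.
  case: Q => [[e st]|[ne ->]]; [left; split; last exact: aut_step | right; split=> //].
    exact: (equiv pos pos').
  move=> e; apply: ne; rewrite -(permK s u).
  apply: (equiv pos' pos) => //; [exact: is_autV | by rewrite -{1}sTT permK |].
  exact: config_mapV.
- move=> pos pend r Jp; have re : reached pos by case: Jp.
  case: (excluded_middle_informative (unambiguous T (conf pos) T)) => U.
    case: (eqVneq (pos r) T) => [E|neq]; first by exists T; left; split=> //; left.
    have [d st] := step_exists cT (reached_inW r re) neq.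
    by exists d; left; split=> //; right; split=> //; apply/eqP.
  case: (excluded_middle_informative (En (conf pos) (pos r))) => e; last first.
    by exists (pos r); right; split=> //; right.
  have [neq _] := source _ _ (okJ _ _ Jp U) e.
  have [d st] := step_exists cT (reached_inW r re) neq.
  by exists d; right; split=> //; left.
- move=> pos pend r d Jp pr Ald; have [re pendok Q] := Jp; split=> //.
    move=> q d'; rewrite /upd; case: eqP => [->|_]; last exact: pendok.
    case=> <-; case: Ald => [[_ [[-> ->]|[_ st]]]|[_ [[_ st]|[_ ->]]]]; by [left|right].
  case: Q => [|[P1p [fp eh]]]; [by left | right; split=> //; split=> //].
  move=> q d'; rewrite /upd; case: eqP => [->|_]; last exact: eh.
  case=> <- neq; case: Ald => [[U _]|[_ [[e st]|[_ E]]]] //.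
  by have [] := source _ _ (okJ _ _ Jp fp) e.
- move=> pos pend r d Jp pr; have [re pendok Q] := Jp.
  have none q d' : upd pend r None q = Some d' -> q != r /\ pend q = Some d'.
    by rewrite /upd; case: eqP.
  case: (pendok _ _ pr) => [dE|st].
    rewrite dE upd_id; split=> //; first by move=> q d' /none[_ /pendok].
    by case: Q => [|[? [? eh]]]; [left | right; do 2!split=> //; move=> q d' /none[_ /eh]].
  split; first exact: reached_upd.
    by move=> q d' /none[qr /pendok]; rewrite upd_neq.
  case: Q => [U|[P1p [fp eh]]]; first by left; apply: unambiguous_upd.
  have okp := okJ _ _ Jp fp.
  have er : EnH pos r.
    by apply: (eh _ _ pr) => E; case: st => _; rewrite E ltnn.
  case: (excluded_middle_informative (unambiguous T (conf (upd pos r d)) T)) => U'; first by left.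
  right; split; first by case: (move_ok _ _ _ okp er st).
  split=> // q d' /none[qr qd]; rewrite upd_neq // => neq.
  by apply: persist => //; apply: eh qd neq.
- move=> pos pend r d [_ pendok _] /pendok[|[_ lt _ _]]; by [left | right].
move=> pos pend c Jp stuck r rc.
case: (excluded_middle_informative (unambiguous T (conf pos) T)) => U.
  by case: (stuck r rc) => [[_ [[]|[_ [_]]]]|[]] //; rewrite ltnn.
(* At most one of the two enabled robots has crashed; the other one would have a proper step to
   make. *)
have okp := okJ _ _ Jp U; have [q [q' [neq e e']]] := two _ okp; exfalso.
have noEn z : Some z != c -> ~ En (conf pos) (pos z).
  by move=> /stuck[[]//|[_ [[_ [_]]|[]//]]]; rewrite ltnn.
case: (eqVneq (Some q) c) => [E|/noEn//].
by case: (eqVneq (Some q') c) => [E'|/noEn//]; rewrite -E' in E; case: E => E; rewrite E eqxx in neq.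
Qed.

End Plan.
End Config.

(** * Gathering from the possible corner occupations *)

Section Scores.
Variables (m n k : nat).
Local Notation V := (node m n).
Implicit Types (pos : 'I_k -> V) (g : V -> nat) (u v x y T : V) (s : {perm V}).

Definition equivariant (score : V -> (V -> nat) -> nat) := forall s g g' y,
  is_aut s -> config_map s g g' -> score (s y) g' = score y g.

Lemma equivariant_le (score : V -> (V -> nat) -> nat) :
  (forall s g g' y, is_aut s -> config_map s g g' -> score y g <= score (s y) g') ->
  equivariant score.
Proof.
move=> le s g g' y auts sg; apply/eqP; rewrite eqn_leq le // andbT.
by rewrite -{2}(permK s y) le //; [apply: is_autV | apply: config_mapV].
Qed.

(* [f] is the initial configuration: a weak advantage of [T] suffices there, because a
   symmetry between two states that both still show [f] is a symmetry of [f]. *)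
Lemma score_ident (score : V -> (V -> nat) -> nat) (R : V -> Prop) (f g g' : V -> nat) T s :
  equivariant score -> is_aut s -> config_map s g g' ->
  R (s T) -> R ((s^-1)%g T) ->
  (forall x, R x -> score x f <= score T f) ->
  (is_aut s -> config_map s f f -> s T = T) ->
  g =1 f \/ (forall x, R x -> x != T -> score x g < score T g) ->
  g' =1 f \/ (forall x, R x -> x != T -> score x g' < score T g') ->
  s T = T.
Proof.
move=> eqs auts sg RsT RsVT weak stab hg hg'.
case: hg => [gf|lt]; case: hg' => [g'f|lt'].
- by apply: stab => // v; rewrite -g'f -gf sg.
- apply/eqP/negPn/negP => neq; have := lt' _ RsT neq.
  rewrite (eqs s g g') // -{2}(permKV s T) (eqs s g g') // => lt.
  have := weak _ RsVT; have eqf y : score y g = score y f.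
    by rewrite -(eqs 1%g g f) ?perm1 // => [u v|v]; rewrite ?perm1 ?gf.
  by rewrite -!eqf leqNgt lt.
- apply/eqP/negPn/negP => neq.
  have neq' : (s^-1)%g T != T by rewrite -(aut_neq s) permKV eq_sym.
  have := lt _ RsVT neq'; rewrite -(eqs s g g') // permKV -(eqs s g g') // => lt'.
  have := weak _ RsT; have eqf y : score y g' = score y f.
    by rewrite -(eqs 1%g g' f) ?perm1 // => [u v|v]; rewrite ?perm1 ?g'f.
  by rewrite -!eqf leqNgt lt'.
apply/eqP/negPn/negP => neq.
have neq' : (s^-1)%g T != T by rewrite -(aut_neq s) permKV eq_sym.
have := lt' _ RsT neq; have := lt _ RsVT neq'.
by rewrite -!(eqs s g g') // permKV => l1 l2; move: (ltn_trans l1 l2); rewrite ltnn.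
Qed.

(** Distances are reversed so that a maximum selects the nearest robot; the values are positive,
    above the default value 0 of an empty maximum. *)
Definition closeness x v : nat := m + n - dist v x.

Lemma closeness_aut s x v : is_aut s -> closeness (s x) (s v) = closeness x v.
Proof. by move=> auts; rewrite /closeness aut_dist. Qed.

Lemma closeness_lt x y u v : (closeness x u < closeness y v) = (dist v y < dist u x).
Proof. by have := dist_lt u x; have := dist_lt v y; rewrite /closeness; clear; lia. Qed.

Lemma closeness_le x y u v : (closeness x u <= closeness y v) = (dist v y <= dist u x).
Proof. by have := dist_lt u x; have := dist_lt v y; rewrite /closeness; clear; lia. Qed.

Lemma closeness_bound x v : closeness x v < (m + n).+1.
Proof. by rewrite ltnS leq_subr. Qed.

(** The base exceeds every closeness, so weights compare lexicographically. *)
Definition pair_weight x (p : V * V) : nat :=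
  (m + n).+1 * closeness x p.1 + closeness x p.2.

Lemma lex_lt K a b c d : b < K -> d < K ->
  (K * a + b < K * c + d) = (a < c) || (a == c) && (b < d).
Proof.
move=> ltb ltd; case: (ltngtP a c) => [lt|gt|->] /=; last by rewrite ltn_add2l.
  have : K * a.+1 <= K * c by rewrite leq_mul.
  rewrite mulnS; lia.
have : K * c.+1 <= K * a by rewrite leq_mul.
rewrite mulnS; lia.
Qed.

Definition lexlt (a b c d : nat) := (a < c) || (a == c) && (b < d).

Lemma pair_weight_lt x y (p q : V * V) :
  (pair_weight x p < pair_weight y q) =
  lexlt (dist q.1 y) (dist q.2 y) (dist p.1 x) (dist p.2 x).
Proof.
rewrite /pair_weight lex_lt ?closeness_bound // !closeness_lt /lexlt; congr (_ || (_ && _)).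
have := dist_lt p.1 x; have := dist_lt q.1 y; rewrite /closeness; clear; lia.
Qed.

(** Weak multiplicity detection is enough to see whether two distinct robots stand on the two nodes,
    be they equal or not. *)
Definition two_robots g (p : V * V) :=
  [&& g p.1 != 0, g p.2 != 0 & (p.1 != p.2) || (1 < g p.1)].

Lemma two_robotsP pos p :
  reflect (exists r r', [/\ r != r', p.1 = pos r & p.2 = pos r']) (two_robots (conf pos) p).
Proof.
case: p => u v; rewrite /two_robots /=; apply: (iffP and3P) => [[]|[r [r' [neq -> ->]]]].
  move=> /conf_gt0[r ru] /conf_gt0[r' rv]; case: eqVneq => [uv /=|uv _].
    by rewrite -uv => /conf_gt1[q [q' [neq qu qu']]]; exists q, q'.
  by exists r, r'; split=> //; apply: contraNneq uv => E; rewrite -ru -rv E.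
split; try exact: conf_at.
by case: eqVneq => //= E; apply/conf_gt1; exists r, r'.
Qed.

Definition pair_score x g := \max_(p : V * V | two_robots g p) pair_weight x p.

Lemma pair_score_ge x g p : two_robots g p -> pair_weight x p <= pair_score x g.
Proof. by move=> tw; apply: (leq_bigmax_cond (F := pair_weight x) p tw). Qed.

Lemma pair_score_equivariant : equivariant pair_score.
Proof.
apply: equivariant_le => s g g' y auts sg; apply/bigmax_leqP => -[u v] tw.
apply: leq_trans (@pair_score_ge _ _ (s u, s v) _).
  by rewrite /pair_weight /= !closeness_aut.
by move: tw; rewrite /two_robots /= !sg aut_neq.
Qed.

End Scores.

Lemma third_robot k (a b : 'I_k) : 3 <= k -> exists r, r != a /\ r != b.
Proof.
move=> k3; have /card_gt0P[r] : 0 < #|[pred r | (r != a) && (r != b)]|.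
  have := cardC (pred2 a b); rewrite card_ord => cE.
  have le2 : #|pred2 a b| <= 2 by rewrite card2; case: (a != b).
  have -> : #|[pred r | (r != a) && (r != b)]| = #|[predC pred2 a b]|.
    by apply: eq_card => r; rewrite !inE negb_or.
  by rewrite -(ltn_add2l #|pred2 a b|) addn0 cE; apply: leq_ltn_trans le2 k3.
by rewrite !inE => /andP[ra rb]; exists r.
Qed.

(** * No occupied corner *)

Section FreePlan.
Variables (m n k : nat).
Local Notation V := (node m n).
Variables (p0 : 'I_k -> V) (T : V).
Hypotheses (k3 : 3 <= k) (cT : centered T) (p0_inj : injective p0).
Hypothesis p0W : forall r, inW T (p0 r).
Implicit Types (pos : 'I_k -> V).

(** [b] and [c] realise the best initial pair of distances. If some [x] tied or won later, its
    nearest robot would stand exactly at the initial minimum. Either it has not moved, and then the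
    second one has moved and is nearer to [T] than to [x]; or it has retreated with equality from an
    antipodal corner, which a third robot contradicts. *)
Lemma pair_strict (b c : 'I_k) pos :
  let d x r := dist (p0 r) x in
  b != c ->
  (forall x (r r' : 'I_k), inX T x -> r != r' -> ~~ lexlt (d x r) (d x r') (d T b) (d T c)) ->
  reached p0 T pos ->
  (forall r, d T c < d T r -> pos r = p0 r) ->
  (exists r, pos r != p0 r) ->
  forall x, inX T x -> x != T -> pair_score x (conf pos) < pair_score T (conf pos).
Proof.
move=> d bc minT re stat [r0 moved0] x Xx xT.
pose A r := dist (pos r) T; pose E r := dist (pos r) x.
suff main (s1 s2 : 'I_k) : s1 != s2 -> exists r1 r2, r1 != r2 /\ lexlt (A r1) (A r2) (E s1) (E s2).
  have lt p : two_robots (conf pos) p -> pair_weight x p < pair_score T (conf pos).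
    move=> /two_robotsP[q1 [q2 [/main[r1 [r2 [neqr lt]]] e1 e2]]].
    apply: leq_trans (@pair_score_ge _ _ T _ (pos r1, pos r2) _); last first.
      by apply/two_robotsP; exists r1, r2.
    by rewrite pair_weight_lt /= e1 e2.
  have : 0 < pair_score T (conf pos).
    by apply: leq_trans (lt (pos b, pos c) _) => //; apply/two_robotsP; exists b, c.
  rewrite {2}/pair_score; case: (pair_score T _) lt => // N lt _; rewrite ltnS.
  by apply/bigmax_leqP => p /lt; rewrite ltnS.
have XT := inX_T T.
have other (r : 'I_k) : exists r', r != r'.
  by case: (eqVneq r b) => [->|]; [exists c | exists b].
have i1_min y r : inX T y -> d T b <= d y r.
  by move=> Xy; have [r' /(minT y r r' Xy)] := other r; rewrite /lexlt; lia.
have i2_min y r r' : inX T y -> r != r' -> d y r = d T b -> d T c <= d y r'.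
  by move=> Xy /(minT y r r' Xy); rewrite /lexlt; lia.
have i2_T (r : 'I_k) : r != b -> d T c <= d T r by rewrite eq_sym => br; apply: (i2_min T b).
have i2_moved r : pos r != p0 r -> d T r <= d T c.
  by move=> moved; rewrite leqNgt; apply: contraNN moved => /stat/eqP.
move=> s12; set goal := exists r1, _.
case: (excluded_middle_informative goal) => // nex; exfalso.
have nolt (r1 r2 : 'I_k) : r1 != r2 -> ~~ lexlt (A r1) (A r2) (E s1) (E s2).
  by move=> neq; apply/negP => lt; apply: nex; exists r1, r2.
have Emin r : E s1 <= A r.
  by have [r' /(nolt r r')] := other r; rewrite /lexlt; lia.
(* [s1] is not nearer to [x] than the initial minimum: if it moved, it is dominated by [T], which is
   absurd here, or has retreated from some [y]. *)
have i1E : d T b <= E s1.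
  case: (eqVneq (pos s1) (p0 s1)) => [E1|moved]; first by rewrite /E E1; apply: i1_min.
  case: (walk_retreats cT (p0W s1) (re s1) moved) => [dom|ret].
    by have := dom _ Xx xT; rewrite -/(A s1) -/(E s1); have := Emin s1; lia.
  have [y [Xy le _]] := ret x Xx.
  by apply: leq_trans (i1_min y s1 Xy) _; rewrite /E /d (distC _ x) (distC _ y).
have b_unmoved : pos b = p0 b.
  case: (walk_lt (re b)) => // lt; move: lt (Emin b) i1E.
  by rewrite /A /d; lia.
have Ab : A b = d T b by rewrite /A b_unmoved.
have Es1 : E s1 = d T b by apply/eqP; rewrite eqn_leq i1E -Ab Emin.
have r0b : r0 != b by apply: contraNneq moved0 => ->; rewrite b_unmoved.
have Ar0 : A r0 < d T c.
  case: (walk_lt (re r0)) => [/eqP|lt]; first by rewrite (negPf moved0).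
  by apply: leq_trans lt _; apply: i2_moved.
have Es2 : E s2 <= A r0.
  by have := nolt b r0; rewrite eq_sym => /(_ r0b); rewrite /lexlt Ab Es1; lia.
(* If [s1] stayed, [s2] has moved, is strictly nearer to [T] than to [x], and together with [b]
   gives [T] a smaller pair. *)
case: (eqVneq (pos s1) (p0 s1)) => [E1|moved].
  have ds1 : d x s1 = d T b by rewrite -Es1 /E E1.
  have le2 := i2_min x s1 s2 Xx s12 ds1.
  have moved2 : pos s2 != p0 s2.
    by apply/eqP => E2; move: Es2 Ar0 le2; rewrite /E E2 /d; lia.
  have s2b : s2 != b by apply: contraNneq moved2 => ->; rewrite b_unmoved.
  have := walk_closer cT (p0W s2) (re s2) moved2 Xx xT.
  move=> /(_ (leq_trans (i2_moved _ moved2) le2)).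
  by have := nolt b s2; rewrite eq_sym => /(_ s2b); rewrite /lexlt Ab Es1 /A /E; lia.
case: (walk_retreats cT (p0W s1) (re s1) moved) => [dom|ret].
  by have := dom _ Xx xT; rewrite -/(A s1) -/(E s1); have := Emin s1; lia.
have [y [Xy le eq]] := ret x Xx.
have dys1 : d y s1 = d T b.
  by apply/eqP; rewrite eqn_leq i1_min // andbT -Es1 /E /d (distC _ x) (distC _ y).
have anti : antipodal T y.
  by apply: eq; rewrite distC -/(d y s1) dys1 -Es1 /E distC.
have inb r : inbox T (p0 r) by case/andP: (p0W r).
(* For [s1] and for a third robot [r], the initial distances to [y] and [T] add up to [dist y T].
   The sum is at most [d T b + d T c] for [s1] and at least twice [d T c] for [r], so
   [d T c <= d T b]; but [r0] lies between the two, strictly below [d T c]. *)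
have [r [rs1 rb]] := third_robot s1 b k3.
have dyr := i2_min y s1 r Xy; rewrite eq_sym in dyr.
have := anti _ (inb r); have := anti _ (inb s1).
rewrite ![dist y _]distC -!/(d _ _) dys1 => e1 e2.
have := dyr rs1 dys1; have := i2_T r rb; have := i2_moved _ moved; have := Emin r0.
by rewrite Es1; move: e1 e2 Ar0; clear; lia.
Qed.

(** The robots initially within the second smallest distance of [T] may move, which enables both [b]
    and [c]. The first one to arrive makes [T] the only occupied node of [inX T]. *)
Lemma gather_free :
  (forall r, ~~ inX T (p0 r)) ->
  (forall x, inX T x -> pair_score x (conf p0) <= pair_score T (conf p0)) ->
  (forall s, is_aut s -> config_map s (conf p0) (conf p0) -> s T = T) ->
  gatherable p0.
Proof.
move=> noX maxT stab.
pose d x r := dist (p0 r) x.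
have r_ex : exists r r' : 'I_k, r != r'.
  by exists (Ordinal (ltnW (ltnW k3))), (Ordinal (ltnW k3)).
have [b [c [bc minT]]] : exists b c : 'I_k, b != c /\
    forall x (r r' : 'I_k), inX T x -> r != r' -> ~~ lexlt (d x r) (d x r') (d T b) (d T c).
  have [r [r' rr']] := r_ex.
  pose w (q : 'I_k * 'I_k) := pair_weight T (p0 q.1, p0 q.2).
  have [q /= qq qmax] := arg_maxnP (i0 := (r, r')) (P := fun q => q.1 != q.2) w rr'.
  exists q.1, q.2; split=> // x a a' Xx aa'.
  rewrite -(pair_weight_lt T x (p0 q.1, p0 q.2) (p0 a, p0 a')) -leqNgt.
  apply: (@leq_trans (pair_score x (conf p0))).
    by apply: pair_score_ge; apply/two_robotsP; exists a, a'.
  apply: leq_trans (maxT x Xx) _; apply/bigmax_leqP => -[u v].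
  by move=> /two_robotsP[z [z' [zz' /= -> ->]]]; apply: (qmax (z, z')).
have bT : d T b <= d T c.
  by have := minT T c b (inX_T T); rewrite eq_sym bc /lexlt => /(_ isT); lia.
pose P1 pos := forall r, d T c < d T r -> pos r = p0 r.
pose EnH (pos : 'I_k -> V) r := d T r <= d T c.
pose En (g : V -> nat) (u : V) := dist u T <= d T c /\ u <> T.
have noXpos pos r : reached p0 T pos -> inX T (pos r) -> pos r = T.
  by move=> re X; case: (reachedX re X) => // E; have := noX r; rewrite -E X.
have occT pos r : reached p0 T pos -> pos r = T -> unambiguous T (conf pos) T.
  move=> re rT; right; split=> [|y Xy yT]; first by rewrite -rT conf_at.
  apply/eqP/negPn/negP => /conf_gt0[q qy].
  by rewrite -qy in Xy yT; rewrite (noXpos pos q re Xy) eqxx in yT.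
apply: (@gather_plan m n k p0 T cT p0_inj p0W P1 EnH En).
- by left.
- move=> pos pos' s [P re _] [P' re' _] auts sg.
  have XsT : inX T (s T) by rewrite aut_inXE ?inX_T.
  have XsVT : inX T ((s^-1)%g T) by rewrite aut_inXE ?inX_T //; apply: is_autV.
  have strict q : P1 q -> reached p0 T q -> conf q =1 conf p0 \/
      (forall x, inX T x -> x != T -> pair_score x (conf q) < pair_score T (conf q)).
    move=> Pq req; case: (excluded_middle_informative (exists r, q r != p0 r)) => [mv|nomv].
      by right; apply: (@pair_strict b c).
    left=> v; rewrite (_ : q = p0) //; apply: functional_extensionality => r.
    by apply/eqP/negPn/negP => neq; apply: nomv; exists r.
  exact: (score_ident (R := inX T) (@pair_score_equivariant m n) auts sg XsT XsVT maxT
    (stab s) (strict pos P re) (strict pos' P' re')).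
- move=> pos x [_ re nu] Xx xT un.
  suff [r rx] : exists r, pos r = x.
    by rewrite -rx in Xx xT; rewrite (noXpos pos r re Xx) eqxx in xT.
  by apply/conf_gt0; case: un => -[h _] //; rewrite h.
- move=> pos pos' s u _ _ auts sT _ [le neq]; split; first by rewrite -{1}sT aut_dist.
  by move=> E; apply: neq; apply: (@perm_inj _ s); rewrite E sT.
- move=> pos [P re nu]; exists b, c; split=> //; split; try by move=> /(occT _ _ re).
    by case: (walk_lt (re b)) => [->|/ltnW le] //; apply: leq_trans le bT.
  by case: (walk_lt (re c)) => [->|/ltnW le].
(* A robot seen within the radius was there initially, since those outside it have not moved. *)
- move=> pos r [P re nu] [le neq]; split; first by apply/eqP.
  by rewrite /EnH leqNgt; apply/negP => lt; move: lt (lt) le => /P E; rewrite E /d; lia.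
- move=> pos r d' [P re nu] e st; left=> q lt; rewrite upd_neq; first exact: P.
  by apply/eqP => E; rewrite E in lt; move: lt e; rewrite /EnH; lia.
by [].
Qed.

End FreePlan.

(** * Score by the nearest robot off the corners *)

Section InnerScore.
Variables (m n k : nat) (T : node m n).
Local Notation V := (node m n).
Hypothesis cT : centered T.
Implicit Types (pos : 'I_k -> V) (g : V -> nat) (u v x y : V) (s : {perm V}).

(** Robots on [inX T] are left out: all occupied corners would tie at distance zero. *)
Definition inner_score x g := \max_(v | (g v != 0) && ~~ inX T v) closeness x v.

Lemma inner_score_equivariant : equivariant inner_score.
Proof.
apply: equivariant_le => s g g' y auts sg; apply/bigmax_leqP => v gv.
rewrite -(closeness_aut _ _ auts).
by apply: (leq_bigmax_cond (F := closeness (s y))); rewrite sg aut_inXE.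
Qed.

Lemma inner_score_ge pos x r : ~~ inX T (pos r) ->
  closeness x (pos r) <= inner_score x (conf pos).
Proof. by move=> nX; apply: (leq_bigmax_cond (F := closeness x)); rewrite conf_at. Qed.

Lemma inner_score_lt pos x y :
  (exists r, ~~ inX T (pos r)) ->
  (forall r, ~~ inX T (pos r) -> exists r', ~~ inX T (pos r') /\ dist (pos r') y < dist (pos r) x) ->
  inner_score x (conf pos) < inner_score y (conf pos).
Proof.
move=> [q nq] closer.
have lt r : ~~ inX T (pos r) -> closeness x (pos r) < inner_score y (conf pos).
  move=> /closer[r' [nr' lt]]; apply: leq_trans (inner_score_ge _ nr').
  by rewrite closeness_lt.
have : 0 < inner_score y (conf pos) by apply: leq_trans (lt q nq).
rewrite {2}/inner_score; case: (inner_score y _) lt => // N lt _; rewrite ltnS.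
by apply/bigmax_leqP => v /andP[/conf_gt0[r <-]] /lt.
Qed.

Lemma inner_min pos x y r : inner_score x (conf pos) <= inner_score y (conf pos) ->
  ~~ inX T (pos r) -> exists2 r', ~~ inX T (pos r') & dist (pos r') y <= dist (pos r) x.
Proof.
move=> le nr.
have ex : (conf pos (pos r) != 0) && ~~ inX T (pos r) by rewrite conf_at.
have [v /andP[/conf_gt0[r' <-] nX] vmin] :=
  arg_maxnP (P := fun v => (conf pos v != 0) && ~~ inX T v) (closeness y) ex.
exists r' => //; rewrite -closeness_le.
apply: leq_trans (inner_score_ge _ nr) (leq_trans le _).
by apply/bigmax_leqP.
Qed.

End InnerScore.

(** * One or two occupied corners *)

Section OccupiedTarget.
Variables (m n k : nat).
Local Notation V := (node m n).
Variables (p0 : 'I_k -> V) (T : V).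
Hypotheses (cT : centered T) (p0_inj : injective p0) (p0W : forall r, inW T (p0 r)).
Implicit Types (pos : 'I_k -> V).

Lemma target_stays pos r : reached p0 T pos -> p0 r = T -> pos r = T.
Proof. by move=> re rT; case: (walk_lt (re r)); rewrite rT // distvv. Qed.

Lemma unambiguous_double pos r r' : reached p0 T pos -> r != r' ->
  pos r = T -> pos r' = T -> unambiguous T (conf pos) T.
Proof.
move=> re neq rT r'T; left; split=> [|y Xy yT]; last exact: (reached_conf_le1 p0_inj re).
by apply/eqP; rewrite eqn_leq conf_le2; apply/conf_gt1; exists r, r'.
Qed.

Lemma unambiguous_single pos r : pos r = T ->
  (forall q, inX T (pos q) -> pos q = T) -> unambiguous T (conf pos) T.
Proof.
move=> rT only; right; split=> [|y Xy yT]; first by rewrite -rT conf_at.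
apply/eqP/negPn/negP => /conf_gt0[q qy]; rewrite -qy in Xy yT.
by rewrite (only q Xy) eqxx in yT.
Qed.

Lemma occupied_noalt pos r x : reached p0 T pos -> pos r = T -> inX T x -> x != T ->
  ~ unambiguous T (conf pos) x.
Proof.
move=> re rT Xx xT; case=> -[h1 h2].
  by have := reached_conf_le1 p0_inj re Xx xT; rewrite h1.
have := h2 T (inX_T T); rewrite eq_sym => /(_ xT)/eqP; apply/negP.
by rewrite -rT conf_at.
Qed.

(** [T] is recognisable from the start, so the phase before recognition is empty. *)
Lemma gather_unique r : p0 r = T -> (forall q, inX T (p0 q) -> q = r) -> gatherable p0.
Proof.
move=> rT only.
apply: (@gather_plan m n k p0 T cT p0_inj p0W (fun _ => False) (fun _ _ => False)
  (fun _ _ => False)).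
  by right; apply: (@unambiguous_single _ r) => // q /only->.
all: by move=> *; match goal with H : [/\ False, _ & _] |- _ => case: H end.
Qed.

(** The robot on [x] and the robots off the corners at minimal distance from [T] may move. If the
    former leaves, [T] is the only occupied corner; if one of the latter arrives, [T] is a
    multiplicity; until then their first move makes the score of [T] strictly larger. *)
Lemma gather_two (b q : 'I_k) x : 3 <= k ->
  p0 b = T -> p0 q = x -> x != T ->
  (forall r, inX T (p0 r) = (r == b) || (r == q)) ->
  inner_score T x (conf p0) <= inner_score T T (conf p0) ->
  (forall s, is_aut s -> config_map s (conf p0) (conf p0) -> s T = T) ->
  gatherable p0.
Proof.
move=> k3 bT qx xT Xp0 maxT stab.
have Xx : inX T x by rewrite -qx Xp0 eqxx orbT.
have qb : q != b by apply: contraNneq xT => E; rewrite -qx E bT.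
have [c0 [c0b c0q]] := third_robot b q k3.
have nc0 : ~~ inX T (p0 c0) by rewrite Xp0 negb_or c0b.
have [c nc cmin] := arg_minnP (P := fun r => ~~ inX T (p0 r)) (fun r => dist (p0 r) T) nc0.
have cminx r : ~~ inX T (p0 r) -> dist (p0 c) T <= dist (p0 r) x.
  by move=> /(inner_min maxT)[r' nr' le]; apply: leq_trans (cmin _ nr') le.
set i := dist (p0 c) T in cmin cminx.
pose P1 pos := pos q = x /\ forall r, ~~ inX T (p0 r) -> i < dist (p0 r) T -> pos r = p0 r.
pose EnH (pos : 'I_k -> V) r := r = q \/ (~~ inX T (p0 r) /\ dist (p0 r) T <= i).
pose En (g : V -> nat) (u : V) := u <> T /\ (inX T u \/ dist u T <= i).
pose ok pos := [/\ P1 pos, reached p0 T pos & ~ unambiguous T (conf pos) T].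
have okX pos r : ok pos -> ~~ inX T (p0 r) -> ~~ inX T (pos r).
  move=> [_ re nu] nX; apply/negP => X; case: (reachedX re X) => [rT|E].
    apply: nu; apply: (unambiguous_double re _ (target_stays re bT) rT).
    by apply: contraNneq nX => <-; rewrite bT inX_T.
  by rewrite -E X in nX.
have okXE pos r : ok pos -> inX T (pos r) = inX T (p0 r).
  move=> okp; case: (boolP (inX T (p0 r))) => [|/(okX _ _ okp)/negPf->//].
  have [[pq _] re _] := okp.
  by rewrite Xp0 => /orP[] /eqP->; rewrite ?pq // target_stays ?inX_T.
have occ pos y : ok pos -> inX T y -> conf pos y != 0 -> y = T \/ y = x.
  move=> okp Xy /conf_gt0[r ry]; have [[pq _] re _] := okp.
  move: Xy; rewrite -ry okXE // Xp0 => /orP[] /eqP->; last by right.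
  by left; apply: target_stays.
apply: (@gather_plan m n k p0 T cT p0_inj p0W P1 EnH En).
- by left.
- move=> pos pos' s okp okp' auts sg.
  have Rs : s T = T \/ s T = x.
    apply: (occ pos') => //; first by rewrite aut_inXE ?inX_T.
    by rewrite sg -(target_stays (r := b) (pos := pos)) ?conf_at //; case: okp.
  have RsV : (s^-1)%g T = T \/ (s^-1)%g T = x.
    apply: (occ pos) => //; first by rewrite aut_inXE ?inX_T //; apply: is_autV.
    by rewrite -sg permKV -(target_stays (r := b) (pos := pos')) ?conf_at //; case: okp'.
  have strict p : ok p -> conf p =1 conf p0 \/
      (forall y, y = T \/ y = x -> y != T -> inner_score T y (conf p) < inner_score T T (conf p)).
    move=> okp1; have [[pq stat] re nu] := okp1.
    case: (excluded_middle_informative (exists r, p r != p0 r)) => [[r0 mv]|nomv]; last first.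
      left=> v; rewrite (_ : p = p0) //; apply: functional_extensionality => r.
      by apply/eqP/negPn/negP => neq; apply: nomv; exists r.
    right=> y [->|-> _]; first by rewrite eqxx.
    have n0 : ~~ inX T (p0 r0).
      apply: contraNN mv; rewrite Xp0 => /orP[] /eqP->; last by rewrite pq qx.
      by rewrite target_stays ?bT.
    have lt0 : dist (p r0) T < i.
      case: (walk_lt (re r0)) => [E|lt]; first by rewrite E eqxx in mv.
      apply: leq_trans lt _; rewrite leqNgt; apply: contraNN mv => lt.
      by rewrite stat.
    apply: inner_score_lt; first by exists r0; rewrite okXE.
    (* An unmoved robot is beaten by [r0], which has come strictly inside the minimal radius; a
       moved one is beaten by itself, being nearer to [T] than to [x]. *)
    move=> r; rewrite okXE // => nr; case: (eqVneq (p r) (p0 r)) => [E|mvr].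
      by exists r0; rewrite okXE // E; split=> //; apply: leq_trans lt0 (cminx r nr).
    exists r; rewrite okXE //; split=> //.
    apply: (walk_closer cT (p0W r) (re r)) => //; apply: leq_trans (cminx r nr).
    by rewrite leqNgt; apply: contraNN mvr => lt; rewrite stat.
  apply: (score_ident (R := fun y => y = T \/ y = x) (inner_score_equivariant cT) auts sg Rs RsV
    _ (stab s) (strict pos okp) (strict pos' okp')).
  by move=> y [->|->].
- by move=> pos y [_ re _]; apply: occupied_noalt (target_stays re bT).
- move=> pos pos' s u _ _ auts sT _ [neq en]; split.
    by move=> E; apply: neq; apply: (@perm_inj _ s); rewrite E sT.
  by case: en => [X|le]; [left; rewrite aut_inXE | right; rewrite -{1}sT aut_dist].
- move=> pos okp; have [[pq stat] re nu] := okp; exists q, c; split.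
  + by apply: contraNneq nc => <-; rewrite qx.
  + by rewrite pq; split; [apply/eqP | left].
  split; first by move=> E; move: nc; rewrite -(okXE _ _ okp) E inX_T.
  by right; case: (walk_lt (re c)) => [->|/ltnW].
- move=> pos r okp [neq en]; split; first exact/eqP.
  have [[pq stat] re nu] := okp.
  case: (boolP (inX T (p0 r))) => [|nr].
    by rewrite Xp0 => /orP[] /eqP E; [case: neq; rewrite E target_stays | left].
  case: en => [|le]; first by rewrite okXE // (negPf nr).
  right; split=> //; rewrite leqNgt; apply/negP => lt.
  by move: le; rewrite stat // leqNgt lt.
- move=> pos r d okp en st; have [[pq stat] re nu] := okp.
  case: (eqVneq r q) => [E|rq].
    right; apply: (@unambiguous_single _ b); first by rewrite upd_neq 1?E 1?eq_sym // target_stays.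
    move=> z; rewrite /upd E; case: eqP => [_ X|/eqP zq].
      by case: st => _ _ /(_ X).
    by rewrite okXE // Xp0 (negPf zq) orbF => /eqP->; apply: target_stays.
  left; split; first by rewrite upd_neq 1?eq_sym.
  move=> z nz lt; rewrite upd_neq; first exact: stat.
  apply: contraTneq lt => ->; rewrite -leqNgt.
  by case: en => [E|[]//]; rewrite E eqxx in rq.
by [].
Qed.

End OccupiedTarget.

Lemma rev_val N (i : 'I_N) : rev_ord i = N.-1 - i :> nat.
Proof. by rewrite /= revE. Qed.

(** * Sides of a box with four distinct corners *)

Section Corners.
Variables (m n : nat) (T : node m n).
Local Notation V := (node m n).
Hypotheses (cT : centered T) (T1 : T.1 + T.1 + 1 != m) (T2 : T.2 + T.2 + 1 != n).
Implicit Types (u v x y z : V) (s : {perm V}).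

(** For two adjacent corners these are the nodes of the segment joining them; the metric form
    commutes with automorphisms. *)
Definition side x y u := dist u x + dist u y == dist x y.

Lemma side_aut s x y u : is_aut s -> side (s x) (s y) (s u) = side x y u.
Proof. by move=> auts; rewrite /side !aut_dist. Qed.

Definition neighbours x y := (x = flip1 T /\ y = flip2 T) \/ (x = flip2 T /\ y = flip1 T).

Lemma neighboursC x y : neighbours x y -> neighbours y x.
Proof. by case=> -[-> ->]; [right | left]. Qed.

Let rev_neq1 : rev_ord T.1 <> T.1.
Proof. by move=> /(congr1 (@nat_of_ord _)); rewrite rev_val; move: T1 (ltn_ord T.1); clear; lia. Qed.

Let rev_neq2 : rev_ord T.2 <> T.2.
Proof. by move=> /(congr1 (@nat_of_ord _)); rewrite rev_val; move: T2 (ltn_ord T.2); clear; lia. Qed.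

Let gap_eq0 i j : (gap i j == 0) = (i == j).
Proof. rewrite /gap; clear; lia. Qed.

Let gapii i : gap i i = 0.
Proof. rewrite /gap; clear; lia. Qed.

Lemma neighbours_neq x y : neighbours x y ->
  [/\ x != T, x != opp T, x != y, y != T & y != opp T].
Proof.
by case=> -[-> ->]; split; apply/eqP => E;
  move: (congr1 fst E) (congr1 snd E) rev_neq1 rev_neq2 => /=; congruence.
Qed.

Lemma opp_neq : opp T != T.
Proof. by apply/eqP => /(congr1 fst) /= /rev_neq1. Qed.

Lemma neighbours_inX x y : neighbours x y -> inX T x /\ inX T y.
Proof. by case=> -[-> ->]; rewrite inX_flip1 inX_flip2. Qed.

Lemma neighbours_cover x y z : neighbours x y -> inX T z ->
  [\/ z = T, z = x, z = y | z = opp T].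
Proof.
by case=> -[-> ->] /inXP[]->; [apply: Or41|apply: Or42|apply: Or43|apply: Or44
  |apply: Or41|apply: Or43|apply: Or42|apply: Or44].
Qed.

Let val_flip1 : ((flip1 T).1 = m.-1 - T.1 :> nat) * ((flip1 T).2 = T.2).
Proof. by split; first exact: rev_val. Qed.

Let val_flip2 : ((flip2 T).2 = n.-1 - T.2 :> nat) * ((flip2 T).1 = T.1).
Proof. by split; first exact: rev_val. Qed.

Let val_opp : ((opp T).1 = m.-1 - T.1 :> nat) * ((opp T).2 = n.-1 - T.2 :> nat).
Proof. by split; exact: rev_val. Qed.

Let valE := (distE, val_flip1, val_flip2, val_opp).

Lemma neighbours_dist x y : neighbours x y ->
  [/\ dist y (opp T) = dist T x, dist x y = dist T (opp T),
      dist T (opp T) = dist T x + dist T y & 0 < dist T x].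
Proof.
have g1 : 0 < gap T.1 (m.-1 - T.1) by move: T1 (ltn_ord T.1); rewrite /gap; clear; lia.
have g2 : 0 < gap T.2 (n.-1 - T.2) by move: T2 (ltn_ord T.2); rewrite /gap; clear; lia.
by case=> -[-> ->]; split; rewrite !valE ?gapii; move: g1 g2;
  rewrite ?(gapC (m.-1 - _)) ?(gapC (n.-1 - _)); clear; lia.
Qed.

Lemma side1E u : between m T.1 u.1 -> between n T.2 u.2 ->
  side (flip1 T) (opp T) u = (u.1 == m.-1 - T.1 :> nat).
Proof.
move=> b1 b2; rewrite /side !valE -(gap_eq0 u.1).
have := opposite_gap (ltn_ord T.2) b2 T2; rewrite revE.
rewrite !gapii ?(gapC (n.-1 - _)); clear; lia.
Qed.

Lemma side2E u : between m T.1 u.1 -> between n T.2 u.2 ->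
  side (flip2 T) (opp T) u = (u.2 == n.-1 - T.2 :> nat).
Proof.
move=> b1 b2; rewrite /side !valE -(gap_eq0 u.2).
have := opposite_gap (ltn_ord T.1) b1 T1; rewrite revE.
rewrite !gapii ?(gapC (m.-1 - _)); clear; lia.
Qed.

Lemma sideT1E u : between m T.1 u.1 -> side T (flip1 T) u = (u.2 == T.2 :> nat).
Proof.
move=> b1; rewrite /side !valE -(gap_eq0 u.2).
have := opposite_gap (ltn_ord T.1) b1 T1; rewrite revE.
rewrite !gapii ?(gapC (m.-1 - _)); clear; lia.
Qed.

Lemma sideT2E u : between n T.2 u.2 -> side T (flip2 T) u = (u.1 == T.1 :> nat).
Proof.
move=> b1; rewrite /side !valE -(gap_eq0 u.1).
have := opposite_gap (ltn_ord T.2) b1 T2; rewrite revE.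
rewrite !gapii ?(gapC (n.-1 - _)); clear; lia.
Qed.

Let inWb u : inW T u -> between m T.1 u.1 /\ between n T.2 u.2.
Proof. by case/andP => /andP[]. Qed.

Let leave_end N t i j : t < N -> between N t i -> t + t + 1 != N ->
  gap i t = (gap j t).+1 -> j != N.-1 - t.
Proof. rewrite /between /gap; clear; lia. Qed.

(** A step lowers the distance to [T] in one coordinate, which therefore cannot reach the line
    facing [T]: the sides ending at [opp T] are never entered. *)
Lemma side_step x y u u' : neighbours x y -> inW T u -> step T u u' ->
  ~~ side y (opp T) u -> ~~ side y (opp T) u'.
Proof.
move=> nb Wu st; have [b1 b2] := inWb Wu.
have [b1' b2'] := inWb (step_inW cT Wu st); case: st => au lt _ _.
by case: nb => -[_ ->]; rewrite ?side1E ?side2E //;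
  case: (step_coord au lt) => -[e1 e _]; first [by rewrite e1 | by move=> _; apply: leave_end e].
Qed.

(** On this side one coordinate already agrees with that of [T], and a step cannot change it. *)
Lemma side_target_step x y u u' : neighbours x y -> inW T u -> step T u u' ->
  side T x u -> side T x u'.
Proof.
move=> nb Wu st; have Wu' := step_inW cT Wu st.
have [b1 b2] := inWb Wu; have [b1' b2'] := inWb Wu'; case: st => au lt _ _.
case: nb => -[-> _]; rewrite ?sideT1E ?sideT2E //;
  case: (step_coord au lt) => -[e1 e _];
  first [by rewrite e1 | by move=> /eqP E; move: e; rewrite E gapii].
Qed.

Lemma side_target_walk x y u v : neighbours x y -> inW T u -> walk T u v ->
  side T x u -> side T x v.
Proof.
move=> nb Wu wk sd; elim: wk => // v' w wk IH st.
exact: side_target_step nb (walk_inW cT Wu wk) st IH.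
Qed.

Lemma side_walk x y v : neighbours x y -> inW T x -> walk T x v -> side T x v.
Proof.
move=> nb Wx wk; apply: side_target_walk nb Wx wk _.
by rewrite /side distvv addn0 distC.
Qed.

Let between_inj N t i j : t < N -> t + t + 1 != N -> between N t i -> between N t j ->
  gap i t = gap j t -> i = j.
Proof. rewrite /between /gap; clear; lia. Qed.

Lemma side_target_inj x y u v : neighbours x y -> inW T u -> inW T v ->
  side T x u -> side T x v -> dist u T = dist v T -> u = v.
Proof.
move=> nb /inWb[b1 b2] /inWb[b1' b2'].
case: nb => -[-> _]; rewrite ?sideT1E ?sideT2E // => /eqP E /eqP E'; rewrite !distE E E' !gapii.
  by rewrite !addn0 => /(between_inj (ltn_ord _) T1 b1 b1') e; apply: node_eq; rewrite ?E ?E'.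
by move=> /(between_inj (ltn_ord _) T2 b2 b2') e; apply: node_eq; rewrite ?E ?E'.
Qed.

Lemma side_disjoint x y u : neighbours x y -> inW T u -> ~~ inX T u -> side T x u ->
  [/\ ~~ side T y u, ~~ side (opp T) x u & ~~ side (opp T) y u].
Proof.
move=> nb /inWb[b1 b2] nX.
have sC z : side (opp T) z u = side z (opp T) u by rewrite /side addnC (distC (opp T)).
have n1 : T.1 <> m.-1 - T.1 :> nat by move: T1 (ltn_ord T.1); clear; lia.
have n2 : T.2 <> n.-1 - T.2 :> nat by move: T2 (ltn_ord T.2); clear; lia.
have bad z : inX T z -> u <> z by move=> Xz E; rewrite E Xz in nX.
rewrite !sC; case: nb => -[-> ->]; rewrite ?sideT1E ?sideT2E ?side1E ?side2E // => /eqP E;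
  split; apply/eqP => E'.
- exact: (bad _ (inX_T T) (node_eq E' E)).
- by apply: (bad _ (inX_flip1 T)); apply: node_eq; rewrite ?val_flip1.
- by apply: n2; rewrite -E' E.
- exact: (bad _ (inX_T T) (node_eq E E')).
- by apply: (bad _ (inX_flip2 T)); apply: node_eq; rewrite ?val_flip2.
by apply: n1; rewrite -E' E.
Qed.

(** The first step from [x] follows the side leading to [T], perpendicular to the one leading to
    [opp T]. *)
Lemma side_leave x y d : neighbours x y -> inW T x -> step T x d -> ~~ side x (opp T) d.
Proof.
move=> nb Wx st; have := side_walk nb Wx (walkS (walk0 _ _) st).
have [b1 b2] := inWb Wx; have [b1' b2'] := inWb (step_inW cT Wx st).
move: Wx b1 b2 st; case: nb => -[-> _] Wx b1 b2 [au lt _ _];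
  rewrite ?side1E ?side2E ?sideT1E ?sideT2E // => /eqP E.
  case: (step_coord au lt) => -[_ e _]; last by move: e; rewrite val_flip1 gapii.
  exact: leave_end e.
case: (step_coord au lt) => -[_ e _]; first by move: e; rewrite val_flip2 gapii.
exact: leave_end e.
Qed.

Lemma side_corner x y : neighbours x y ->
  [/\ ~~ side y (opp T) x, ~~ side y (opp T) T & forall u, inW T u ->
    side y (opp T) u -> side x (opp T) u -> u = opp T].
Proof.
move=> nb; have [e1 e2 e3 e4] := neighbours_dist nb.
have [f1 f2 f3 f4] := neighbours_dist (neighboursC nb).
split; first by rewrite /side e1 f1 e2 e3; move: e4 f4; clear; lia.
  by rewrite /side e1 e3; move: e4 f4; clear; lia.
move=> u /inWb[b1 b2].
by case: nb => -[-> ->]; rewrite side1E // side2E // => /eqP h1 /eqP h2;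
  apply: node_eq; rewrite val_opp.
Qed.

(** Only opposite corners are as far apart as a diagonal of the box. *)
Lemma opposite_neighbour x y z : neighbours x y -> inX T z ->
  dist z x = dist T (opp T) -> z = y.
Proof.
move=> nb Xz; have [e1 e2 e3 e4] := neighbours_dist nb.
have [f1 f2 f3 f4] := neighbours_dist (neighboursC nb).
case: (neighbours_cover nb Xz) => -> //; rewrite ?(distC (opp T) x) ?distvv ?f3 ?f1;
  by move: e4 f4; clear; lia.
Qed.

Lemma opposite_opp z : inX T z -> dist z (opp T) = dist T (opp T) -> z = T.
Proof.
have nb : neighbours (flip1 T) (flip2 T) by left.
move=> Xz; have [e1 e2 e3 e4] := neighbours_dist nb.
have [f1 f2 f3 f4] := neighbours_dist (neighboursC nb).
case: (neighbours_cover nb Xz) => -> //; rewrite ?distvv ?e3 ?f3 ?e1 ?f1;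
  by move: e4 f4; clear; lia.
Qed.

Lemma aut_opp s : is_aut s -> s T = T -> s (opp T) = opp T.
Proof.
move=> auts sT.
have nb : neighbours (flip1 T) (flip2 T) by left.
have nbo : inX T (s (opp T)) by rewrite aut_inXE ?inX_opp.
have [e1 e2 e3 e4] := neighbours_dist nb.
have [f1 f2 f3 f4] := neighbours_dist (neighboursC nb).
have dso : dist T (s (opp T)) = dist T (opp T) by rewrite -{1}sT aut_dist.
case: (neighbours_cover nb nbo) => // E; move: dso; rewrite E ?distvv ?e3;
  by move: e4 f4; clear; lia.
Qed.

Lemma aut_neighbours s x y : is_aut s -> s T = T -> neighbours x y ->
  (s x = x /\ s y = y) \/ (s x = y /\ s y = x).
Proof.
move=> auts sT nb; have so := aut_opp auts sT.
have [xT xo xy yT yo] := neighbours_neq nb; have [Xx Xy] := neighbours_inX nb.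
have stay z : inX T z -> z != T -> z != opp T -> s z = x \/ s z = y.
  move=> Xz zT zo; have Xsz : inX T (s z) by rewrite aut_inXE.
  case: (neighbours_cover nb Xsz) => E; [|by left|by right|].
    by move: zT; rewrite -(aut_neq s) sT E eqxx.
  by move: zo; rewrite -(aut_neq s) so E eqxx.
have nxy : s x != s y by rewrite aut_neq.
by case: (stay x Xx xT xo) (stay y Xy yT yo) nxy => -> [] ->; rewrite ?eqxx // => _; [left | right].
Qed.

End Corners.

(** * Three occupied corners *)

Section ThreePlan.
Variables (m n k : nat).
Local Notation V := (node m n).
Variables (p0 : 'I_k -> V) (T : V).
Hypotheses (k3 : 3 <= k) (cT : centered T) (p0_inj : injective p0).
Hypothesis p0W : forall r, inW T (p0 r).
Hypotheses (T1 : T.1 + T.1 + 1 != m) (T2 : T.2 + T.2 + 1 != n).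
Implicit Types (pos : 'I_k -> V) (x y : V).

(* The side from [y] to [opp T] is parallel to the side from [x] to [T]. A robot leaves
   the corner [x] along the latter, so once the former is free of robots the corner [T]
   cannot be mistaken for a neighbouring one. *)
Definition clear_side y (g : V -> nat) :=
  forall u : V, g u != 0 -> ~~ inX T u -> ~~ side y (opp T) u.

(** When [y] is empty, the departure from [x] makes [T] the only occupied corner and nothing has to
    be kept clear. *)
Definition may_leave y (g : V -> nat) := g y = 0 \/ clear_side y g.

Lemma may_leave_step x y pos r d : neighbours T x y -> reached p0 T pos ->
  step T (pos r) d -> [\/ ~~ inX T (pos r), pos r = x | pos r = y] ->
  (clear_side y (conf pos) -> clear_side y (conf (upd pos r d))) /\
  (may_leave y (conf pos) -> may_leave y (conf (upd pos r d))).
Proof.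
move=> nb re st at_r; have Wr := reached_inW cT p0W r re.
have cl : clear_side y (conf pos) -> clear_side y (conf (upd pos r d)).
  move=> cy u /conf_gt0[z zu] nu; move: zu; rewrite /upd; case: eqP => _ zu; last first.
    by rewrite -zu in nu *; apply: cy; rewrite ?conf_at.
  rewrite -{}zu {u nu}; case: at_r => E.
  - by apply: (side_step cT T1 T2 nb Wr st); apply: cy; rewrite ?conf_at.
  - apply: (side_step cT T1 T2 nb Wr st); rewrite E.
    by case: (side_corner T1 T2 nb).
  by rewrite E in Wr st; apply: (side_leave cT T1 T2 (neighboursC nb) Wr st).
split=> // -[y0|cy]; [left | by right; apply: cl].
apply/eqP/negPn/negP => /conf_gt0[z]; rewrite /upd; case: eqP => _ zy.
  have [_ _ _ yT _] := neighbours_neq T1 T2 nb; have [_ Xy] := neighbours_inX nb.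
  case: st => _ _ noX _; rewrite zy in noX.
  by have E := noX Xy; rewrite E eqxx in yT.
by have := conf_at pos z; rewrite zy y0.
Qed.

(** Initially [T] faces the only empty corner. Robots off the corners always move, and can only
    clear the sides ending at [opp T]; a corner robot waits for [may_leave], after which the clear
    side marks the difference between [T] and its neighbours. *)
Lemma gather_three (b q1 q2 : 'I_k) :
  p0 b = T -> p0 q1 = flip1 T -> p0 q2 = flip2 T ->
  (forall r, p0 r != opp T) -> gatherable p0.
Proof.
move=> bT q1x q2y noopp.
have nb : neighbours T (flip1 T) (flip2 T) by left.
have [xT xo xy yT yo] := neighbours_neq T1 T2 nb.
set x := flip1 T in nb q1x xT xo xy; set y := flip2 T in nb q2y xy yT yo.
have [Xx Xy] := neighbours_inX nb.
pose En (g : V -> nat) u := u <> T /\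
  [\/ ~~ inX T u, u = x /\ may_leave y g | u = y /\ may_leave x g].
pose EnH (pos : 'I_k -> V) r := [\/ ~~ inX T (pos r),
  [/\ r = q1, pos r = x & may_leave y (conf pos)] |
  [/\ r = q2, pos r = y & may_leave x (conf pos)]].
pose P1 pos := (pos q1 = x \/ clear_side y (conf pos)) /\
  (pos q2 = y \/ clear_side x (conf pos)).
pose ok pos := [/\ P1 pos, reached p0 T pos & ~ unambiguous T (conf pos) T].
have bq1 : b != q1 by apply: contraNneq xT => E; rewrite -q1x -E bT.
have bq2 : b != q2 by apply: contraNneq yT => E; rewrite -q2y -E bT.
have q12 : q1 != q2 by apply: contraNneq xy => E; rewrite -q1x E q2y.
have atX pos r : reached p0 T pos -> inX T (pos r) ->
    [\/ pos r = T, r = q1 /\ pos r = x | r = q2 /\ pos r = y].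
  move=> re X; case: (reachedX re X) => [|E]; first by apply: Or31.
  rewrite E in X *; case: (neighbours_cover nb X) => E'.
  - by apply: Or31.
  - by apply: Or32; split=> //; apply: p0_inj; rewrite q1x.
  - by apply: Or33; split=> //; apply: p0_inj; rewrite q2y.
  by have := noopp r; rewrite E' eqxx.
have notT pos r : ok pos -> r != b -> pos r <> T.
  move=> [_ re nu] rb rT; apply: nu.
  by apply: (unambiguous_double p0_inj re rb rT); apply: target_stays re bT.
have opp0 pos : ok pos -> conf pos (opp T) = 0.
  move=> [_ re _]; apply/eqP/negPn/negP => /conf_gt0[r ro].
  have := atX pos r re; rewrite ro => /(_ (inX_opp T))[E|[_ E]|[_ E]].
  - by have := opp_neq T1; rewrite E eqxx.
  - by rewrite E eqxx in xo.
  by rewrite E eqxx in yo.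
have out pos r z : ok pos -> r != b -> p0 r = z -> conf pos z = 0 -> ~~ inX T (pos r).
  move=> okp rb rz z0; apply/negP => X; have [_ re _] := okp.
  case: (reachedX re X) => E; first exact: (notT _ _ okp rb E).
  by have := conf_at pos r; rewrite E rz z0.
(* If [s] sends [T] to [x'], it sends [opp T] to [y'], which is thus empty in [pos'], so the side
   from [x'] to [opp T] is clear there. But the corner [z] sent to [opp T] has lost its robot, now
   on the side from [z] to [T], whose image is that clear side. *)
have ident pos pos' s x' y' r1 r2 : ok pos -> ok pos' -> is_aut s ->
    config_map s (conf pos) (conf pos') -> neighbours T x' y' ->
    p0 r1 = x' -> p0 r2 = y' -> r1 != b -> r2 != b ->
    (pos' r2 = y' \/ clear_side x' (conf pos')) -> s T <> x'.
  move=> okp okp' auts sg nb' r1x r2y r1b r2b cond sT.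
  have [x'T x'o x'y y'T y'o] := neighbours_neq T1 T2 nb'.
  have so : s (opp T) = y'.
    apply: (opposite_neighbour T1 T2 nb'); first by rewrite aut_inXE ?inX_opp.
    by rewrite -sT aut_dist // distC.
  have y0 : conf pos' y' = 0 by rewrite -so sg opp0.
  have clx : clear_side x' (conf pos').
    by case: cond => // E; have := conf_at pos' r2; rewrite E y0.
  set z := (s^-1)%g (opp T).
  have sz : s z = opp T by rewrite permKV.
  have z0 : conf pos z = 0 by rewrite -sg sz opp0.
  have Xz : inX T z by rewrite -(aut_inXE _ cT auts) sz inX_opp.
  have [rz [rzb rzz zz]] : exists r, [/\ r != b, p0 r = z & z = x' \/ z = y'].
    case: (neighbours_cover nb' Xz) => E.
    - by move: sz x'o; rewrite E sT => ->; rewrite eqxx.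
    - by exists r1; rewrite E; split=> //; left.
    - by exists r2; rewrite E; split=> //; right.
    by move: sz y'o; rewrite E so => ->; rewrite eqxx.
  have no := out _ _ _ okp rzb rzz z0.
  have [_ re _] := okp.
  have sd : side T z (pos rz).
    have Wz : inW T z by rewrite -rzz.
    have wk : walk T z (pos rz) by have := re rz; rewrite rzz.
    by case: zz => E; rewrite E in Wz wk *;
      [apply: (side_walk cT T1 T2 nb') | apply: (side_walk cT T1 T2 (neighboursC nb'))].
  have := clx (s (pos rz)); rewrite sg conf_at aut_inXE // => /(_ isT no).
  by rewrite -sT -sz side_aut // sd.
have at_r pos r : ok pos -> EnH pos r -> [\/ ~~ inX T (pos r), pos r = x | pos r = y].
  by move=> _ [?|[_ ? _]|[_ ? _]]; [apply: Or31 | apply: Or32 | apply: Or33].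
have at_r' pos r : ok pos -> EnH pos r -> [\/ ~~ inX T (pos r), pos r = y | pos r = x].
  by move=> okp /(at_r _ _ okp)[?|?|?]; [apply: Or31 | apply: Or33 | apply: Or32].
have single pos r z z' : ok pos -> step T (pos r) z' -> pos r = z ->
    (forall q, pos q = x \/ pos q = y -> q = r) ->
    unambiguous T (conf (upd pos r z')) T.
  move=> okp st rz only; have [_ re nu] := okp.
  have rb : r != b by apply/eqP => E; case: (step_source st); rewrite E (target_stays re bT).
  apply: (@unambiguous_single _ _ _ _ _ b).
    by rewrite upd_neq 1?eq_sym // (target_stays re bT).
  move=> q; rewrite /upd; case: eqP => [_ X|qr X]; first by case: st => _ _ /(_ X).
  case: (atX _ _ re X) => // -[_ E]; case: qr; apply: only; by [left | right].
apply: (@gather_plan m n k p0 T cT p0_inj p0W P1 EnH En).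
- by left; split; left.
- move=> pos pos' s okp okp' auts sg.
  have [P re nu] := okp; have [[c1 c2] re' nu'] := okp'.
  have XsT : inX T (s T) by rewrite aut_inXE ?inX_T.
  have q1b : q1 != b by rewrite eq_sym.
  have q2b : q2 != b by rewrite eq_sym.
  case: (neighbours_cover nb XsT) => // E; exfalso.
  + exact: (ident pos pos' s x y q1 q2 okp okp' auts sg nb q1x q2y q1b q2b c2 E).
  + exact: (ident pos pos' s y x q2 q1 okp okp' auts sg (neighboursC nb) q2y q1x q2b q1b c1 E).
  by have := conf_at pos b; rewrite (target_stays re bT) -sg E opp0.
- by move=> pos z [_ re _]; apply: (occupied_noalt p0_inj re (target_stays re bT)).
- move=> pos pos' s u okp okp' auts sT sg [neq en]; split.
    by move=> E; apply: neq; apply: (@perm_inj _ s); rewrite E sT.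
  have so := aut_opp cT T1 T2 auts sT.
  have may z : may_leave z (conf pos) -> may_leave (s z) (conf pos').
    case=> [z0|cz]; [by left; rewrite sg | right => v gv nv].
    rewrite -(permKV s v) -so side_aut //; apply: cz.
      by rewrite -sg permKV.
    by rewrite aut_inXE //; apply: is_autV.
  have swap := aut_neighbours cT T1 T2 auts sT nb.
  case: en => [nX|[-> mv]|[-> mv]]; first by apply: Or31; rewrite aut_inXE.
    by have := may _ mv; case: swap => -[-> ->] mv'; [apply: Or32 | apply: Or33].
  by have := may _ mv; case: swap => -[-> ->] mv'; [apply: Or33 | apply: Or32].
- move=> pos okp; have [[c1 c2] re nu] := okp.
  have nout r : ~~ inX T (pos r) -> En (conf pos) (pos r).
    by move=> nX; split; [move=> E; rewrite E inX_T in nX | apply: Or31].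
  have conf0 z r : p0 r = z -> inX T z -> z != T -> pos r <> z -> conf pos z = 0.
    move=> rz Xz zT nz; apply/eqP/negPn/negP => /conf_gt0[q qz].
    case: (reachedX (r := q) re); rewrite ?qz // => E; first by rewrite E eqxx in zT.
    by apply: nz; rewrite -qz; congr pos; apply: p0_inj; rewrite rz.
  have move1 : pos q1 <> x -> ~~ inX T (pos q1).
    by move=> nx; apply: (out _ _ x okp) => //; [rewrite eq_sym | apply: conf0 q1x Xx xT nx].
  have move2 : pos q2 <> y -> ~~ inX T (pos q2).
    by move=> ny; apply: (out _ _ y okp) => //; [rewrite eq_sym | apply: conf0 q2y Xy yT ny].
  have en1 : pos q1 = x -> may_leave y (conf pos) -> En (conf pos) (pos q1).
    by move=> -> mv; split; [apply/eqP | apply: Or32].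
  have en2 : pos q2 = y -> may_leave x (conf pos) -> En (conf pos) (pos q2).
    by move=> -> mv; split; [apply/eqP | apply: Or33].
  case: (eqVneq (pos q1) x) => [E1|/eqP n1]; case: (eqVneq (pos q2) y) => [E2|/eqP n2].
  (* Both neighbours are still occupied: a side that is not clear provides a robot off the corners,
     and one robot cannot block both sides, which meet only in [opp T]. *)
  + have block z : ~ clear_side z (conf pos) ->
        exists r, ~~ inX T (pos r) /\ side z (opp T) (pos r).
      move=> ncl; case: (excluded_middle_informative (exists r, ~~ inX T (pos r) /\ side z (opp T) (pos r))) => // nex; case: ncl => u /conf_gt0[r <-] nX; apply/negP => sd.
      by apply: nex; exists r.
    case: (excluded_middle_informative (clear_side y (conf pos))) => cy;
      case: (excluded_middle_informative (clear_side x (conf pos))) => cx.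
    * by exists q1, q2; split=> //; [apply: en1 | apply: en2] => //; right.
    * have [r [nX _]] := block _ cx; exists q1, r; split; first by apply: contraNneq nX => <-; rewrite E1.
        by apply: en1 => //; right.
      exact: nout.
    * have [r [nX _]] := block _ cy; exists q2, r; split; first by apply: contraNneq nX => <-; rewrite E2.
        by apply: en2 => //; right.
      exact: nout.
    have [r [nX sd]] := block _ cy; have [r' [nX' sd']] := block _ cx.
    exists r, r'; split; [|exact: nout|exact: nout].
    apply: contraNneq nX => E; rewrite -E in sd'.
    have [_ _ only] := side_corner T1 T2 nb.
    by rewrite (only _ (reached_inW cT p0W r re) sd sd') inX_opp.
  + exists q1, q2; split=> //; last by apply/nout/move2.
    by apply: en1 => //; left; apply: conf0 q2y Xy yT n2.
  + exists q1, q2; split=> //; first by apply/nout/move1.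
    by apply: en2 => //; left; apply: conf0 q1x Xx xT n1.
  by exists q1, q2; split=> //; apply/nout; [apply: move1 | apply: move2].
- move=> pos r okp [neq en]; split; first exact/eqP.
  have [_ re _] := okp.
  have who z q : p0 q = z -> inX T z -> z != T -> pos r = z -> r = q.
    move=> qz Xz zT rz; apply: p0_inj; rewrite qz.
    by case: (reachedX (r := r) re); rewrite rz // => E; rewrite E eqxx in zT.
  case: en => [nX|[E mv]|[E mv]]; [exact: Or31|apply: Or32|apply: Or33]; split=> //.
    exact: who q1x Xx xT E.
  exact: who q2y Xy yT E.
- move=> pos r d okp en st; have [[c1 c2] re nu] := okp.
  have [cy my] := may_leave_step nb re st (at_r _ _ okp en).
  have [cx mx] := may_leave_step (neighboursC nb) re st (at_r' _ _ okp en).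
  have who z q q' : p0 q = z -> inX T z -> z != T -> pos q' = z -> q' = q.
    move=> qz Xz zT rz; apply: p0_inj; rewrite qz.
    by case: (reachedX (r := q') re); rewrite rz // => E; rewrite E eqxx in zT.
  have empty z q : conf pos z = 0 -> pos q <> z.
    by move=> z0 E; have := conf_at pos q; rewrite E z0.
  case: en => [nX|[rq E [y0|cly]]|[rq E [x0|clx]]].
  + left; split.
      case: (eqVneq q1 r) => [q1r|q1r].
        by right; apply: cy; case: c1 => // E; move: nX; rewrite -q1r E Xx.
      by case: c1 => [E|/cy]; [left; rewrite upd_neq | right].
    case: (eqVneq q2 r) => [q2r|q2r].
      by right; apply: cx; case: c2 => // E; move: nX; rewrite -q2r E Xy.
    by case: c2 => [E|/cx]; [left; rewrite upd_neq | right].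
  + right; apply: (single pos r x d okp st E) => q [qx|/(empty _ _ y0)//].
    by rewrite rq; apply: who q1x Xx xT qx.
  + left; split; first by right; apply: cy.
    by case: c2 => [E2|/cx]; [left; rewrite upd_neq // rq eq_sym | right].
  + right; apply: (single pos r y d okp st E) => q [/(empty _ _ x0)//|qy].
    by rewrite rq; apply: who q2y Xy yT qy.
  left; split; last by right; apply: cx.
  by case: c1 => [E1|/cy]; [left; rewrite upd_neq // rq | right].
move=> pos r r' d okp en en' neq st; have [_ re _] := okp.
have [_ my] := may_leave_step nb re st (at_r _ _ okp en).
have [_ mx] := may_leave_step (neighboursC nb) re st (at_r' _ _ okp en).
rewrite /EnH upd_neq //; case: en' => [nX|[? ? mv]|[? ? mv]];
  [apply: Or31 | apply: Or32 | apply: Or33] => //.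
  by split=> //; apply: my.
by split=> //; apply: mx.
Qed.

End ThreePlan.

(** * Four occupied corners, without diagonal symmetry *)

Section FourPlan.
Variables (m n k : nat).
Local Notation V := (node m n).
Variables (p0 : 'I_k -> V) (T : V).
Hypotheses (cT : centered T) (p0_inj : injective p0).
Hypothesis p0W : forall r, inW T (p0 r).
Hypotheses (T1 : T.1 + T.1 + 1 != m) (T2 : T.2 + T.2 + 1 != n).
Implicit Types (pos : 'I_k -> V) (x y : V).

(** The robots on the neighbours of [T] wait until [T] is a multiplicity. While [opp T] is occupied
    the score designates [T]; once [q3] has left, [T] faces the only empty corner and every robot
    off the corners may move. *)
Lemma gather_four (b q1 q2 q3 a : 'I_k) :
  p0 b = T -> p0 q1 = flip1 T -> p0 q2 = flip2 T -> p0 q3 = opp T ->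
  ~~ inX T (p0 a) ->
  (forall x, inX T x -> inner_score T x (conf p0) <= inner_score T T (conf p0)) ->
  (forall s, is_aut s -> config_map s (conf p0) (conf p0) -> s T = T) ->
  gatherable p0.
Proof.
move=> bT q1x q2y q3o nXa maxT stab.
have nb : neighbours T (flip1 T) (flip2 T) by left.
have [xT xo xy yT yo] := neighbours_neq T1 T2 nb.
set x := flip1 T in nb q1x xT xo xy; set y := flip2 T in nb q2y xy yT yo.
set o := opp T in q3o xo yo.
have oT : o != T := opp_neq T1.
have [Xx Xy] := neighbours_inX nb; have Xo : inX T o := inX_opp T.
have [c nc cmin] := arg_minnP (P := fun r => ~~ inX T (p0 r)) (fun r => dist (p0 r) T) nXa.
have cminx r z : ~~ inX T (p0 r) -> inX T z -> dist (p0 c) T <= dist (p0 r) z.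
  move=> nX Xz; have [r' nr' le] := inner_min (maxT z Xz) nX.
  exact: leq_trans (cmin _ nr') le.
set i := dist (p0 c) T in cmin cminx.
have bq3 : b != q3 by apply: contraNneq oT => E; rewrite -q3o -E bT.
have cornerE z r : p0 r = z -> inX T z -> forall q, p0 q = z -> q = r.
  by move=> rz _ q qz; apply: p0_inj; rewrite rz.
pose P1 pos := [/\ pos q1 = x, pos q2 = y &
  pos q3 = o -> forall r, ~~ inX T (p0 r) -> i < dist (p0 r) T -> pos r = p0 r].
pose ok pos := [/\ P1 pos, reached p0 T pos & ~ unambiguous T (conf pos) T].
pose En (g : V -> nat) u := u <> T /\
  ((g o <> 0 /\ (u = o \/ (~~ inX T u /\ dist u T <= i))) \/ (g o = 0 /\ ~~ inX T u)).
pose EnH (pos : 'I_k -> V) r :=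
  r = q3 \/ (~~ inX T (p0 r) /\ (pos q3 <> o \/ dist (p0 r) T <= i)).
have notT pos r : ok pos -> r != b -> pos r <> T.
  move=> [_ re nu] rb rT; apply: nu.
  by apply: (unambiguous_double p0_inj re rb rT); apply: target_stays re bT.
have o0 pos : reached p0 T pos -> (conf pos o = 0) <-> (pos q3 <> o).
  move=> re; split=> [z0 E|ne]; first by have := conf_at pos q3; rewrite E z0.
  apply/eqP/negPn/negP => /conf_gt0[q qo].
  case: (reachedX (r := q) re); rewrite qo // => E; first by rewrite E eqxx in oT.
  by apply: ne; rewrite -qo; congr pos; apply: p0_inj; rewrite q3o.
have inner pos r : ok pos -> ~~ inX T (p0 r) -> ~~ inX T (pos r).
  move=> okp nX; have [_ re _] := okp; apply/negP => X.
  case: (reachedX re X) => E; last by rewrite -E X in nX.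
  apply: (notT _ r okp) => //; apply: contraNneq nX => ->; by rewrite bT inX_T.
have origin r : inX T (p0 r) -> [\/ r = b, r = q1, r = q2 | r = q3].
  move=> X; case: (neighbours_cover nb X) => E.
  - by apply: Or41; apply: p0_inj; rewrite bT.
  - by apply: Or42; apply: p0_inj; rewrite q1x.
  - by apply: Or43; apply: p0_inj; rewrite q2y.
  by apply: Or44; apply: p0_inj; rewrite q3o.
have inner_origin pos r : ok pos -> ~~ inX T (pos r) -> r = q3 \/ ~~ inX T (p0 r).
  move=> okp nX; have [[E1 E2 _] re _] := okp.
  case: (boolP (inX T (p0 r))) => [X|]; [left | by right].
  case: (origin r X) => E //; move: nX; rewrite E ?E1 ?E2 ?Xx ?Xy //.
  by rewrite (target_stays re bT) inX_T.
have q3_out pos : ok pos -> pos q3 <> o -> ~~ inX T (pos q3).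
  move=> okp ne; have [_ re _] := okp; apply/negP => X.
  case: (reachedX re X) => E; last by apply: ne; rewrite E.
  by apply: (notT _ q3 okp) => //; rewrite eq_sym.
have c3 : c != q3 by apply: contraNneq nc => ->; rewrite q3o.
have cb : c != b by apply: contraNneq nc => ->; rewrite bT inX_T.
apply: (@gather_plan m n k p0 T cT p0_inj p0W P1 EnH En).
- by left; split.
- move=> pos pos' s okp okp' auts sg.
  have [[E1 E2 stat] re nu] := okp; have [[E1' E2' stat'] re' nu'] := okp'.
  have full p z : ok p -> inX T z -> z <> o -> conf p z <> 0.
    move=> [[h1 h2 _] rep _] Xz zo; apply/eqP.
    case: (neighbours_cover nb Xz) => E //; apply/conf_gt0.
    + by exists b; rewrite E; apply: target_stays rep bT.
    + by exists q1; rewrite E.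
    by exists q2; rewrite E.
  have XsT : inX T (s T) by rewrite aut_inXE ?inX_T.
  have XsVT : inX T ((s^-1)%g T) by rewrite aut_inXE ?inX_T //; apply: is_autV.
  (* An empty corner is sent to an empty corner, which can only be [o] again; then [T] is fixed as
     the corner facing it. *)
  case: (eqVneq (pos q3) o) => [E3|/eqP n3]; last first.
    have so : s o = o.
      have [//|/eqP ne] := eqVneq (s o) o.
      case: (full pos' (s o) okp' _ ne); first by rewrite aut_inXE.
      by rewrite sg; apply/o0.
    by apply: (opposite_opp T1 T2 XsT); have := aut_dist T o auts; rewrite so.
  (* All corners are occupied in [pos], hence also in [pos'], and the scores decide. *)
  have E3' : pos' q3 = o.
    have [//|/eqP ne] := eqVneq (pos' q3) o.
    have z0 := (o0 pos' re').2 ne.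
    have [E|/eqP nE] := eqVneq ((s^-1)%g o) o.
      have := sg o; rewrite -{1}E permKV z0 => /esym; rewrite -E3 => E0.
      by have := conf_at pos q3; rewrite E0.
    case: (full pos ((s^-1)%g o) okp _ nE); first by rewrite aut_inXE //; apply: is_autV.
    by rewrite -sg permKV.
  have strict p : ok p -> p q3 = o -> conf p =1 conf p0 \/
      (forall z, inX T z -> z != T -> inner_score T z (conf p) < inner_score T T (conf p)).
    move=> okp1 p3; have [[h1 h2 st] rep nup] := okp1.
    case: (excluded_middle_informative (exists r, p r != p0 r)) => [[r0 mv]|nomv]; last first.
      left=> v; rewrite (_ : p = p0) //; apply: functional_extensionality => r.
      by apply/eqP/negPn/negP => neq; apply: nomv; exists r.
    right=> z Xz zT.
    have n0 : ~~ inX T (p0 r0).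
      apply: contraNN mv => /origin[] ->; rewrite ?h1 ?h2 ?p3 ?q1x ?q2y ?q3o //.
      by rewrite (target_stays rep bT) bT.
    have lt0 : dist (p r0) T < i.
      case: (walk_lt (rep r0)) => [E|lt]; first by rewrite E eqxx in mv.
      apply: leq_trans lt _; rewrite leqNgt; apply: contraNN mv => lt.
      by rewrite st.
    have innerE r : ~~ inX T (p r) -> ~~ inX T (p0 r).
      by move=> nX; case: (inner_origin _ _ okp1 nX) => // E; rewrite E p3 Xo in nX.
    apply: inner_score_lt; first by exists r0; apply: inner.
    move=> r /innerE nr; case: (eqVneq (p r) (p0 r)) => [E|mvr].
      exists r0; split; first exact: inner.
      by rewrite E; apply: leq_trans lt0 (cminx r z nr Xz).
    exists r; split; first exact: inner.
    apply: (walk_closer cT (p0W r) (rep r)) => //; apply: leq_trans (cminx r z nr Xz).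
    by rewrite leqNgt; apply: contraNN mvr => lt; rewrite st.
  exact: (score_ident (R := inX T) (inner_score_equivariant cT) auts sg XsT XsVT maxT
    (stab s) (strict pos okp E3) (strict pos' okp' E3')).
- by move=> pos z [_ re _]; apply: (occupied_noalt p0_inj re (target_stays re bT)).
- move=> pos pos' s u _ _ auts sT sg [neq en]; split.
    by move=> E; apply: neq; apply: (@perm_inj _ s); rewrite E sT.
  have so := aut_opp cT T1 T2 auts sT; have conf_o : conf pos' o = conf pos o by rewrite -sg so.
  rewrite conf_o; case: en => [[no [->|[nX le]]]|[z0 nX]]; [left | left | right]; split=> //.
  + by left.
  + by right; split; [rewrite aut_inXE | rewrite -{1}sT aut_dist].
  by rewrite aut_inXE.
- move=> pos okp; have [[E1 E2 stat] re nu] := okp; exists q3, c.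
  have nXc := inner _ _ okp nc.
  split; first by rewrite eq_sym.
    split; first by apply: (notT _ _ okp); rewrite eq_sym.
    case: (eqVneq (pos q3) o) => [E3|/eqP n3]; [left | right; split; last exact: q3_out].
      by split; [move=> /o0; apply | left].
    exact/o0.
  split; first exact: (notT _ _ okp).
  case: (eqVneq (pos q3) o) => [E3|/eqP n3]; [left | right; split=> //; exact/o0].
  split; first by move=> /o0; apply.
  by right; split=> //; case: (walk_lt (re c)) => [->|/ltnW].
- move=> pos r okp [neq en]; split; first exact/eqP.
  have [[E1 E2 stat] re nu] := okp.
  case: en => [[no [E|[nX le]]]|[/(o0 _ re) z0 nX]].
  + left; apply: p0_inj; rewrite q3o.
    by case: (reachedX (r := r) re); rewrite E // => Eo; rewrite Eo eqxx in oT.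
  + case: (inner_origin _ _ okp nX) => [|nX0]; [by left | right; split=> //; right].
    have E3 : pos q3 = o by have [//|/eqP /(o0 _ re)] := eqVneq (pos q3) o.
    rewrite leqNgt; apply/negP => lt; move: le; rewrite stat // leqNgt lt //.
  by case: (inner_origin _ _ okp nX) => [|nX0]; [left | right; split=> //; left].
- move=> pos r d okp en st; have [[E1 E2 stat] re nu] := okp; left.
  have r12 : r <> q1 /\ r <> q2.
    case: en => [->|[nX _]].
      by split=> E; [move: xo | move: yo]; rewrite -?q1x -?q2y -E q3o eqxx.
    by split=> E; move: nX; rewrite E ?q1x ?q2y ?Xx ?Xy.
  split; [by rewrite upd_neq //; apply/eqP => E; case: r12; rewrite E
    | by rewrite upd_neq //; apply/eqP => E; case: r12; rewrite E |].
  rewrite {1}/upd; case: eqP => [E dO|n3 p3] z nX lt.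
    by case: st => _ _ noX _; rewrite dO in noX; have E' := noX Xo; rewrite E' eqxx in oT.
  rewrite upd_neq; first exact: stat.
  apply: contraTneq lt => ->; rewrite -leqNgt.
  by case: en => [E|[_ []]] //; case: n3.
move=> pos r r' d okp en [->|[nX en']] neq st; [by left | right; split=> //].
case: en' => [n3|le]; [left | by right].
rewrite /upd; case: eqP => // _ dO.
by case: st => _ _ noX _; rewrite dO in noX; have E' := noX Xo; rewrite E' eqxx in oT.
Qed.

End FourPlan.

(** * Sums over robots read off a snapshot *)

Section WeightedSum.
Variables (m n k : nat).
Local Notation V := (node m n).
Implicit Types (pos : 'I_k -> V) (w : V -> nat).

(** A snapshot caps multiplicities at two, so it gives the sum over robots as long as no node holds
    three of them. *)
Lemma conf_sum pos w : (forall v, #|[set r | pos r == v]| <= 2) ->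
  \sum_v conf pos v * w v = \sum_r w (pos r).
Proof.
move=> le2; rewrite [RHS](partition_big pos xpredT) //=; apply: eq_bigr => v _.
rewrite (eq_bigr (fun=> w v)); last by move=> r /eqP->.
rewrite sum_nat_const /conf (minn_idPr (le2 v)); congr (_ * _).
by apply: eq_card => r; rewrite !inE.
Qed.

Lemma count_le2 pos (P : pred 'I_k) v :
  (forall r r', P r -> P r' -> pos r = v -> pos r' = v -> r = r') ->
  (forall r r', ~~ P r -> ~~ P r' -> pos r = v -> pos r' = v -> r = r') ->
  #|[set r | pos r == v]| <= 2.
Proof.
move=> uP unP.
have le1 (Q : pred 'I_k) : (forall r r', Q r -> Q r' -> pos r = v -> pos r' = v -> r = r') ->
    #|[set r | (pos r == v) && Q r]| <= 1.
  move=> uQ; rewrite leqNgt; apply/negP => /card_gt1P[r [r' []]].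
  rewrite !inE => /andP[/eqP rv Qr] /andP[/eqP rv' Qr'].
  by rewrite (uQ r r' Qr Qr' rv rv') eqxx.
have -> : [set r | pos r == v] =
    [set r | (pos r == v) && P r] :|: [set r | (pos r == v) && ~~ P r].
  by apply/setP => r; rewrite !inE -andb_orr orbN andbT.
by apply: leq_trans (leq_card_setU _ _) _; apply: (@leq_add _ _ 1 1); apply: le1.
Qed.

End WeightedSum.

(** * Four occupied corners with a diagonal symmetry *)

Section SquareFourPlan.
Variables (m n k : nat).
Local Notation V := (node m n).
Variables (p0 : 'I_k -> V) (T : V).
Hypotheses (cT : centered T) (p0_inj : injective p0).
Hypothesis p0W : forall r, inW T (p0 r).
Hypotheses (T1 : T.1 + T.1 + 1 != m) (T2 : T.2 + T.2 + 1 != n).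
Implicit Types (pos : 'I_k -> V) (x y : V).

Lemma opp_sum u : inbox T u -> dist u T + dist u (opp T) = dist T (opp T).
Proof.
case/andP => b1 b2.
have := opposite_gap (ltn_ord T.1) b1 T1; have := opposite_gap (ltn_ord T.2) b2 T2.
have o1 : (opp T).1 = m - T.1.+1 :> nat by [].
have o2 : (opp T).2 = n - T.2.+1 :> nat by [].
rewrite !distE o1 o2 (gapC u.1 (m - _)) (gapC u.2 (n - _)).
rewrite (gapC T.1 (m - _)) (gapC T.2 (n - _)).
by move=> <- <-; clear; lia.
Qed.

(** Breaks ties of [inner_score] between [T] and [opp T]: a step towards [T] leads equally far from
    [opp T], the two distances having a constant sum on the box. *)
Definition total_closeness y (g : V -> nat) := \sum_v g v * closeness y v.

Lemma total_closeness_equivariant : equivariant total_closeness.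
Proof.
move=> s g g' y auts sg; rewrite /total_closeness (reindex_inj (@perm_inj _ s)) /=.
by apply: eq_bigr => v _; rewrite sg closeness_aut.
Qed.

(** A diagonal symmetry exchanges [x] and [y], which may have the best scores, so only [T] and
    [opp T] are compared. The robots on [x] and [y] leave first: once one of these corners is empty,
    a symmetry can only fix or exchange [T] and [opp T]. The robot on [opp T] leaves when both are
    empty, making [T] the only occupied corner. *)
Lemma gather_four_square (b q1 q2 q3 a : 'I_k) :
  p0 b = T -> p0 q1 = flip1 T -> p0 q2 = flip2 T -> p0 q3 = opp T ->
  ~~ inX T (p0 a) -> dist T (flip1 T) = dist T (flip2 T) ->
  inner_score T (opp T) (conf p0) < inner_score T T (conf p0) \/
  inner_score T (opp T) (conf p0) = inner_score T T (conf p0) /\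
    total_closeness (opp T) (conf p0) <= total_closeness T (conf p0) ->
  (forall s, is_aut s -> config_map s (conf p0) (conf p0) -> s T = T) ->
  gatherable p0.
Proof.
move=> bT q1x q2y q3o nXa sq maxT stab.
have nb : neighbours T (flip1 T) (flip2 T) by left.
have [xT xo xy yT yo] := neighbours_neq T1 T2 nb.
set x := flip1 T in nb q1x xT xo xy sq; set y := flip2 T in nb q2y xy yT yo sq.
have oT : opp T != T := opp_neq T1.
have [Xx Xy] := neighbours_inX nb; have Xo : inX T (opp T) := inX_opp T.
have sumo u : inW T u -> dist u T + dist u (opp T) = dist T (opp T).
  by case/andP => bu _; apply: opp_sum.
have dTo : dist T (opp T) = dist T x + dist T x.
  by have [_ _ -> _] := neighbours_dist T1 T2 nb; rewrite -sq.
set o := opp T in q3o xo yo oT Xo sumo dTo maxT.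
have [c nc cmin] := arg_minnP (P := fun r => ~~ inX T (p0 r)) (fun r => dist (p0 r) T) nXa.
have cmino r : ~~ inX T (p0 r) -> dist (p0 c) T <= dist (p0 r) o.
  have le : inner_score T o (conf p0) <= inner_score T T (conf p0).
    by case: maxT => [/ltnW|[->]].
  move=> nX; have [r' nr' le'] := inner_min le nX.
  exact: leq_trans (cmin _ nr') le'.
set i := dist (p0 c) T in cmin cmino.
have bq3 : b != q3 by apply: contraNneq oT => E; rewrite -q3o -E bT.
have bq1 : b != q1 by apply: contraNneq xT => E; rewrite -q1x -E bT.
have q12 : q1 != q2 by apply: contraNneq xy => E; rewrite -q1x E q2y.
have q13 : q1 != q3 by apply: contraNneq xo => E; rewrite -q1x E q3o.
have q23 : q2 != q3 by apply: contraNneq yo => E; rewrite -q2y E q3o.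
pose gone pos := pos q1 <> x \/ pos q2 <> y.
pose P1 pos := [/\ pos q3 = o, (pos q1 = x -> pos q2 = y -> forall r, pos r = p0 r) &
  forall r, ~~ inX T (p0 r) -> i < dist (p0 r) T -> pos r = p0 r].
pose ok pos := [/\ P1 pos, reached p0 T pos & ~ unambiguous T (conf pos) T].
pose En (g : V -> nat) u := u <> T /\ [\/ u = x \/ u = y,
  [/\ ~~ inX T u, dist u T <= i & g x = 0 \/ g y = 0] | [/\ u = o, g x = 0 & g y = 0]].
pose EnH (pos : 'I_k -> V) r := [\/ (r = q1 /\ pos r = x) \/ (r = q2 /\ pos r = y),
  [/\ ~~ inX T (pos r), dist (pos r) T <= i & gone pos] |
  [/\ r = q3, pos q1 <> x & pos q2 <> y]].
have notT pos r : ok pos -> r != b -> pos r <> T.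
  move=> [_ re nu] rb rT; apply: nu.
  by apply: (unambiguous_double p0_inj re rb rT); apply: target_stays re bT.
have who pos z r q : reached p0 T pos -> p0 q = z -> z != T -> inX T z -> pos r = z -> r = q.
  move=> re qz zT Xz rz; apply: p0_inj; rewrite qz.
  by case: (reachedX (r := r) re); rewrite rz // => E; rewrite E eqxx in zT.
have emptyE pos z q : reached p0 T pos -> p0 q = z -> z != T -> inX T z ->
    (conf pos z = 0) <-> (pos q <> z).
  move=> re qz zT Xz; split=> [z0 E|ne]; first by have := conf_at pos q; rewrite E z0.
  apply/eqP/negPn/negP => /conf_gt0[r rz]; apply: ne.
  by rewrite -(who _ _ _ _ re qz zT Xz rz).
have origin r : inX T (p0 r) -> [\/ r = b, r = q1, r = q2 | r = q3].
  move=> X; case: (neighbours_cover nb X) => E.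
  - by apply: Or41; apply: p0_inj; rewrite bT.
  - by apply: Or42; apply: p0_inj; rewrite q1x.
  - by apply: Or43; apply: p0_inj; rewrite q2y.
  by apply: Or44; apply: p0_inj; rewrite q3o.
have inner pos r : ok pos -> r != b -> pos r <> p0 r -> ~~ inX T (pos r).
  move=> okp rb mv; have [_ re _] := okp; apply/negP => X.
  by case: (reachedX re X) => // /(notT _ _ okp rb).
have innerc pos : ok pos -> ~~ inX T (pos c) /\ dist (pos c) T <= i.
  move=> okp; have [_ re _] := okp; split; last by case: (walk_lt (re c)) => [->|/ltnW].
  have [->//|/eqP mv] := eqVneq (pos c) (p0 c); apply: inner => //.
  by apply: contraNneq nc => ->; rewrite bT inX_T.
(* After the first departure [T] beats [o] lexicographically. Either a robot off the corners has
   come inside the radius [i], or only [q1] and [q2] have moved, and a tie of the first score is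
   broken by the total, which has shifted towards [T]. *)
have strict pos : ok pos -> gone pos ->
    inner_score T o (conf pos) < inner_score T T (conf pos) \/
    inner_score T o (conf pos) = inner_score T T (conf pos) /\
    total_closeness o (conf pos) < total_closeness T (conf pos).
  move=> okp go; have [[p3 _ stat] re nu] := okp.
  have Wp r : inW T (pos r) := reached_inW cT p0W r re.
  have [nXc dc] := innerc _ okp.
  have leT r : dist (pos r) T <= dist (p0 r) T by case: (walk_lt (re r)) => [->|/ltnW].
  (* In a square [x] and [y] are equidistant from [T] and [o], so a robot that has left them is
     strictly nearer to [T]. *)
  have q_far r : r = q1 \/ r = q2 -> pos r <> p0 r -> dist (pos r) T < dist (pos r) o.
    move=> q mv; have := sumo _ (Wp r); rewrite dTo.
    have : dist (p0 r) T = dist T x by case: q => ->; rewrite ?q1x ?q2y distC.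
    by case: (walk_lt (re r)) => [/mv//|]; clear; lia.
  have class r : ~~ inX T (pos r) -> ~~ inX T (p0 r) \/ ((r = q1 \/ r = q2) /\ pos r <> p0 r).
    move=> nX; case: (boolP (inX T (p0 r))) => [X|]; [right | by left].
    have mv : pos r <> p0 r by move=> E; rewrite E X in nX.
    case: (origin r X) => E; split=> //; [|by left|by right|].
      by case: mv; rewrite E (target_stays re bT) bT.
    by case: mv; rewrite E p3 q3o.
  have far r : ~~ inX T (p0 r) -> i <= dist (pos r) o.
    move=> nX; have := cmino r nX; have := leT r.
    by have := sumo _ (p0W r); have := sumo _ (Wp r); clear; lia.
  case: (excluded_middle_informative (exists r, ~~ inX T (pos r) /\ dist (pos r) T < i)).
    move=> [r0 [nX0 lt0]]; left; apply: inner_score_lt; first by exists c.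
    move=> r nX; case: (class r nX) => [nX'|[q mv]]; last by exists r; split=> //; apply: q_far.
    by exists r0; split=> //; apply: leq_trans lt0 (far r nX').
  move=> nolt.
  have ge r : ~~ inX T (pos r) -> i <= dist (pos r) T.
    by move=> nX; rewrite leqNgt; apply/negP => lt; apply: nolt; exists r.
  have unmoved r : r != q1 -> r != q2 -> pos r = p0 r.
    move=> r1 r2; have [//|/eqP mv] := eqVneq (pos r) (p0 r).
    case: (boolP (inX T (p0 r))) => [X|nX].
      case: (origin r X) => E; rewrite E ?(target_stays re bT) ?p3 ?bT ?q3o //.
        by rewrite E eqxx in r1.
      by rewrite E eqxx in r2.
    have rb : r != b by apply: contraNneq nX => ->; rewrite bT inX_T.
    have := ge r (inner _ _ okp rb mv).
    case: (walk_lt (re r)) => // lt.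
    have : dist (p0 r) T <= i by rewrite leqNgt; apply/negP => /(stat r nX).
    by move: lt; clear; lia.
  have ec : dist (pos c) T = i by apply/eqP; rewrite eqn_leq dc ge.
  have far_all r : ~~ inX T (pos r) -> i <= dist (pos r) o.
    move=> nX; case: (class r nX) => [/far//|[q mv]].
    by apply: leq_trans (ge r nX) (ltnW (q_far r q mv)).
  have le_score : inner_score T o (conf pos) <= inner_score T T (conf pos).
    apply/bigmax_leqP => v /andP[/conf_gt0[r <-] nX].
    apply: leq_trans (inner_score_ge _ nXc); rewrite closeness_le ec; exact: far_all.
  case: (ltngtP (inner_score T o (conf pos)) (inner_score T T (conf pos))) le_score => // [lt|E] _.
    by left.
  right; split=> //.
  (* Under a tie some robot off the corners is within [i] of [o]; it has not moved, so the scores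
     were tied initially and the hypothesis compares the totals. *)
  have [r1 nr1 dr1] : exists2 r, ~~ inX T (pos r) & dist (pos r) o <= i.
    by rewrite -ec; apply: (inner_min _ nXc); rewrite E.
  have nr1' : ~~ inX T (p0 r1) /\ dist (p0 r1) o <= i.
    case: (class r1 nr1) => [nX|[q mv]].
      split=> //; suff <- : pos r1 = p0 r1 by [].
      apply: unmoved; apply: contraNneq nX => ->; by rewrite ?q1x ?q2y.
    by have := q_far r1 q mv; have := ge r1 nr1; move: dr1; clear; lia.
  have le0 : inner_score T T (conf p0) <= inner_score T o (conf p0).
    apply/bigmax_leqP => v /andP[/conf_gt0[r <-] nX].
    apply: leq_trans (inner_score_ge _ nr1'.1); rewrite closeness_le.
    exact: leq_trans nr1'.2 (cmin r nX).
  have {maxT} W0 : total_closeness o (conf p0) <= total_closeness T (conf p0).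
    by case: maxT => [|[]//]; rewrite ltnNge le0.
  (* [q1] and [q2] walk on sides that meet only in [T], and the other robots are still on their
     distinct initial nodes. *)
  have cnt v : #|[set r | pos r == v]| <= 2.
    apply: (@count_le2 _ _ _ _ (fun r => (r == q1) || (r == q2))).
      have no12 : pos q1 <> pos q2.
        move=> E12.
        have Wx : inW T x by rewrite -q1x.
        have Wy : inW T y by rewrite -q2y.
        have wk1 : walk T x (pos q1) by have := re q1; rewrite q1x.
        have wk2 : walk T y (pos q2) by have := re q2; rewrite q2y.
        have s1 := side_walk cT T1 T2 nb Wx wk1.
        have s2 := side_walk cT T1 T2 (neighboursC nb) Wy wk2.
        have [_ e2 _ _] := neighbours_dist T1 T2 nb.
        have := dist_tri x (pos q1) y; rewrite e2 dTo.
        move: s1 s2; rewrite /side -E12 -sq (distC x) => /eqP s1 /eqP s2.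
        have := sumo _ (Wp q1); rewrite dTo; have := dist_tri (pos q1) x T.
        have : dist (pos q1) T <> 0.
          by move/dist_eq0; apply: notT okp _; rewrite eq_sym.
        by move: s1 s2; clear; lia.
      move=> r r' /orP[] /eqP-> /orP[] /eqP-> // h h'; case: no12; congruence.
    move=> r r'; rewrite !negb_or => /andP[h1 h2] /andP[h3 h4] e e'; apply: p0_inj.
    by rewrite -!unmoved // e e'.
  have cnt0 v : #|[set r | p0 r == v]| <= 2.
    apply: (@count_le2 _ _ _ _ xpredT) => // r r' _ _ e e'; apply: p0_inj; congruence.
  rewrite /total_closeness !conf_sum //.
  have W0' : \sum_r closeness o (p0 r) <= \sum_r closeness T (p0 r).
    by move: W0; rewrite /total_closeness !conf_sum.
  apply: leq_ltn_trans (leq_trans _ W0') _.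
    apply: leq_sum => r _; rewrite closeness_le; have := leT r.
    by have := sumo _ (p0W r); have := sumo _ (Wp r); clear; lia.
  have [r0 mv] : exists r, pos r <> p0 r.
    by case: go => ne; [exists q1; rewrite q1x | exists q2; rewrite q2y].
  rewrite (bigD1 r0) //= [X in _ < X](bigD1 r0) //= -addSn; apply: leq_add.
    by rewrite closeness_lt; case: (walk_lt (re r0)).
  by apply: leq_sum => r _; rewrite closeness_le.
have occT pos : ok pos -> conf pos T != 0.
  by move=> [_ re _]; apply/conf_gt0; exists b; apply: target_stays re bT.
have occo pos : ok pos -> conf pos o != 0.
  by move=> [[p3 _ _] _ _]; apply/conf_gt0; exists q3.
have e1 pos : ok pos -> conf pos x = 0 <-> pos q1 <> x.
  by move=> [_ re _]; apply: emptyE.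
have e2 pos : ok pos -> conf pos y = 0 <-> pos q2 <> y.
  by move=> [_ re _]; apply: emptyE.
have upd_ne pos r d q z : step T (pos r) d -> inX T z -> z != T -> pos q <> z -> upd pos r d q <> z.
  move=> st Xz zT ne; rewrite /upd; case: eqP => // _ dz.
  by case: st => _ _ noX _; rewrite dz in noX; have E := noX Xz; rewrite E eqxx in zT.
apply: (@gather_plan m n k p0 T cT p0_inj p0W P1 EnH En).
- by left; split.
- move=> pos pos' s okp okp' auts sg.
  have XsT : inX T (s T) by rewrite aut_inXE ?inX_T.
  case: (excluded_middle_informative (gone pos)) => go; last first.
    have [p1 p2] : pos q1 = x /\ pos q2 = y.
      by split; apply/eqP/negPn/negP => /eqP ne; apply: go; [left | right].
    have occ z : inX T z -> conf pos' z != 0.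
      move=> Xz; rewrite -(permKV s z) sg.
      have Xz' : inX T ((s^-1)%g z) by rewrite aut_inXE //; apply: is_autV.
      case: (neighbours_cover nb Xz') => ->; rewrite ?occT ?occo //; apply/conf_gt0;
        by [exists q1 | exists q2].
    have [p1' p2'] : pos' q1 = x /\ pos' q2 = y.
      split; apply/eqP/negPn/negP => /eqP ne.
        by have := occ x Xx; rewrite (proj2 (e1 _ okp') ne).
      by have := occ y Xy; rewrite (proj2 (e2 _ okp') ne).
    apply: stab => //.
    have E : pos = p0 by apply: functional_extensionality => r; case: okp => [[_ st _] _ _]; apply: st.
    have E' : pos' = p0 by apply: functional_extensionality => r; case: okp' => [[_ st _] _ _]; apply: st.
    by rewrite -{1}E -E'.
  have [z [z' [nbz z0]]] : exists z z', neighbours T z z' /\ conf pos z = 0.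
    case: go => ne; [exists x, y | exists y, x]; split=> //; [exact/e1 | exact: neighboursC | exact/e2].
  have [w [w' [nbw [Ew w0]]]] : exists w w', neighbours T w w' /\ s z = w /\ conf pos' w = 0.
    have [Xz _] := neighbours_inX nbz.
    have Xsz : inX T (s z) by rewrite aut_inXE.
    have sz0 : conf pos' (s z) = 0 by rewrite sg.
    case: (neighbours_cover nb Xsz) => E.
    + by have := occT _ okp'; rewrite -E sz0.
    + by exists x, y; split=> //; rewrite -{2}E.
    + by exists y, x; split; [exact: neighboursC | rewrite -{2}E].
    by have := occo _ okp'; rewrite /o -E sz0.
  have go' : gone pos'.
    case: nbw => -[E _]; [left; apply/e1 | right; apply/e2] => //; by rewrite /x /y -E.
  have [zT zo zz' z'T z'o] := neighbours_neq T1 T2 nbz.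
  have Ew' : s z' = w'.
    have [Xz Xz'] := neighbours_inX nbz.
    apply: (opposite_neighbour T1 T2 nbw); first by rewrite aut_inXE.
    rewrite -Ew aut_dist // distC; by have [_ -> _ _] := neighbours_dist T1 T2 nbz.
  case: (neighbours_cover nbw XsT) => // E; exfalso.
  + by move: zT; rewrite -(aut_neq s) Ew E eqxx.
  + by move: z'T; rewrite -(aut_neq s) Ew' E eqxx.
  have so : s o = T.
    apply: (opposite_opp T1 T2); first by rewrite aut_inXE.
    by rewrite -{1}E aut_dist // distC.
  have h1 := inner_score_equivariant cT T auts sg; have h2 := inner_score_equivariant cT o auts sg.
  have h3 := total_closeness_equivariant T auts sg; have h4 := total_closeness_equivariant o auts sg.
  rewrite E in h1 h3; rewrite so in h2 h4.
  move: (strict _ okp go) (strict _ okp' go'); rewrite h1 h2 h3 h4; clear; lia.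
- by move=> pos z [_ re _]; apply: (occupied_noalt p0_inj re (target_stays re bT)).
- move=> pos pos' s u _ _ auts sT sg [neq en]; split.
    by move=> E; apply: neq; apply: (@perm_inj _ s); rewrite E sT.
  have so := aut_opp cT T1 T2 auts sT.
  have swap := aut_neighbours cT T1 T2 auts sT nb.
  have gx := sg x; have gy := sg y.
  case: en => [xy'|[nX le z0]|[-> x0 y0]].
  + by apply: Or31; case: xy' => ->; case: swap => -[h1 h2]; rewrite ?h1 ?h2; by [left | right].
  + apply: Or32; split; [by rewrite aut_inXE | by rewrite -{1}sT aut_dist |].
    by rewrite -gx -gy in z0; case: swap z0 => -[-> ->] [->|->]; by [left | right].
  by apply: Or33; rewrite so -gx -gy in x0 y0 *; case: swap x0 y0 => -[-> ->].
- move=> pos okp; have [[p3 _ _] re nu] := okp; have [nXc dc] := innerc _ okp.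
  have enc : gone pos -> En (conf pos) (pos c).
    move=> go; split; first by move=> E; rewrite E inX_T in nXc.
    by apply: Or32; split=> //; case: go => ne; [left; apply/e1 | right; apply/e2].
  have cq q z : p0 q = z -> inX T z -> c != q.
    by move=> qz Xz; apply: contraNneq nc => ->; rewrite qz.
  have c1 := cq q1 x q1x Xx; have c2 := cq q2 y q2y Xy; have c3 := cq q3 o q3o Xo.
  case: (eqVneq (pos q1) x) => [E1|/eqP n1]; case: (eqVneq (pos q2) y) => [E2|/eqP n2].
  + exists q1, q2; split=> //; (split; first by rewrite ?E1 ?E2; apply/eqP);
      by apply: Or31; rewrite ?E1 ?E2; by [left | right].
  + exists q1, c; split; [by rewrite eq_sym| |by apply: enc; right].
    by split; [rewrite E1; apply/eqP | apply: Or31; left].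
  + exists q2, c; split; [by rewrite eq_sym| |by apply: enc; left].
    by split; [rewrite E2; apply/eqP | apply: Or31; right].
  exists q3, c; split; [by rewrite eq_sym| |by apply: enc; left].
  split; first by rewrite p3; apply/eqP.
  by apply: Or33; split=> //; [apply/e1 | apply/e2].
- move=> pos r okp [neq en]; split; first exact/eqP.
  have [_ re _] := okp; case: en => [[E|E]|[nX le z0]|[E x0 y0]].
  + by apply: Or31; left; split=> //; apply: who re q1x xT Xx E.
  + by apply: Or31; right; split=> //; apply: who re q2y yT Xy E.
  + by apply: Or32; split=> //; case: z0 => [/e1|/e2] ne; [left | right]; apply: ne.
  by apply: Or33; split; [apply: who re q3o oT Xo E | apply/e1 | apply/e2].
- move=> pos r d okp en st; have [[p3 stay stat] re nu] := okp.
  have [r3|r3] := eqVneq r q3.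
    right; case: en => [[[E _]|[E _]]|[nX _ _]|[_ n1 n2]].
    + by rewrite -r3 E eqxx in q13.
    + by rewrite -r3 E eqxx in q23.
    + by rewrite r3 p3 Xo in nX.
    apply: (@unambiguous_single _ _ _ _ _ b).
      by rewrite upd_neq ?(target_stays re bT) // r3.
    move=> q; rewrite /upd; case: eqP => [_ X|qr X]; first by case: st => _ _ /(_ X).
    case: (reachedX re X) => // E; move: X; rewrite E => X.
    case: (origin q X) => Eq; [by rewrite Eq bT| | |by case: qr; rewrite Eq r3].
      by case: n1; rewrite -Eq E Eq q1x.
    by case: n2; rewrite -Eq E Eq q2y.
  left; split; first by rewrite upd_neq // eq_sym.
    have go : gone (upd pos r d).
      case: en => [[[Er E]|[Er E]]|[_ _ [ne|ne]]|[E _ _]].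
      + left; rewrite Er upd_eq => dx; case: st => _ lt _ _.
        by move: lt; rewrite E dx ltnn.
      + right; rewrite Er upd_eq => dx; case: st => _ lt _ _.
        by move: lt; rewrite E dx ltnn.
      + by left; apply: upd_ne st Xx xT ne.
      + by right; apply: upd_ne st Xy yT ne.
      by rewrite E eqxx in r3.
    by case: go => ne E1 E2; case: ne.
  move=> q nX lt; rewrite upd_neq; first exact: stat.
  apply: contraTneq lt => Eq; rewrite -leqNgt Eq; move: nX; rewrite Eq => nX.
  case: en => [[[Er _]|[Er _]]|[_ le _]|[Er _ _]].
  + by rewrite Er q1x Xx in nX.
  + by rewrite Er q2y Xy in nX.
  + by rewrite leqNgt; apply/negP => lt; move: le; rewrite stat // leqNgt lt.
  by rewrite Er eqxx in r3.
move=> pos r r' d okp en en' neq st.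
have p1 := upd_ne pos r d q1 x st Xx xT; have p2 := upd_ne pos r d q2 y st Xy yT.
rewrite /EnH [upd pos r d r']upd_neq //.
case: en' => [E|[nX le go]|[E n1 n2]]; [exact: Or31|apply: Or32|apply: Or33].
  by split=> //; case: go => ne; [left; apply: p1 | right; apply: p2].
by split=> //; [apply: p1 | apply: p2].
Qed.

End SquareFourPlan.

(** * No occupied corner, with a diagonal symmetry *)

Section SidesPlan.
Variables (m n k : nat).
Local Notation V := (node m n).
Variables (p0 : 'I_k -> V) (T : V).
Hypotheses (cT : centered T) (p0_inj : injective p0).
Hypothesis p0W : forall r, inW T (p0 r).
Hypotheses (T1 : T.1 + T.1 + 1 != m) (T2 : T.2 + T.2 + 1 != n).
Implicit Types (pos : 'I_k -> V) (u v w x y : V).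

Definition on_side u v w := side u v w && ~~ inX T w.
Definition side_count u v (g : V -> nat) := \sum_w g w * on_side u v w.
Definition side_moment u v (g : V -> nat) := \sum_w g w * (on_side u v w * dist w u).

Lemma on_side_aut s u v w : is_aut s -> on_side (s u) (s v) (s w) = on_side u v w.
Proof. by move=> auts; rewrite /on_side side_aut // aut_inXE. Qed.

Lemma side_count_aut s g g' u v : is_aut s -> config_map s g g' ->
  side_count (s u) (s v) g' = side_count u v g.
Proof.
move=> auts sg; rewrite /side_count (reindex_inj (@perm_inj _ s)) /=.
by apply: eq_bigr => w _; rewrite sg on_side_aut.
Qed.

Lemma side_moment_aut s g g' u v : is_aut s -> config_map s g g' ->
  side_moment (s u) (s v) g' = side_moment u v g.
Proof.
move=> auts sg; rewrite /side_moment (reindex_inj (@perm_inj _ s)) /=.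
by apply: eq_bigr => w _; rewrite sg on_side_aut // aut_dist.
Qed.

Lemma on_sideC u v w : on_side u v w = on_side v u w.
Proof. by rewrite /on_side /side addnC (distC u v). Qed.

Lemma side_countC u v g : side_count u v g = side_count v u g.
Proof. by apply: eq_bigr => w _; rewrite on_sideC. Qed.

(** On a side the distances to the two ends add up to its length; this evaluates a moment after an
    automorphism has reversed the side. *)
Lemma side_momentC u v g :
  side_moment u v g + side_moment v u g = dist u v * side_count u v g.
Proof.
rewrite /side_moment /side_count -big_split big_distrr /=; apply: eq_bigr => w _.
rewrite (on_sideC v u) -mulnDr -mulnDr [RHS]mulnCA mulnC [RHS]mulnC; congr (_ * _).
case E: (on_side u v w); last by rewrite muln0.
rewrite mul1n muln1.
by apply/eqP; case/andP: E.
Qed.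

(* Only the robots nearest to [T] on the two sides ending at [T] move, along these sides:
   the side counts stay constant and the moment at [T] decreases, which tells [T] from
   [opp T]. *)
Lemma gather_sides delta a :
  (forall r, ~~ inX T (p0 r)) ->
  is_aut delta -> config_map delta (conf p0) (conf p0) ->
  delta T = T -> delta (flip1 T) = flip2 T -> delta (flip2 T) = flip1 T ->
  side T (flip1 T) (p0 a) || side T (flip2 T) (p0 a) ->
  side_count T (flip1 T) (conf p0) <> side_count (opp T) (flip1 T) (conf p0) \/
    side_moment T (flip1 T) (conf p0) <= side_moment (opp T) (flip1 T) (conf p0) ->
  (forall s, is_aut s -> config_map s (conf p0) (conf p0) -> s T = T) ->
  gatherable p0.
Proof.
move=> noX autd dp0 dT d1 d2 onT choice stab.
have nb : neighbours T (flip1 T) (flip2 T) by left.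
have [xT xo xy yT yo] := neighbours_neq T1 T2 nb.
set x := flip1 T in nb xT xo xy d1 d2 onT choice.
set y := flip2 T in nb xy yT yo d1 d2 onT.
have nb' := neighboursC nb.
have [Xx Xy] := neighbours_inX nb; have Xo := inX_opp T.
have do_ : delta (opp T) = opp T := aut_opp cT T1 T2 autd dT.
have [e1 e2 e3 e4] := neighbours_dist T1 T2 nb.
have sq : dist T y = dist T x by rewrite -(aut_dist T x autd) dT d1.
set o := opp T in xo yo choice Xo do_ e1 e2 e3.
set L := dist T x in e1 e3 e4 sq.
have Lyo : dist y o = L := e1.
have Lxo : dist x o = L by have [-> _ _ _] := neighbours_dist T1 T2 nb'.
pose onTs w := side T x w || side T y w.
have [c onc cmin] := arg_minnP (P := fun r => onTs (p0 r)) (fun r => dist (p0 r) T) onT.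
set i := dist (p0 c) T in cmin.
have [c' c'E] : exists c', p0 c' = delta (p0 c).
  by apply/conf_gt0; rewrite dp0 conf_at.
have dc' : dist (p0 c') T = i by rewrite c'E -{1}dT aut_dist.
(* The symmetry [delta] turns a nearest robot on one side into a nearest one on the other: these are
   the two enabled robots. *)
have [a1 [a2 [s1 s2 i1 i2]]] : exists a1 a2, [/\ side T x (p0 a1), side T y (p0 a2),
    dist (p0 a1) T = i & dist (p0 a2) T = i].
  case/orP: onc => sd; [exists c, c' | exists c', c]; split=> //; rewrite c'E.
    by rewrite -dT -d1 side_aut.
  by rewrite -dT -d2 side_aut.
pose P1 pos := forall r, r != a1 -> r != a2 -> pos r = p0 r.
pose ok pos := [/\ P1 pos, reached p0 T pos & ~ unambiguous T (conf pos) T].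
pose EnH (pos : 'I_k -> V) r := r = a1 \/ r = a2.
pose En (g : V -> nat) u := [/\ u <> T, onTs u & dist u T <= i].
have noXpos pos r : ok pos -> ~~ inX T (pos r).
  move=> [_ re nu]; apply/negP => X; apply: nu; right; split.
    by case: (reachedX re X) => E; [rewrite -E conf_at | have := noX r; rewrite -E X].
  move=> z Xz zT; apply/eqP/negPn/negP => /conf_gt0[q qz].
  case: (reachedX (r := q) re); rewrite qz // => E; first by rewrite E eqxx in zT.
  by have := noX q; rewrite -E Xz.
have Wp pos r : ok pos -> inW T (pos r) by move=> [_ re _]; exact: (reached_inW cT p0W r re).
have sd1 pos : ok pos -> side T x (pos a1).
  by move=> [_ re _]; apply: (side_target_walk cT T1 T2 nb (p0W a1) (re a1)).
have sd2 pos : ok pos -> side T y (pos a2).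
  by move=> [_ re _]; apply: (side_target_walk cT T1 T2 nb' (p0W a2) (re a2)).
have dle pos r : ok pos -> dist (pos r) T <= dist (p0 r) T.
  by move=> [_ re _]; case: (walk_lt (re r)) => [->|/ltnW].
have disj1 pos r := fun okp => side_disjoint T1 T2 nb (Wp pos r okp) (noXpos pos r okp).
have disj2 pos r := fun okp => side_disjoint T1 T2 nb' (Wp pos r okp) (noXpos pos r okp).
have a12 : a1 != a2.
  apply/eqP => E; have [h _ _] := side_disjoint T1 T2 nb (p0W a1) (noX a1) s1.
  by rewrite E s2 in h.
have who1 r : side T x (p0 r) -> dist (p0 r) T <= i -> r = a1.
  move=> sr le; apply: p0_inj; apply: (side_target_inj T1 T2 nb) => //.
  by apply/eqP; rewrite i1 eqn_leq le cmin // /onTs sr.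
have who2 r : side T y (p0 r) -> dist (p0 r) T <= i -> r = a2.
  move=> sr le; apply: p0_inj; apply: (side_target_inj T1 T2 nb') => //.
  by apply/eqP; rewrite i2 eqn_leq le cmin // /onTs sr orbT.
(* Nothing stands between [a1] or [a2] and [T] on their disjoint sides, so robots never meet before
   reaching [T], and the snapshot counts them exactly. *)
have inj pos : ok pos -> injective pos.
  move=> okp; have [P _ _] := okp.
  have neq1 r : r != a1 -> pos r <> pos a1.
    move=> r1 E; have sr := sd1 _ okp; rewrite -E in sr.
    have [r2|r2] := eqVneq r a2.
      by have [h _ _] := disj1 _ _ okp sr; rewrite r2 sd2 in h.
    move: sr E; rewrite P // => sr E; case/eqP: r1; apply: who1 => //.
    by rewrite E -i1 dle.
  have neq2 r : r != a2 -> pos r <> pos a2.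
    move=> r2 E; have sr := sd2 _ okp; rewrite -E in sr.
    have [r1|r1] := eqVneq r a1.
      by have [h _ _] := disj2 _ _ okp sr; rewrite r1 sd1 in h.
    move: sr E; rewrite P // => sr E; case/eqP: r2; apply: who2 => //.
    by rewrite E -i2 dle.
  move=> r r' E; have [r1|r1] := eqVneq r a1.
    by have [->//|/neq1] := eqVneq r' a1; rewrite -E r1.
  have [r2|r2] := eqVneq r a2.
    by have [->//|/neq2] := eqVneq r' a2; rewrite -E r2.
  have [r1'|r1'] := eqVneq r' a1; first by case: (neq1 r r1); rewrite E r1'.
  have [r2'|r2'] := eqVneq r' a2; first by case: (neq2 r r2); rewrite E r2'.
  by apply: p0_inj; rewrite -!P.
have sum pos (f : V -> nat) : injective pos -> \sum_v conf pos v * f v = \sum_r f (pos r).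
  move=> ip; apply: conf_sum => v; apply: (@count_le2 _ _ _ _ xpredT) => // r r' _ _ e e'.
  by apply: ip; rewrite e e'.
have on1 pos r : ok pos -> side T x (pos r) ->
    [/\ on_side T x (pos r), on_side T y (pos r) = false,
        on_side o x (pos r) = false & on_side o y (pos r) = false].
  move=> okp sr; have [h1 h2 h3] := disj1 _ _ okp sr.
  by rewrite /on_side sr noXpos // (negPf h1) (negPf h2) (negPf h3).
have on2 pos r : ok pos -> side T y (pos r) ->
    [/\ on_side T y (pos r), on_side T x (pos r) = false,
        on_side o x (pos r) = false & on_side o y (pos r) = false].
  move=> okp sr; have [h1 h2 h3] := disj2 _ _ okp sr.
  by rewrite /on_side sr noXpos // (negPf h1) (negPf h2) (negPf h3).
have okp0 : ok p0.
  split=> //; first by move=> r; apply: walk0.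
  move=> U; have /conf_gt0[r rT] : conf p0 T != 0 by case: U => -[h _] //; rewrite h.
  by have := noX r; rewrite rT inX_T.
have onE pos r u v : ok pos -> (u = T \/ u = o) -> (v = x \/ v = y) ->
    on_side u v (pos r) = on_side u v (p0 r).
  move=> okp hu hv; have [P _ _] := okp.
  have [->|r1] := eqVneq r a1.
    have [h1 h2 h3 h4] := on1 _ _ okp (sd1 _ okp); have [h5 h6 h7 h8] := on1 _ _ okp0 s1.
    by case: hu => ->; case: hv => ->; rewrite ?h1 ?h2 ?h3 ?h4 ?h5 ?h6 ?h7 ?h8.
  have [->|r2] := eqVneq r a2; last by rewrite P.
  have [h1 h2 h3 h4] := on2 _ _ okp (sd2 _ okp); have [h5 h6 h7 h8] := on2 _ _ okp0 s2.
  by case: hu => ->; case: hv => ->; rewrite ?h1 ?h2 ?h3 ?h4 ?h5 ?h6 ?h7 ?h8.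
have NE pos u v : ok pos -> (u = T \/ u = o) -> (v = x \/ v = y) ->
    side_count u v (conf pos) = side_count u v (conf p0).
  move=> okp hu hv; rewrite /side_count (sum _ _ (inj _ okp)) (sum _ _ (inj _ okp0)).
  by apply: eq_bigr => r _; rewrite onE.
have MoE pos v : ok pos -> (v = x \/ v = y) ->
    side_moment o v (conf pos) = side_moment o v (conf p0).
  move=> okp hv; have [P _ _] := okp; rewrite /side_moment (sum _ _ (inj _ okp)) (sum _ _ (inj _ okp0)).
  apply: eq_bigr => r _; rewrite onE //; last by right.
  have [->|r1] := eqVneq r a1.
    by have [_ _ h7 h8] := on1 _ _ okp0 s1; case: hv => ->; rewrite ?h7 ?h8.
  have [->|r2] := eqVneq r a2; last by rewrite P.
  by have [_ _ h7 h8] := on2 _ _ okp0 s2; case: hv => ->; rewrite ?h7 ?h8.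
have MTle pos v : ok pos -> (v = x \/ v = y) ->
    side_moment T v (conf pos) <= side_moment T v (conf p0).
  move=> okp hv; rewrite /side_moment (sum _ _ (inj _ okp)) (sum _ _ (inj _ okp0)).
  apply: leq_sum => r _; rewrite onE //; last by left.
  by apply: leq_mul => //; apply: dle.
have unmoved pos : ok pos ->
    side_moment T x (conf pos) = side_moment T x (conf p0) ->
    side_moment T y (conf pos) = side_moment T y (conf p0) -> pos = p0.
  move=> okp; have [P re _] := okp.
  have strict v r : (v = x \/ v = y) -> on_side T v (p0 r) ->
      side_moment T v (conf pos) = side_moment T v (conf p0) -> pos r = p0 r.
    move=> hv onr; rewrite /side_moment (sum _ _ (inj _ okp)) (sum _ _ (inj _ okp0)) => E.
    case: (walk_lt (re r)) => // lt; exfalso; move/eqP: E; apply/negP; rewrite neq_ltn.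
    rewrite (bigD1 r) //= [X in _ < X](bigD1 r) //= -addSn; apply/orP; left.
    apply: leq_add; first by rewrite onE ?onr ?mul1n //; left.
    apply: leq_sum => r' _; rewrite onE //; last by left.
    by apply: leq_mul => //; apply: dle.
  have [h1 _ _ _] := on1 _ _ okp0 s1; have [h2 _ _ _] := on2 _ _ okp0 s2.
  move=> Ex Ey; apply: functional_extensionality => r.
  have [->|r1] := eqVneq r a1; first by apply: (strict x) => //; left.
  have [->|r2] := eqVneq r a2; first by apply: (strict y) => //; right.
  exact: P.
have Np : side_count T y (conf p0) = side_count T x (conf p0).
  by have := side_count_aut T x autd dp0; rewrite dT d1.
have Np2 : side_count o y (conf p0) = side_count o x (conf p0).
  by have := side_count_aut o x autd dp0; rewrite do_ d1.
have MS : side_moment T y (conf p0) = side_moment T x (conf p0).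
  by have := side_moment_aut T x autd dp0; rewrite dT d1.
have MR : side_moment o y (conf p0) = side_moment o x (conf p0).
  by have := side_moment_aut o x autd dp0; rewrite do_ d1.
set p := side_count T x (conf p0) in Np choice.
set p2 := side_count o x (conf p0) in Np2 choice.
set S := side_moment T x (conf p0) in MS choice.
set R := side_moment o x (conf p0) in MR choice.
have facts pos : ok pos -> let g := conf pos in
    [/\ [/\ side_count T x g = p, side_count T y g = p, side_count o x g = p2
           & side_count o y g = p2],
        [/\ side_moment T x g <= S, side_moment T y g <= S, side_moment o x g = R
           & side_moment o y g = R],
        [/\ side_moment x T g + side_moment T x g = L * p,
            side_moment y T g + side_moment T y g = L * p,
            side_moment x o g + R = L * p2 & side_moment y o g + R = L * p2]
      & side_moment T x g = S -> side_moment T y g = S -> pos = p0].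
  move=> okp g.
  have h1 : side_count T x g = p by apply: NE => //; left.
  have h2 : side_count T y g = p by rewrite -Np; apply: NE => //; [left | right].
  have h3 : side_count o x g = p2 by apply: NE => //; [right | left].
  have h4 : side_count o y g = p2 by rewrite -Np2; apply: NE => //; right.
  have h5 : side_moment o x g = R by apply: MoE => //; left.
  have h6 : side_moment o y g = R by rewrite -MR; apply: MoE => //; right.
  split=> //.
  - by split=> //; [apply: MTle => //; left | rewrite -MS; apply: MTle => //; right].
  - split.
    + by rewrite side_momentC side_countC h1 distC.
    + by rewrite side_momentC side_countC h2 distC sq.
    + by rewrite -{1}h5 side_momentC side_countC h3 Lxo.
    by rewrite -{1}h6 side_momentC side_countC h4 Lyo.
  by move=> E1 E2; apply: unmoved => //; rewrite MS.
apply: (@gather_plan m n k p0 T cT p0_inj p0W P1 EnH En).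
- by left.
- move=> pos pos' s okp okp' auts sg.
  have XsT : inX T (s T) by rewrite aut_inXE ?inX_T.
  suff both : s T <> T -> pos = p0 /\ pos' = p0.
    case: (eqVneq (s T) T) => // /eqP ne; have [E E'] := both ne.
    by apply: stab => //; rewrite -{1}E -E'.
  have [[n1 n2 n3 n4] [t_le l_le r_eq b_eq] [x1 x2 x3 x4] done1] := facts _ okp.
  have [[n1' n2' n3' n4'] [t_le' l_le' r_eq' b_eq'] [x1' x2' x3' x4'] done2] := facts _ okp'.
  move=> neT.
  have cnt u v := side_count_aut u v auts sg; have mom u v := side_moment_aut u v auts sg.
  have opp_case z z' : neighbours T z z' -> s T = z -> s o = z'.
    move=> nbz Ez; apply: (opposite_neighbour T1 T2 nbz); first by rewrite aut_inXE.
    by rewrite -Ez aut_dist // distC.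
  have Xs z : inX T z -> inX T (s z) by move=> Xz; rewrite aut_inXE.
  have sneq z z' : z != z' -> s z <> s z' by move=> ne; apply/eqP; rewrite aut_neq.
  have Tx : T != x by rewrite eq_sym.
  have Ty : T != y by rewrite eq_sym.
  have ox : o != x by rewrite eq_sym.
  have oy : o != y by rewrite eq_sym.
  have cases : [\/ [/\ s T = x, s o = y & (s x = T /\ s y = o) \/ (s x = o /\ s y = T)],
      [/\ s T = y, s o = x & (s x = T /\ s y = o) \/ (s x = o /\ s y = T)]
    | [/\ s T = o, s o = T & (s x = x /\ s y = y) \/ (s x = y /\ s y = x)]].
    have nTx := sneq _ _ Tx; have nTy := sneq _ _ Ty; have nox := sneq _ _ ox.
    have noy := sneq _ _ oy; have nxy := sneq _ _ xy.
    case: (neighbours_cover nb XsT) => ET //; [apply: Or31|apply: Or32|apply: Or33].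
    + have Eo := opp_case _ _ nb ET; split=> //.
      case: (neighbours_cover nb (Xs _ Xx)) => Ex; case: (neighbours_cover nb (Xs _ Xy)) => Ey;
        try congruence; by [left | right].
    + have Eo := opp_case _ _ nb' ET; split=> //.
      case: (neighbours_cover nb (Xs _ Xx)) => Ex; case: (neighbours_cover nb (Xs _ Xy)) => Ey;
        try congruence; by [left | right].
    have Eo : s o = T.
      apply: (opposite_opp T1 T2); first exact: Xs.
      by rewrite -{1}ET aut_dist // distC.
    split=> //.
    case: (neighbours_cover nb (Xs _ Xx)) => Ex; case: (neighbours_cover nb (Xs _ Xy)) => Ey;
      try congruence; by [left | right].
  have c1 := cnt T x; have c2 := cnt T y; have c3 := cnt o x; have c4 := cnt o y.
  have m1 := mom T x; have m2 := mom T y; have m3 := mom o x; have m4 := mom o y.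
  have ge : p = p2 -> S <= R by case: choice.
  suff [q1 q2 q3 q4] : [/\ side_moment T x (conf pos) = S, side_moment T y (conf pos) = S,
      side_moment T x (conf pos') = S & side_moment T y (conf pos') = S].
    by split; [apply: done1 | apply: done2].
  (* In every case the side counts give [p = p2], hence [S <= R], and a reversed side exchanges a
     moment [M] with [L * p - M]. The moments at [T] never exceed [S], which forces all of them to
     equal [S]: nothing has moved. *)
  case: cases => -[ET Eo [[Ex Ey]|[Ex Ey]]]; rewrite ET Ex Ey Eo in c1 c2 c3 c4 m1 m2 m3 m4;
    rewrite ?(side_countC x) ?(side_countC y) in c1 c2 c3 c4;
    (have pp : p = p2 by congruence); rewrite -pp in x3 x4 x3' x4';
    move: (ge pp) t_le l_le r_eq b_eq x1 x2 x3 x4 t_le' l_le' r_eq' b_eq' x1' x2' x3' x4' m1 m2 m3 m4;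
    clear; set Q := L * p; move: Q; move=> *; split; lia.
- move=> pos z okp Xz zT un; have [r rz] : exists r, pos r = z.
    by apply/conf_gt0; case: un => -[h _] //; rewrite h.
  by have := noXpos pos r okp; rewrite rz Xz.
- move=> pos pos' s u _ _ auts sT sg [neq onu le]; split; last by rewrite -{1}sT aut_dist.
    by move=> E; apply: neq; apply: (@perm_inj _ s); rewrite E sT.
  have sdE z z' : s z = z' -> side T z' (s u) = side T z u.
    by move=> <-; rewrite -{1}sT side_aut.
  move: onu; rewrite /onTs.
  by case: (aut_neighbours cT T1 T2 auts sT nb) => -[Ex Ey];
    rewrite (sdE _ _ Ex) (sdE _ _ Ey) 1?orbC.
- move=> pos okp; exists a1, a2; split=> //.
    split; [by move=> E; have := noXpos pos a1 okp; rewrite E inX_T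
      | by rewrite /onTs sd1 | by rewrite -i1; apply: dle].
  split; [by move=> E; have := noXpos pos a2 okp; rewrite E inX_T
    | by rewrite /onTs sd2 ?orbT | by rewrite -i2; apply: dle].
- move=> pos r okp [neq onr le]; split; first exact/eqP.
  have [P _ _] := okp.
  have [->|r1] := eqVneq r a1; first by left.
  have [->|r2] := eqVneq r a2; first by right.
  by rewrite P // in onr le; case/orP: onr => sr; [left; apply: who1 | right; apply: who2].
- move=> pos r d [P re nu] en st; left=> q q1 q2; rewrite upd_neq; first exact: P.
  by apply/eqP => E; case: en => E'; [move: q1 | move: q2]; rewrite E E' eqxx.
by [].
Qed.

End SidesPlan.

(** * Symmetries and the choice of the gathering node *)

Section Symmetries.
Variables (m n : nat).
Local Notation V := (node m n).
Implicit Types (u v x y T : V) (s : {perm V}) (f : V -> nat).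

Lemma partitive_involution (s : {perm V}) f v0 : is_aut s -> involutive s ->
  (forall v, s v <> v) -> config_map s f f -> partitive f.
Proof.
move=> auts inv nofix fs; exists s.
have s2 : (s ^+ 2 = 1)%g by apply/permP => v; rewrite expgS expg1 permM perm1 inv.
have s1 : (s != 1)%g by apply/eqP => E; apply: (nofix v0); rewrite E perm1.
have os : #[s]%g = 2.
  have := order_dvdn s 2; rewrite s2 eqxx => dv.
  have : #[s]%g <= 2 by apply: dvdn_leq.
  have : 1 < #[s]%g by rewrite order_gt1.
  lia.
rewrite os; split=> // v; apply/eqP; rewrite eqn_leq; apply/andP; split.
  by rewrite -os porbit.unlock leq_imset_card.
apply/card_gt1P; exists v, (s v); rewrite porbit_id (mem_porbit s 1); split=> //.
by rewrite eq_sym; apply/eqP.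
Qed.

Lemma is_autM s s' : is_aut s -> is_aut s' -> is_aut (s * s')%g.
Proof. by move=> h h' u v; rewrite !permM h' h. Qed.

Lemma config_mapM s s' f : config_map s f f -> config_map s' f f -> config_map (s * s')%g f f.
Proof. by move=> h h' v; rewrite permM h' h. Qed.

Lemma reflK N a i : i < N -> refl N a (refl N a i) = i.
Proof. by rewrite /refl; case: a; lia. Qed.

Lemma refl_negb N a i : i < N -> refl N a (refl N (~~ a) i) = refl N true i.
Proof. by rewrite /refl; case: a => /=; lia. Qed.

Lemma refl_neq N i : i < N -> ~~ odd N -> refl N true i <> i.
Proof. by rewrite /refl; lia. Qed.

(** The reflection in the main diagonal for [b = false], in the other one for [b = true]; two
    different booleans would give a quarter turn. *)
Definition transposing b s := forall v,
  (s v).1 = refl n b v.2 :> nat /\ (s v).2 = refl m b v.1 :> nat.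

(** Reversing an even dimension without transposing is an involution fixing no node, hence
    forbidden; a quarter turn of an even square is excluded through its square, the half-turn. *)
Lemma config_aut_cases s f v0 : is_aut s -> config_map s f f -> ~ partitive f ->
  (exists a b : bool, [/\ a -> odd m, b -> odd n &
    forall v, (s v).1 = refl m a v.1 :> nat /\ (s v).2 = refl n b v.2 :> nat])
  \/ m = n /\ (odd m /\ (exists a b, forall v,
        (s v).1 = refl n a v.2 :> nat /\ (s v).2 = refl m b v.1 :> nat)
      \/ exists b, transposing b s).
Proof.
move=> auts sf np.
case: (aut_classify auts) => [[a [b sE]]|[mn [a [b sE]]]].
  left; exists a, b.
  have inv : involutive s.
    move=> v; have [e1 e2] := sE (s v); have [e3 e4] := sE v; bound v.
    by apply: node_eq; rewrite ?e1 ?e2 ?e3 ?e4 reflK.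
  split=> //.
    case: a sE => // sE _; apply/negPn/negP => ev; apply: np.
    apply: (partitive_involution v0 auts inv) => // v E.
    by have [e _] := sE v; apply: (refl_neq (ltn_ord v.1) ev); rewrite -e E.
  case: b sE => // sE _; apply/negPn/negP => ev; apply: np.
  apply: (partitive_involution v0 auts inv) => // v E.
  by have [_ e] := sE v; apply: (refl_neq (ltn_ord v.2) ev); rewrite -e E.
right; split=> //.
case: (boolP (odd m)) => [od|ev]; first by left; split=> //; exists a, b.
right; case: (eqVneq a b) => [E|ab]; first by exists b; rewrite -E in sE *.
case: np; have aut2 := is_autM auts auts; have f2 := config_mapM sf sf.
have bE : b = ~~ a by case: (a) (b) ab => [] [].
have re : refl m = refl n by rewrite /refl mn.
have sE2 v : ((s * s)%g v).1 = refl m true v.1 :> nat.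
  rewrite permM; have [e1 _] := sE (s v); have [_ e2] := sE v; rewrite e1 e2 bE.
  by rewrite -re refl_negb.
have sE3 v : ((s * s)%g v).2 = refl n true v.2 :> nat.
  rewrite permM; have [_ e1] := sE (s v); have [e2 _] := sE v; rewrite e1 e2 bE.
  by rewrite re -{2}(negbK a) refl_negb.
apply: (partitive_involution v0 aut2) => //.
  by move=> v; apply: node_eq; rewrite ?sE2 ?sE3 ?reflK.
by move=> v E; apply: (refl_neq (ltn_ord v.1) ev); rewrite -sE2 E.
Qed.

End Symmetries.

(** * Choice of a plan from the number of occupied corners *)

Section Box.
Variables (m n k : nat).
Local Notation V := (node m n).
Implicit Types (u v x y T : V) (s : {perm V}).

Lemma ends_eq N t t' i : t < N -> t' < N -> i < N -> ends N t t' -> ends N t' i = ends N t i.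
Proof. rewrite /ends; lia. Qed.

Lemma between_eq N t t' i : t < N -> t' < N -> i < N -> ends N t t' ->
  between N t' i = between N t i.
Proof.
move=> ht ht' hi /orP[/eqP->//|/eqP e]; rewrite /between.
have -> : t = N.-1 - t' by lia.
lia.
Qed.

Lemma inX_eq T0 T : inX T0 T -> inX T =1 inX T0.
Proof.
by move=> /andP[h1 h2] x; rewrite /inX (ends_eq _ _ _ h1) // (ends_eq _ _ _ h2).
Qed.

Lemma inbox_eq T0 T : inX T0 T -> inbox T =1 inbox T0.
Proof.
by move=> /andP[h1 h2] x; rewrite /inbox (between_eq _ _ _ h1) // (between_eq _ _ _ h2).
Qed.

Lemma centered_eq T0 T : inX T0 T -> centered T0 -> centered T.
Proof.
move=> /andP[h1 h2] [c1 c2 c3]; split.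
- by move=> /c1; move: h1 (ltn_ord T.1) (ltn_ord T0.1); rewrite /ends; clear; lia.
- by move=> /c2; move: h2 (ltn_ord T.2) (ltn_ord T0.2); rewrite /ends; clear; lia.
move=> mn; have := c3 mn; move: h1 h2 mn (ltn_ord T.1) (ltn_ord T0.1) (ltn_ord T.2) (ltn_ord T0.2).
by rewrite /ends; clear; lia.
Qed.

Lemma oppK : involutive (@opp m n).
Proof. by case=> a b; rewrite /opp /= !rev_ordK. Qed.

Lemma inX_small T u : gap T.1 (m.-1 - T.1) == 1 -> gap T.2 (n.-1 - T.2) == 1 ->
  inbox T u -> inX T u.
Proof.
move=> g1 g2 /andP[b1 b2].
have e N (i t : nat) : t < N -> i < N -> gap t (N.-1 - t) == 1 -> between N t i -> ends N t i.
  by rewrite /gap /between /ends; clear; lia.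
by apply/andP; split; apply: e.
Qed.

(** The excluded node exists only in a 2 x 2 box, all of whose nodes are corners. *)
Lemma inW_intro T u : inbox T u -> u != opp T \/ (exists w, inbox T w /\ ~~ inX T w) -> inW T u.
Proof.
move=> bu h; rewrite /inW bu; apply/negP => /and3P[g1 g2 /eqP E].
by case: h => [|[w [bw /negP nw]]]; [rewrite E eqxx | apply: nw; apply: inX_small].
Qed.

Lemma degenerate1 T : T.1 + T.1 + 1 = m -> flip1 T = T /\ opp T = flip2 T.
Proof.
move=> e; have E : rev_ord T.1 = T.1.
  by apply: ord_inj; rewrite rev_val; move: e (ltn_ord T.1); clear; lia.
by rewrite /flip1 /opp E; case: (T).
Qed.

Lemma degenerate2 T : T.2 + T.2 + 1 = n -> flip2 T = T /\ opp T = flip1 T.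
Proof.
move=> e; have E : rev_ord T.2 = T.2.
  by apply: ord_inj; rewrite rev_val; move: e (ltn_ord T.2); clear; lia.
by rewrite /flip2 /opp E; case: (T).
Qed.

(** One or three occupied corners designate a target whatever the symmetries; the other numbers are
    left as hypotheses. More than two occupied corners imply that no dimension is degenerate. *)
Lemma gather_by_corners (p0 : 'I_k -> V) T0 :
  3 <= k -> injective p0 -> centered T0 -> (forall r, inbox T0 (p0 r)) ->
  ((forall r, ~~ inX T0 (p0 r)) -> gatherable p0) ->
  (forall u v, u != v -> inX T0 u -> inX T0 v ->
     (forall x, inX T0 x -> (conf p0 x != 0) = (x == u) || (x == v)) -> gatherable p0) ->
  (T0.1 + T0.1 + 1 != m -> T0.2 + T0.2 + 1 != n ->
     (forall x, inX T0 x -> conf p0 x != 0) -> gatherable p0) ->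
  gatherable p0.
Proof.
move=> k3 p0_inj c0 b0 H0 H2 H4.
pose S := [set x | inX T0 x && (conf p0 x != 0)].
have inS x : (x \in S) = inX T0 x && (conf p0 x != 0) by rewrite inE.
case: (posnP #|S|) => [/cards0_eq S0|S_gt0].
  by apply: H0 => r; apply/negP => X; have := inS (p0 r); rewrite S0 inE X conf_at.
have box T r : inX T0 T -> inbox T (p0 r) by move=> XT; rewrite (inbox_eq XT).
case: (ltngtP #|S| 1) => [|S_gt1|/eqP/cards1P[T ST]]; first by rewrite ltnNge S_gt0.
  case: (ltngtP #|S| 2) => [|S_gt2|/eqP/cards2P[u [v [uv SE]]]]; first by rewrite ltnNge S_gt1.
    have nd1 : T0.1 + T0.1 + 1 != m.
      apply/eqP => e; have [e1 e2] := degenerate1 e.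
      have : #|S| <= #|[set T0; flip2 T0]|.
        apply/subset_leq_card/subsetP => x; rewrite inS !inE => /andP[/inXP h _].
        by case: h => ->; rewrite ?e1 ?e2 eqxx ?orbT.
      by rewrite cards2 leqNgt; case: (_ != _); rewrite /= ?S_gt2 // ltnW.
    have nd2 : T0.2 + T0.2 + 1 != n.
      apply/eqP => e; have [e1 e2] := degenerate2 e.
      have : #|S| <= #|[set T0; flip1 T0]|.
        apply/subset_leq_card/subsetP => x; rewrite inS !inE => /andP[/inXP h _].
        by case: h => ->; rewrite ?e1 ?e2 eqxx ?orbT.
      by rewrite cards2 leqNgt; case: (_ != _); rewrite /= ?S_gt2 // ltnW.
    case: (boolP [forall x, inX T0 x ==> (conf p0 x != 0)]) => [/forallP all4|].
      by apply: H4 => // x Xx; have := all4 x; rewrite Xx.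
    rewrite negb_forall => /existsP[o']; rewrite negb_imply negbK => /andP[Xo' /eqP o0].
    set T := opp o'.
    have XT : inX T0 T by rewrite -(inX_eq Xo') inX_opp.
    have oT : opp T = o' by rewrite /T oppK.
    have cT := centered_eq XT c0.
    have T1 : T.1 + T.1 + 1 != m.
      case/andP: XT => e _; move: e nd1 (ltn_ord T.1) (ltn_ord T0.1); rewrite /ends; clear; lia.
    have T2 : T.2 + T.2 + 1 != n.
      case/andP: XT => _ e; move: e nd2 (ltn_ord T.2) (ltn_ord T0.2); rewrite /ends; clear; lia.
    have noopp r : p0 r != opp T.
      by apply/eqP => E; have := conf_at p0 r; rewrite E oT o0.
    have SE : S = [set T; flip1 T; flip2 T].
      apply/eqP; rewrite eqEcard; apply/andP; split.
        apply/subsetP => x; rewrite inS -(inX_eq XT) !inE => /andP[/inXP h nz].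
        case: h nz => ->; rewrite ?eqxx ?orbT // oT o0 eqxx //.
      apply: leq_trans S_gt2; rewrite setUC cardsU1 cards2.
      by case: (_ \notin _); case: (_ != _).
    have occ x : x \in S -> exists r, p0 r = x by rewrite inS => /andP[_ /conf_gt0].
    have [b bT] : exists r, p0 r = T by apply: occ; rewrite SE !inE eqxx.
    have [q1 q1x] : exists r, p0 r = flip1 T by apply: occ; rewrite SE !inE eqxx orbT.
    have [q2 q2y] : exists r, p0 r = flip2 T by apply: occ; rewrite SE !inE eqxx ?orbT.
    apply: (@gather_three m n k p0 T cT p0_inj _ T1 T2 b q1 q2) => // r.
    by apply: inW_intro; [exact: box | left].
  have Xu : inX T0 u by have := inS u; rewrite SE !inE eqxx => /esym/andP[].
  have Xv : inX T0 v by have := inS v; rewrite SE !inE eqxx orbT => /esym/andP[].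
  apply: (H2 u v) => // x Xx; have := inS x; rewrite SE !inE Xx => ->; by [].
have := inS T; rewrite ST inE eqxx => /esym/andP[XT /conf_gt0[r rT]].
have only q : inX T0 (p0 q) -> q = r.
  move=> X; apply: p0_inj; rewrite rT; apply/eqP; have := inS (p0 q).
  by rewrite ST inE X conf_at.
have [q [qr _]] := third_robot r r k3.
have cT := centered_eq XT c0.
apply: (@gather_unique m n k p0 T cT p0_inj _ r rT).
  move=> q'; apply: inW_intro; [exact: box | right]; exists (p0 q); split; first exact: box.
  by rewrite (inX_eq XT); apply: contraNN qr => /only->.
by move=> q'; rewrite (inX_eq XT) => /only.
Qed.

Lemma inner_score_eq T0 T x g : inX T0 T -> inner_score T x g = inner_score T0 x g.
Proof. by move=> XT; apply: eq_bigl => v; rewrite (inX_eq XT). Qed.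

Lemma third_inner (p0 : 'I_k -> V) T0 u v : 3 <= k -> injective p0 ->
  (forall x, inX T0 x -> (conf p0 x != 0) = (x == u) || (x == v)) ->
  exists q, ~~ inX T0 (p0 q).
Proof.
move=> k3 p0_inj occ.
case: (excluded_middle_informative (exists q, ~~ inX T0 (p0 q))) => // nex.
have X r : inX T0 (p0 r) by apply/negPn/negP => h; apply: nex; exists r.
have two r : p0 r = u \/ p0 r = v.
  by have := occ _ (X r); rewrite conf_at => /esym/orP[] /eqP; [left | right].
have r0 : 'I_k := Ordinal (ltnW (ltnW k3)).
have [r1 [h1 _]] := third_robot r0 r0 k3; have [r2 [h2 h3]] := third_robot r0 r1 k3.
have ne a b : a != b -> p0 a <> p0 b by move=> /eqP ab /p0_inj.
have := ne _ _ h1; have := ne _ _ h2; have := ne _ _ h3.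
by case: (two r0) => ->; case: (two r1) => ->; case: (two r2) => ->.
Qed.

(** Both corners are fixed by all symmetries, so the one of larger score can be the target. *)
Lemma gather_two_best (p0 : 'I_k -> V) T0 u v : 3 <= k -> injective p0 -> centered T0 ->
  (forall r, inbox T0 (p0 r)) -> u != v -> inX T0 u -> inX T0 v ->
  (forall x, inX T0 x -> (conf p0 x != 0) = (x == u) || (x == v)) ->
  (forall s, is_aut s -> config_map s (conf p0) (conf p0) -> s u = u /\ s v = v) ->
  gatherable p0.
Proof.
move=> k3 p0_inj c0 b0.
wlog le : u v / inner_score T0 v (conf p0) <= inner_score T0 u (conf p0).
  move=> wl uv Xu Xv occ stab.
  case: (leqP (inner_score T0 v (conf p0)) (inner_score T0 u (conf p0))) => [le|/ltnW le].
    exact: (wl u v).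
  apply: (wl v u) => //; first by rewrite eq_sym.
    by move=> x /occ ->; rewrite orbC.
  by move=> s auts /(stab s auts)[].
move=> uv Xu Xv occ stab.
have cu := centered_eq Xu c0.
have [q nq] := third_inner k3 p0_inj occ.
have occr x : inX T0 x -> (x == u) || (x == v) -> exists r, p0 r = x.
  by move=> Xx; rewrite -occ // => /conf_gt0.
have [b bu] : exists r, p0 r = u by apply: occr; rewrite ?eqxx.
have [b' b'v] : exists r, p0 r = v by apply: occr; rewrite ?eqxx ?orbT.
apply: (@gather_two m n k p0 u cu p0_inj _ b b' v k3 bu b'v).
- move=> r; apply: inW_intro; first by rewrite (inbox_eq Xu).
  by right; exists (p0 q); rewrite (inbox_eq Xu) (inX_eq Xu).
- by rewrite eq_sym.
- move=> r; rewrite (inX_eq Xu) -!(inj_eq p0_inj) bu b'v.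
  case: (boolP (inX T0 (p0 r))) => [X|nX]; first by rewrite -occ // conf_at.
  by apply/esym/norP; split; apply: contraNneq nX => ->.
- by rewrite !(inner_score_eq _ _ Xu).
by move=> s auts /(stab s auts)[].
Qed.

Definition opp_perm : {perm V} := perm (can_inj oppK).

Lemma opp_perm_aut : is_aut opp_perm.
Proof.
move=> u v; rewrite !permE !adj_dist; congr (_ == 1).
have rr N (i j : 'I_N) : gap (rev_ord i) (rev_ord j) = gap i j.
  by rewrite !rev_val; have := ltn_ord i; have := ltn_ord j; rewrite /gap; clear; lia.
by rewrite !distE !rr.
Qed.

(** The half-turn preserves the set of corners and fixes no node. Hence, in a non-partitive
    configuration with four occupied corners, some robot is off the corners. *)
Lemma full_corners_partitive (p0 : 'I_k -> V) T0 : centered T0 -> injective p0 ->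
  T0.1 + T0.1 + 1 != m -> (forall x, inX T0 x -> conf p0 x != 0) ->
  (forall r, inX T0 (p0 r)) -> partitive (conf p0).
Proof.
move=> c0 p0_inj T1 occ allX.
have ev : ~~ odd m by apply: contra T1; case: c0 => c _ _ /c ->.
have cE v : conf p0 v = inX T0 v.
  case: (boolP (inX T0 v)) => [/occ nz|nX].
    apply/eqP; rewrite eqn_leq lt0n nz andbT; apply: conf_le1 => r r' h h'.
    by apply: p0_inj; rewrite h h'.
  by apply/eqP/negPn/negP => /conf_gt0[r rv]; rewrite -rv allX in nX.
apply: (@partitive_involution m n opp_perm _ T0 opp_perm_aut).
- by move=> v; rewrite !permE oppK.
- move=> v; rewrite permE => /(congr1 (fun w : V => w.1 : nat)) E.
  have : rev_ord v.1 = v.1 :> nat := E.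
  by rewrite rev_val; move: ev (ltn_ord v.1); clear; lia.
by move=> v; rewrite !cE (aut_inXE _ c0 opp_perm_aut).
Qed.

(** The box is the whole grid, and since the symmetries fix every candidate, the one of maximal
    score is taken. *)
Lemma gather_asymmetric (p0 : 'I_k -> V) T0 : 3 <= k -> injective p0 -> centered T0 ->
  (forall v, inbox T0 v) -> ~ partitive (conf p0) ->
  (forall s, is_aut s -> config_map s (conf p0) (conf p0) -> forall x, inX T0 x -> s x = x) ->
  gatherable p0.
Proof.
move=> k3 p0_inj c0 b0 np fixX.
have box T : inX T0 T -> forall v, inbox T v by move=> XT v; rewrite (inbox_eq XT).
apply: (@gather_by_corners p0 T0) => //.
- move=> noX.
  have [T XT Tmax] := arg_maxnP (fun x => pair_score x (conf p0)) (inX_T T0).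
  apply: (@gather_free m n k p0 T k3 (centered_eq XT c0) p0_inj).
  + move=> r; apply: inW_intro; first exact: box.
    by right; exists (p0 r); rewrite (inX_eq XT); split=> //; apply: box.
  + by move=> r; rewrite (inX_eq XT).
  + by move=> x; rewrite (inX_eq XT) => /Tmax.
  by move=> s auts sm; apply: fixX.
- move=> u v uv Xu Xv occ; apply: (gather_two_best k3 p0_inj c0 _ uv Xu Xv occ) => //.
  by move=> s auts sm; split; apply: fixX.
move=> T1 T2 occ.
have [T XT Tmax] := arg_maxnP (fun x => inner_score T0 x (conf p0)) (inX_T T0).
have [a na] : exists a, ~~ inX T0 (p0 a).
  case: (excluded_middle_informative (exists a, ~~ inX T0 (p0 a))) => // nex; case: np.
  apply: (full_corners_partitive c0 p0_inj T1 occ) => r.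
  by apply/negPn/negP => h; apply: nex; exists r.
have T1' : T.1 + T.1 + 1 != m.
  case/andP: XT => e _; move: e T1 (ltn_ord T.1) (ltn_ord T0.1); rewrite /ends; clear; lia.
have T2' : T.2 + T.2 + 1 != n.
  case/andP: XT => _ e; move: e T2 (ltn_ord T.2) (ltn_ord T0.2); rewrite /ends; clear; lia.
have occT x : inX T x -> exists r, p0 r = x by rewrite (inX_eq XT) => /occ/conf_gt0.
have [b bT] := occT _ (inX_T T); have [q1 q1x] := occT _ (inX_flip1 T).
have [q2 q2y] := occT _ (inX_flip2 T); have [q3 q3o] := occT _ (inX_opp T).
apply: (@gather_four m n k p0 T (centered_eq XT c0) p0_inj _ T1' T2' b q1 q2 q3 a) => //.
- move=> r; apply: inW_intro; first exact: box.
  by right; exists (p0 a); rewrite (inX_eq XT); split=> //; apply: box.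
- by rewrite (inX_eq XT).
- by move=> x; rewrite (inX_eq XT) !(inner_score_eq _ _ XT) => /Tmax.
by move=> s auts sm; apply: fixX.
Qed.

End Box.

(** * Even squares with a diagonal symmetry *)

Section Diagonal.
Variables (m n k : nat).
Local Notation V := (node m n).
Implicit Types (u v x y T : V) (s : {perm V}) (g : V -> nat).

Lemma flips_opp T : flip1 (opp T) = flip2 T /\ flip2 (opp T) = flip1 T.
Proof. by rewrite /flip1 /flip2 /opp /= !rev_ordK. Qed.

Lemma side_count_eq T0 T u v g : inX T0 T -> side_count T u v g = side_count T0 u v g.
Proof. by move=> XT; apply: eq_bigr => w _; rewrite /on_side (inX_eq XT). Qed.

Lemma side_moment_eq T0 T u v g : inX T0 T -> side_moment T u v g = side_moment T0 u v g.
Proof. by move=> XT; apply: eq_bigr => w _; rewrite /on_side (inX_eq XT). Qed.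

Lemma side_count_gt0 (p0 : 'I_k -> V) T0 u v : (forall r, ~~ inX T0 (p0 r)) ->
  0 < side_count T0 u v (conf p0) <-> exists r, side u v (p0 r).
Proof.
move=> noX; split=> [|[r sr]].
  rewrite lt0n sum_nat_eq0 => /forallPn[w]; rewrite negb_imply /= muln_eq0 negb_or.
  by case/andP => /conf_gt0[r <-]; rewrite eqb0 negbK => /andP[sd _]; exists r.
rewrite /side_count (bigD1 (p0 r)) //= ltn_addr // muln_gt0 lt0n conf_at.
by rewrite /on_side sr noX.
Qed.

(** The candidates are the corners on the axis, [T0] and [opp T0], compared by the quantity of the
    relevant plan. The excluded occupation is the one where [delta] exchanges the two occupied
    corners. A robot on the edge of the box is what the plan along the sides starts from. *)
Lemma gather_diagonal (p0 : 'I_k -> V) T0 delta c :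
  3 <= k -> injective p0 -> m = n -> ~~ odd m -> ~ partitive (conf p0) ->
  is_aut delta -> config_map delta (conf p0) (conf p0) -> transposing c delta ->
  delta T0 = T0 -> centered T0 ->
  (forall r, inbox T0 (p0 r)) ->
  (exists r, ends m T0.1 (p0 r).1 || ends n T0.2 (p0 r).2) ->
  ~ [/\ conf p0 (flip1 T0) <> 0, conf p0 (flip2 T0) <> 0,
        conf p0 T0 = 0 & conf p0 (opp T0) = 0] ->
  gatherable p0.
Proof.
move=> k3 p0_inj mn ev np autd dp0 dE dT c0 b0 [r0 edge] not2.
have ev' : ~~ odd n by rewrite -mn.
have T1 : T0.1 + T0.1 + 1 != m by apply: contra ev => /eqP <-; rewrite addn1 /= addnn odd_double.
have T2 : T0.2 + T0.2 + 1 != n by apply: contra ev' => /eqP <-; rewrite addn1 /= addnn odd_double.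
have stab s : is_aut s -> config_map s (conf p0) (conf p0) -> s T0 = T0.
  move=> auts sm; case: (config_aut_cases T0 auts sm np) => [[a [b [ha hb sE]]]|[_ h]].
    have a0 : a = false by apply/negP => /ha; apply/negP.
    have b00 : b = false by apply/negP => /hb; apply/negP.
    by have [e1 e2] := sE T0; apply: node_eq; rewrite ?e1 ?e2 /refl ?a0 ?b00.
  have {h} [b sE] : exists b, transposing b s.
    by case: h => // -[od]; rewrite od in ev.
  case: (eqVneq b c) => [E|bc].
    by rewrite -[RHS]dT; have [e1 e2] := sE T0; have [e3 e4] := dE T0;
      apply: node_eq; rewrite ?e1 ?e2 ?e3 ?e4 E.
  (* [s] reflects in the other diagonal: its composition with [delta] is the half-turn, which fixes
     no node of an even grid. *)
  have bE : b = ~~ c by case: (b) (c) bc => [] [].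
  have re : refl m = refl n by rewrite /refl mn.
  have e1 v : ((delta * s)%g v).1 = refl m true v.1 :> nat.
    rewrite permM; have [h1 _] := sE (delta v); have [_ h2] := dE v; rewrite h1 h2 bE -re.
    by rewrite -{2}(negbK c) refl_negb.
  have e2 v : ((delta * s)%g v).2 = refl n true v.2 :> nat.
    rewrite permM; have [_ h1] := sE (delta v); have [h2 _] := dE v; rewrite h1 h2 bE re.
    by rewrite -{2}(negbK c) refl_negb.
  case: np; apply: (partitive_involution T0 (is_autM autd auts)); last exact: config_mapM.
    by move=> v; apply: node_eq; rewrite ?e1 ?e2 reflK.
  by move=> v E; apply: (refl_neq (ltn_ord v.1) ev); rewrite -e1 E.
have nb : neighbours T0 (flip1 T0) (flip2 T0) by left.
have [xT xo xy yT yo] := neighbours_neq T1 T2 nb.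
have dopp : delta (opp T0) = opp T0 := aut_opp c0 T1 T2 autd dT.
have [d1 d2] : delta (flip1 T0) = flip2 T0 /\ delta (flip2 T0) = flip1 T0.
  case: (aut_neighbours c0 T1 T2 autd dT nb) => // -[d1 _]; exfalso.
  have [e1 _] := dE (flip1 T0); have [e2 _] := dE T0; rewrite d1 in e1; rewrite dT in e2.
  have : rev_ord T0.1 = T0.1 :> nat by rewrite e2 -e1.
  by rewrite rev_val; move: T1 (ltn_ord T0.1); clear; lia.
have sq : dist T0 (flip1 T0) = dist T0 (flip2 T0) by have := aut_dist T0 (flip1 T0) autd; rewrite dT d1.
have stab_opp s : is_aut s -> config_map s (conf p0) (conf p0) -> s (opp T0) = opp T0.
  by move=> auts sm; apply: aut_opp => //; apply: stab.
have Xo := inX_opp T0; have co := centered_eq Xo c0.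
have T1o : (opp T0).1 + (opp T0).1 + 1 != m.
  by apply: contra ev => /eqP <-; rewrite addn1 /= addnn odd_double.
have T2o : (opp T0).2 + (opp T0).2 + 1 != n.
  by apply: contra ev' => /eqP <-; rewrite addn1 /= addnn odd_double.
have [fo1 fo2] := flips_opp T0.
have bo r : inbox (opp T0) (p0 r) by rewrite (inbox_eq Xo).
have dconf x : conf p0 (delta x) = conf p0 x by apply: dp0.
apply: (@gather_by_corners m n k p0 T0 k3 p0_inj c0 b0).
- move=> noX.
  have noXo r : ~~ inX (opp T0) (p0 r) by rewrite (inX_eq Xo).
  have W0 r : inW T0 (p0 r) by apply: inW_intro => //; right; exists (p0 r).
  have Wo r : inW (opp T0) (p0 r) by apply: inW_intro => //; right; exists (p0 r).
  pose N u v := side_count T0 u v (conf p0); pose M u v := side_moment T0 u v (conf p0).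
  have Nx : N T0 (flip2 T0) = N T0 (flip1 T0).
    by have := side_count_aut c0 T0 (flip1 T0) autd dp0; rewrite dT d1.
  have No : N (opp T0) (flip2 T0) = N (opp T0) (flip1 T0).
    by have := side_count_aut c0 (opp T0) (flip1 T0) autd dp0; rewrite dopp d1.
  have Mx : M T0 (flip2 T0) = M T0 (flip1 T0).
    by have := side_moment_aut c0 T0 (flip1 T0) autd dp0; rewrite dT d1.
  have Mo : M (opp T0) (flip2 T0) = M (opp T0) (flip1 T0).
    by have := side_moment_aut c0 (opp T0) (flip1 T0) autd dp0; rewrite dopp d1.
  have goT : 0 < N T0 (flip1 T0) -> N T0 (flip1 T0) <> N (opp T0) (flip1 T0) \/
      M T0 (flip1 T0) <= M (opp T0) (flip1 T0) -> gatherable p0.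
    move=> /(side_count_gt0 _ _ noX)[a sa] choice.
    apply: (@gather_sides m n k p0 T0 c0 p0_inj W0 T1 T2 delta a) => //.
    by rewrite sa.
  have goO : 0 < N (opp T0) (flip1 T0) -> N T0 (flip1 T0) <> N (opp T0) (flip1 T0) \/
      M (opp T0) (flip1 T0) <= M T0 (flip1 T0) -> gatherable p0.
    move=> /(side_count_gt0 _ _ noX)[a sa] choice.
    apply: (@gather_sides m n k p0 (opp T0) co p0_inj Wo T1o T2o delta a) => //.
    + by rewrite fo1 fo2.
    + by rewrite fo1 fo2.
    + by rewrite fo1 fo2 sa orbT.
    rewrite fo1 oppK !(side_count_eq _ _ _ Xo) !(side_moment_eq _ _ _ Xo).
    rewrite -/(N _ _) -/(N _ _) -/(M _ _) -/(M _ _) Nx No Mx Mo.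
    by case: choice => [ne|le]; [left => E; apply: ne | right].
  (* The edge robot is on a side ending at [T0] or at [opp T0]; [delta] makes both sides at that
     corner equally populated. *)
  have some : 0 < N T0 (flip1 T0) \/ 0 < N (opp T0) (flip1 T0).
    have [b1 b2] : between m T0.1 (p0 r0).1 /\ between n T0.2 (p0 r0).2 by case/andP: (b0 r0).
    have mem u v : side u v (p0 r0) -> 0 < N u v.
      by move=> sd; apply/(side_count_gt0 _ _ noX); exists r0.
    have NC u v : N u v = N v u := side_countC _ _ _ _.
    case/orP: edge => /orP[] /eqP e.
    + by left; rewrite -Nx; apply: mem; rewrite sideT2E // e.
    + right; rewrite NC; apply: mem; rewrite side1E //.
      by apply/eqP; move: e (ltn_ord (p0 r0).1); clear; lia.
    + by left; apply: mem; rewrite sideT1E // e.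
    right; rewrite -No NC; apply: mem; rewrite side2E //.
    by apply/eqP; move: e (ltn_ord (p0 r0).2); clear; lia.
  case: (eqVneq (N T0 (flip1 T0)) (N (opp T0) (flip1 T0))) => [E|/eqP ne].
    have gt0 : 0 < N T0 (flip1 T0) by case: some; rewrite -?E.
    case: (leqP (M T0 (flip1 T0)) (M (opp T0) (flip1 T0))) => [le|/ltnW le].
      by apply: goT => //; right.
    by apply: goO; [rewrite -E | right].
  by case: some => gt0; [apply: goT | apply: goO] => //; left.
- move=> u v uv Xu Xv occ.
  suff [uT vT] : (u = T0 \/ u = opp T0) /\ (v = T0 \/ v = opp T0).
    apply: (gather_two_best k3 p0_inj c0 b0 uv Xu Xv occ) => s auts sm.
    by case: uT => ->; case: vT => ->; rewrite ?stab ?stab_opp.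
  (* The occupied pair is invariant under [delta], so it contains both exchanged corners or
     neither. *)
  have inv x : inX T0 x -> (delta x == u) || (delta x == v) = (x == u) || (x == v).
    by move=> Xx; rewrite -!occ // ?aut_inXE // dconf.
  have [Xf1 Xf2] := neighbours_inX nb.
  have i1 := inv _ Xf1; rewrite d1 in i1.
  case: (boolP ((flip1 T0 == u) || (flip1 T0 == v))) i1 => [f1|f1] i1; last first.
    move/norP: (f1) => [n1 n2]; move/norP: i1 => -[n3 n4].
    by split; [case: (neighbours_cover nb Xu) | case: (neighbours_cover nb Xv)] => E;
      try (by left); try (by right); move: n1 n2 n3 n4; rewrite E eqxx.
  exfalso; apply: not2.
  have uvE : (u = flip1 T0 /\ v = flip2 T0) \/ (u = flip2 T0 /\ v = flip1 T0).
    case/orP: f1 => /eqP E; rewrite E in xy *; case/orP: i1 => /eqP E'; rewrite E' in xy *;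
      rewrite ?eqxx // in xy; by [left | right].
  have occE x : inX T0 x -> (conf p0 x != 0) = (x == flip1 T0) || (x == flip2 T0).
    by move=> /occ ->; case: uvE => -[-> ->]; rewrite // orbC.
  split.
  + by apply/eqP; rewrite occE // eqxx.
  + by apply/eqP; rewrite occE // eqxx orbT.
  + by apply/eqP; rewrite -[_ == _]negbK occE ?inX_T // negb_or !(eq_sym T0) xT yT.
  by apply/eqP; rewrite -[_ == _]negbK occE // negb_or !(eq_sym (opp T0)) xo yo.
move=> _ _ occ.
have [a na] : exists a, ~~ inX T0 (p0 a).
  case: (excluded_middle_informative (exists a, ~~ inX T0 (p0 a))) => // nex; case: np.
  apply: (full_corners_partitive c0 p0_inj T1 occ) => r.
  by apply/negPn/negP => h; apply: nex; exists r.
have W0 r : inW T0 (p0 r) by apply: inW_intro => //; right; exists (p0 a).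
have Wo r : inW (opp T0) (p0 r).
  by apply: inW_intro => //; right; exists (p0 a); rewrite (inX_eq Xo).
have [Xf1 Xf2] := neighbours_inX nb.
have [b bT] := conf_gt0 _ _ (occ _ (inX_T T0)); have [q1 q1x] := conf_gt0 _ _ (occ _ Xf1).
have [q2 q2y] := conf_gt0 _ _ (occ _ Xf2); have [q3 q3o] := conf_gt0 _ _ (occ _ Xo).
pose I x := inner_score T0 x (conf p0); pose C x := total_closeness x (conf p0).
have [better|better] : (I (opp T0) < I T0 \/ I (opp T0) = I T0 /\ C (opp T0) <= C T0) \/
    (I T0 < I (opp T0) \/ I T0 = I (opp T0) /\ C T0 <= C (opp T0)) by clear; lia.
  exact: (@gather_four_square m n k p0 T0 c0 p0_inj W0 T1 T2 b q1 q2 q3 a).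
apply: (@gather_four_square m n k p0 (opp T0) co p0_inj Wo T1o T2o q3 q2 q1 b a) => //.
- by rewrite fo1.
- by rewrite fo2.
- by rewrite oppK.
- by rewrite (inX_eq Xo).
- rewrite fo1 fo2; have [e1 _ _ _] := neighbours_dist T1 T2 nb.
  have [e2 _ _ _] := neighbours_dist T1 T2 (neighboursC nb).
  by rewrite ![dist (opp T0) _]distC e1 e2.
by rewrite oppK !(inner_score_eq _ _ Xo).
Qed.

End Diagonal.

Lemma MES_exists m n (g : node m n -> nat) v0 : g v0 != 0 -> exists a, is_MES g a.
Proof.
move=> g0.
pose okb a := [forall v, (g v != 0) ==>
  [&& a <= v.1, v.1 <= m.-1 - a, a <= v.2 & v.2 <= n.-1 - a]].
have okP a : reflect (mes_ok g a) (okb a).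
  apply: (iffP forallP) => h v; first by move=> gv; have := h v; rewrite gv => /and4P.
  by apply/implyP => gv; apply/and4P; apply: h.
have ex0 : exists a, okb a.
  exists 0; apply/okP => v _; have := ltn_ord v.1; have := ltn_ord v.2.
  by split; rewrite ?subn0 //; lia.
have bnd a : okb a -> a <= v0.1 by move=> /okP/(_ v0 g0)[].
have [a /okP oka amax] := ex_maxnP ex0 bnd.
by exists a; split=> // b /okP; apply: amax.
Qed.

Theorem theorem11 (m n k : nat) (p0 : 'I_k -> node m n) :
  3 <= k -> injective p0 ->
  ~ partitive (conf p0) -> ~ is_2S2 (conf p0) ->
  gatherable p0.
Proof.
move=> k3 p0_inj np not2.
pose r0 : 'I_k := Ordinal (ltnW (ltnW k3)).
pose v0 := p0 r0; have m_gt0 : 0 < m := leq_ltn_trans (leq0n _) (ltn_ord v0.1).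
have n_gt0 : 0 < n := leq_ltn_trans (leq0n _) (ltn_ord v0.2).
case: (excluded_middle_informative ([/\ m = n, ~~ odd m & exists delta c,
    [/\ is_aut delta, config_map delta (conf p0) (conf p0) & transposing c delta]]))
  => [[mn ev [delta [c [autd dp0 dE]]]]|nodiag]; last first.
  (* The remaining symmetries reflect odd dimensions only, where X lies on the median line, or else
     act on an odd square, where X is the centre: X is fixed pointwise. *)
  have [||T0 [e1 e2]] := @node_ex m n (if odd m then m./2 else 0) (if odd n then n./2 else 0).
  - by case: ifP => // o; lia.
  - by case: ifP => // o; lia.
  have c0 : centered T0.
    by split=> [o|o|mn]; [rewrite e1 o; lia | rewrite e2 o; lia | left; rewrite e1 e2 mn].
  have b0 v : inbox T0 v.
    rewrite /inbox /between e1 e2; have := ltn_ord v.1; have := ltn_ord v.2.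
    by case: (boolP (odd m)) => o1; case: (boolP (odd n)) => o2; lia.
  apply: (gather_asymmetric k3 p0_inj c0 b0 np) => s auts sm x /andP[x1 x2].
  have mid N i : odd N -> ends N N./2 i -> i = N./2 by rewrite /ends; lia.
  have fixmid N a : odd N -> refl N a N./2 = N./2 by rewrite /refl; case: a; lia.
  rewrite e1 e2 in x1 x2.
  case: (config_aut_cases v0 auts sm np) => [[a [b [ha hb sE]]]|[mn h]].
    have [h1 h2] := sE x; apply: node_eq; rewrite ?h1 ?h2.
      by case: a ha {sE h1} => // /(_ isT) o; rewrite o in x1; rewrite (mid _ _ o x1) fixmid.
    by case: b hb {sE h2} => // /(_ isT) o; rewrite o in x2; rewrite (mid _ _ o x2) fixmid.
  case: (boolP (odd m)) => [od|ev]; last first.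
    by case: nodiag; split=> //; case: h => [[od]|[b sE]]; [rewrite od in ev | exists s, b].
  have od' : odd n by rewrite -mn.
  rewrite od in x1; rewrite od' in x2.
  have E1 := mid _ _ od x1; have E2 := mid _ _ od' x2.
  have [a [b sE]] : exists a b, forall v,
      (s v).1 = refl n a v.2 :> nat /\ (s v).2 = refl m b v.1 :> nat.
    by case: h => [[_ //]|[b sE]]; exists b, b.
  have [h1 h2] := sE x; apply: node_eq; rewrite ?h1 ?h2.
    by rewrite E2 fixmid // E1; clear -mn; lia.
  by rewrite E1 fixmid // E2; clear -mn; lia.
have [a [ok amax]] := MES_exists (conf_at p0 r0).
have okr r := ok (p0 r) (conf_at p0 r).
have [a1 a2 a3 a4] := okr r0.
have alt : a + a + 1 < n by clear -a1 a2 mn ev m_gt0; lia.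
(* The corner of the MES in row [a] that lies on the axis of [delta]. *)
have [||T0 [e1 e2]] := @node_ex m n a (refl n c a).
- by lia.
- by rewrite /refl; case: (c); lia.
have reE i : refl m c i = refl n c i by rewrite /refl mn.
have dT : delta T0 = T0.
  have [h1 h2] := dE T0; apply: node_eq; rewrite ?h1 ?h2 e1 e2 ?reE // reflK //; lia.
have c0 : centered T0.
  split=> [o|o|_]; [by rewrite o in ev | by rewrite mn o in ev |].
  by rewrite e1 e2 /refl; case: (c); [right | left]; lia.
have b0 r : inbox T0 (p0 r).
  have [h1 h2 h3 h4] := okr r; rewrite /inbox /between e1 e2.
  by move: h1 h2 h3 h4 alt; rewrite /refl; case: (c); clear -mn; lia.
apply: (@gather_diagonal m n k p0 T0 delta c) => //.
  (* Otherwise all robots would be strictly inside the square, and [a.+1] would contradict the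
     maximality of [a]. *)
  case: (excluded_middle_informative
    (exists r, ends m T0.1 (p0 r).1 || ends n T0.2 (p0 r).2)) => // nex.
  have : mes_ok (conf p0) a.+1.
    move=> v /conf_gt0[r <-]; have [h1 h2 h3 h4] := okr r.
    have := (fun h => nex (ex_intro _ r h)); rewrite /ends e1 e2 => ne.
    have {}ne : ~~ [|| ((p0 r).1 == a :> nat) || ((p0 r).1 + a + 1 == m),
        (p0 r).2 == refl n c a :> nat | (p0 r).2 + refl n c a + 1 == n].
      by apply/negP => h; apply: ne.
    by split; move: ne h1 h2 h3 h4 alt; rewrite /refl; case: (c); clear -mn; lia.
  by move=> /amax; rewrite ltnn.
have occP (z : node m n) i j : z.1 = i :> nat -> z.2 = j :> nat -> conf p0 z <> 0 ->
    occupied (conf p0) i j by move=> <- <- /eqP nz; exists z.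
have emptyP (z : node m n) i j : z.1 = i :> nat -> z.2 = j :> nat -> conf p0 z = 0 ->
    ~ occupied (conf p0) i j.
  by move=> h1 h2 z0 [w [w1 w2]]; rewrite (node_eq (u := w) (v := z)) ?z0 // ?h1 ?h2.
have f11 : (flip1 T0).1 = n.-1 - a :> nat by have := rev_val T0.1; rewrite /= e1 => ->; rewrite mn.
have f12 : (flip1 T0).2 = refl n c a :> nat := e2.
have f21 : (flip2 T0).1 = a :> nat := e1.
have f22 : (flip2 T0).2 = n.-1 - refl n c a :> nat by rewrite -e2; apply: rev_val.
have o1 : (opp T0).1 = n.-1 - a :> nat := f11.
have o2 : (opp T0).2 = n.-1 - refl n c a :> nat := f22.
have aK : n.-1 - (n.-1 - a) = a by clear -alt; lia.
(* The remaining occupation is the 2S2 one; [c] tells which diagonal is the axis, and the occupied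
   corners are those of the other diagonal. *)
move=> [x_occ y_occ T_emp o_emp]; apply: not2; split=> //; first by move: ev; rewrite mn.
exists a; split=> //=; case: c dE reE e2 f12 f22 o2 => dE reE e2 f12 f22 o2;
  rewrite /refl ?aK in e2 f12 f22 o2; [left | right]; do !split.
- exact: occP f21 f22 y_occ.
- exact: occP f11 f12 x_occ.
- exact: emptyP e1 e2 T_emp.
- exact: emptyP o1 o2 o_emp.
- move=> v w w1 w2; rewrite -(dp0 v); congr (conf _ _); have [h1 h2] := dE v.
  by apply: node_eq; rewrite ?h1 ?h2 ?reE; [apply: w1 | apply: w2].
- exact: occP f21 f22 y_occ.
- exact: occP f11 f12 x_occ.
- exact: emptyP e1 e2 T_emp.
- exact: emptyP o1 o2 o_emp.
move=> v w w1 w2; rewrite -(dp0 v); congr (conf _ _); have [h1 h2] := dE v.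
by apply: node_eq; rewrite ?h1 ?h2; [apply: w1 | apply: w2].
Qed.
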